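(* Consider the setting, the data and the family of analytic solutions $(u_p(t,z,\epsilon))_{0\le p\le\varsigma-1}$ described in the context, and let $0<\beta'<\beta$. Let $p\in\{0,\ldots,\varsigma-1\}$ and assume that the infinite sectors $U_{\mathfrak{d}_p}$ and $U_{\mathfrak{d}_{p+1}}$ have empty intersection. Then the following statements hold. (1) There exist $K_3>0$ and $K_4\in\mathbb{R}$ such that $$|u_{p+1}(t,z,\epsilon)-u_p(t,z,\epsilon)|\le K_3\exp\left(-\frac{k_1}{2\log(q)}\log^2|\epsilon t|\right)|\epsilon t|^{K_4}$$ for every $t\in\mathcal{T}$, $z\in H_{\beta'}$ and $\epsilon\in\mathcal{E}_p\cap\mathcal{E}_{p+1}$. (2) There exist $K_3>0$ and $K_4\in\mathbb{R}$ such that $$|u_{p+1}(t,z,\epsilon)-u_p(t,z,\epsilon)|\le K_3q^{\frac{K_4^2}{2k_1}}\left(q^{-\frac{K_4}{k_1}}\right)^Nq^{\frac{N^2}{2k_1}}|\epsilon t|^N$$ for every $t\in\mathcal{T}$, $z\in H_{\beta'}$, $\epsilon\in\mathcal{E}_p\cap\mathcal{E}_{p+1}$ and all integers $N\ge0$.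
   Context: Notation. $D(z_0,r)$ is the open disc, $\overline{D}(z_0,r)$ its closure, $\mathbb{C}^\star=\mathbb{C}\setminus\{0\}$, $H_b=\{z\in\mathbb{C}:|\mathrm{Im}(z)|<b\}$. For $q>1$ and $\delta>0$, $\sigma_{q,t}^{\delta}(f)(t)=f(q^{\delta}t)$ and $\sigma_{q,t}=\sigma_{q,t}^1$. $\mathcal{O}(V)$ is the set of holomorphic functions on an open set $V\subseteq\mathbb{C}^h$. For continuous $f:\mathbb{R}\to\mathbb{C}$ with $|f(m)|\le C(1+|m|)^{-\mu}e^{-\beta|m|}$, $\mathcal{F}^{-1}(f)(x)=\frac{1}{\sqrt{2\pi}}\int_{-\infty}^\infty f(m)e^{ixm}dm$, which extends holomorphically to $H_\beta$. Jacobi Theta function of order $k>0$: $\Theta_{q^{1/k}}(z)=\sum_{n\in\mathbb{Z}}q^{-\frac{n(n-1)}{2k}}z^n$, $z\in\mathbb{C}^\star$. $q$-Laplace transform of order $k$ along direction $d$: $\mathcal{L}_{q;1/k}^{d}(f(u))(T)=\frac{k}{\log(q)}\int_{L_{d}}\frac{f(u)}{\Theta_{q^{1/k}}(u/T)}\frac{du}{u}$, $L_d=[0,\infty)e^{\sqrt{-1}d}$. The equation. Let $q>1$, $1\le k_1<k_2$ real, $\frac1\kappa=\frac1{k_1}-\frac1{k_2}$; $D,D_1,D_2\ge3$ integers, $d_{D_1},d_{D_2}$ positive integers; for $1\le j\le D-1$, $\Delta_j\ge0$ and $d_j,\delta_j\ge1$ integers with $\delta_1=1$, $\delta_j<\delta_{j+1}$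 ($1\le j\le D-2$). Assume for $1\le j\le D-1$: $\Delta_j\ge d_j$, $\frac{d_{D_1}-1}{\kappa}+\frac{d_j}{k_2}+1\ge\delta_j$, $\frac{d_j}{k_1}+1\ge\delta_j$, $\frac{d_{D_2}-1}{k_2}\ge\delta_j-1$; and $k_1(d_{D_2}-1)>k_2d_{D_1}$. Let $\mu>0$ and $Q,R_1,\dots,R_{D-1},R_{D_1},R_{D_2}\in\mathbb{C}[X]$ with $\mu>\deg(R_{D_j})+1$, $Q(im)\ne0$, $R_{D_j}(im)\neq0$ for $m\in\mathbb{R}$, $j=1,2$, and $\deg Q\ge\deg R_{D_1}=\deg R_{D_2}\ge\max_{1\le\ell\le D-1}\deg R_\ell$. The equation is $$Q(\partial_z)\sigma_{q,t}u=\sum_{j=1}^{2}(\epsilon t)^{d_{D_j}}\sigma_{q,t}^{\frac{d_{D_j}}{k_j}+1}R_{D_j}(\partial_z)u+\sum_{\ell=1}^{D-1}\epsilon^{\Delta_{\ell}}t^{d_{\ell}}\sigma_{q,t}^{\delta_{\ell}}\big(c_{\ell}(t,z,\epsilon)R_{\ell}(\partial_z)u\big)+\sigma_{q,t}f(t,z,\epsilon)\qquad(E)$$ for $u=u(t,z,\epsilon)$. Let $\beta>0$, $0<\epsilon_0<1$, $T_0>0$. Here $c_\ell(t,z,\epsilon)=\mathcal{F}^{-1}(m\mapsto\sum_{n\ge0}C_{\ell,n}(m,\epsilon)(\epsilon t)^n)(z)$, $f(t,z,\epsilon)=\mathcal{F}^{-1}(m\mapsto\sum_{n\ge0}F_n(m,\epsilon)(\epsilon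 t)^n)(z)$, with $C_{\ell,n},F_n$ continuous in $m\in\mathbb{R}$, holomorphic in $\epsilon\in D(0,\epsilon_0)$, and for all $m\in\mathbb{R}$, $n\ge0$: $\sup_{\epsilon\in D(0,\epsilon_0)}|C_{\ell,n}(m,\epsilon)|\le\Delta_{C,\ell}T_0^{-n}q^{-\frac{n^2\kappa}{2k_1k_2}}(1+|m|)^{-\mu}e^{-\beta|m|}$, $\sup_{\epsilon\in D(0,\epsilon_0)}|F_n(m,\epsilon)|\le\Delta_FT_0^{-n}(1+|m|)^{-\mu}e^{-\beta|m|}$, for constants $\Delta_{C,\ell},\Delta_F>0$. Geometry. $\varsigma\ge2$ is an integer and $(\mathcal{E}_p)_{0\le p\le\varsigma-1}$ is a good covering in $\mathbb{C}^\star$: each $\mathcal{E}_p$ is an open sector of positive radius with vertex at $0$, $\mathcal{E}_j\cap\mathcal{E}_k\ne\emptyset$ iff $|j-k|\le1$ (convention $\mathcal{E}_\varsigma:=\mathcal{E}_0$), and $\bigcup_p\mathcal{E}_p=\mathcal{U}\setminus\{0\}$ for some neighborhood $\mathcal{U}$ of $0$; also $\mathcal{E}_p\subseteq D(0,\epsilon_0)$. All indices $p+1$ are read with index $\varsigma$ identified with $0$. Let $\alpha,\nu\in\mathbb{R}$, $\nu<1/2$, and let $\mathcal{T}\subseteq D(0,r_{\mathcal{T}})$, $0<r_{\mathcal{T}}<1$, be an open bounded sector with vertex at $0$ such that $\nu+\frac{k_2}{\log q}\log(r_{\mathcal{T}})<0$, $\alpha+\frac{\kappa}{\log q}\log(\epsilon_0r_{\mathcal{T}})<0$,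 $\epsilon_0r_{\mathcal{T}}\le q^{(\frac12-\nu)/k_2}/2$. For directions $\mathfrak{d}_p\in\mathbb{R}$ and fixed $0<\tilde\delta<1$ put $\mathcal{R}_{\mathfrak{d}_p,\tilde\delta}=\{T\in\mathbb{C}^\star:|1+\frac{re^{i\mathfrak{d}_p}}{T}|>\tilde\delta\text{ for all }r\ge0\}$, $\mathcal{R}^b_{\mathfrak{d}_p}=\mathcal{R}_{\mathfrak{d}_p,\tilde\delta}\cap D(0,\epsilon_0r_{\mathcal{T}})$. For $j=1,2$, $Q(im)/R_{D_j}(im)$ ($m\in\mathbb{R}$) takes values in an unbounded sector $S_{Q,R_{D_j}}=\{z:|z|\ge r_{Q,R_{D_j}},|\arg(z)-d_{Q,R_{D_j}}|\le\nu_{Q,R_{D_j}}\}$ with $r_{Q,R_{D_j}},\nu_{Q,R_{D_j}}>0$; let $q_{\ell,j}(m)$, $0\le\ell\le d_{D_j}-1$, be the roots of $P_{m,j}(\tau)=\frac{Q(im)}{(q^{1/k_j})^{k_j(k_j-1)/2}}-\frac{R_{D_j}(im)}{(q^{1/k_j})^{(d_{D_j}+k_j)(d_{D_j}+k_j-1)/2}}\tau^{d_{D_j}}$. The number $\rho>0$, the directions $\mathfrak{d}_p$ and the infinite sectors $U_{\mathfrak{d}_p},S_{\mathfrak{d}_p}$ with vertex $0$ and bisecting direction $\mathfrak{d}_p$ are such that, for some positive constants $M_1,M_2,M_{12},M_{22}$ and all $m\in\mathbb{R}$ and all $\ell$: $|\tau-q_{\ell,1}(m)|\ge M_1(1+|\tau|)$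 and $|\tau-q_{\ell,1}(m)|\ge M_2|q_{\ell,1}(m)|$ for $\tau\in U_{\mathfrak{d}_p}\cup\overline D(0,\rho)$; $|\tau-q_{\ell,2}(m)|\ge M_{12}(1+|\tau|)$ and $|\tau-q_{\ell,2}(m)|\ge M_{22}|q_{\ell,2}(m)|$ for $\tau\in S_{\mathfrak{d}_p}$. Moreover $\mathcal{R}^b_{\mathfrak{d}_p}\cap\mathcal{R}^b_{\mathfrak{d}_{p+1}}\neq\emptyset$, and $\epsilon t\in\mathcal{R}^b_{\mathfrak{d}_p}$ for all $t\in\mathcal{T}$, $\epsilon\in\mathcal{E}_p$. The solutions $u_p$. It is assumed that $r_{Q,R_{D_1}},r_{Q,R_{D_2}}$ are large enough and $\Delta_{C,\ell}$ ($1\le\ell\le D-1$), $\Delta_F$ small enough for the following known construction (Dreyfus–Lastra–Malek) to apply: for each $p$ there is a solution of (E), $u_p\in\mathcal{O}(\mathcal{T}\times H_{\beta'}\times\mathcal{E}_p)$ for every $0<\beta'<\beta$, given by $$u_p(t,z,\epsilon)=\frac{1}{(2\pi)^{1/2}}\frac{k_2}{\log(q)}\int_{-\infty}^{\infty}\int_{L_{\mathfrak{d}_p}}\frac{w^{\mathfrak{d}_p}_{k_2}(u,m,\epsilon)}{\Theta_{q^{1/k_2}}\left(\frac{u}{\epsilon t}\right)}\frac{du}{u}e^{izm}dm,$$ with functions $w^{\mathfrak{d}_p}_{k_2}$ and auxiliary functions $w^{\mathfrak{d}_p}_{k_1}$ having the following properties. (W1) $w_{k_2}^{\mathfrak{d}_p}$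 is continuous on $S_{\mathfrak{d}_p}\times\mathbb{R}\times D(0,\epsilon_0)$, holomorphic in its first and third variables, and for some $C>0$, $\sup_{\epsilon\in D(0,\epsilon_0)}|w_{k_2}^{\mathfrak{d}_p}(u,m,\epsilon)|\le C(1+|m|)^{-\mu}e^{-\beta|m|}\exp(\frac{k_2}{2\log q}\log^2|u|+\nu\log|u|)$ for $u\in S_{\mathfrak{d}_p}$, $m\in\mathbb{R}$. (W2) $w_{k_1}^{\mathfrak{d}_p}$ is continuous on $(U_{\mathfrak{d}_p}\cup\overline D(0,\rho))\times\mathbb{R}\times\mathcal{E}_p$, holomorphic in its first and third variables on $U_{\mathfrak{d}_p}\cup D(0,\rho)$ and $\mathcal{E}_p$, and for some $C_{p,1}>0$ and small $\delta>0$, $\sup_{\epsilon\in\mathcal{E}_p}|w_{k_1}^{\mathfrak{d}_p}(u,m,\epsilon)|\le C_{p,1}(1+|m|)^{-\mu}e^{-\beta|m|}\exp(\frac{\kappa}{2}\frac{\log^2|u+\delta|}{\log q}+\alpha\log|u+\delta|)$. (W3) $\tau\mapsto\mathcal{L}^{\mathfrak{d}_p}_{q;1/\kappa}(w_{k_1}^{\mathfrak{d}_p}(u,m,\epsilon))(\tau)$ is holomorphic on $\mathcal{R}_{\mathfrak{d}_p,\tilde\delta}\cap D(0,r_1)$ for $0<r_1\le q^{(\frac12-\alpha)/\kappa}/2$ and equals $w_{k_2}^{\mathfrak{d}_p}(\tau,m,\epsilon)$ for $\tau$ in a finite sector $S^b_{\mathfrak{d}_p}$ of bisecting direction $\mathfrak{d}_p$,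 $m\in\mathbb{R}$, $\epsilon\in\mathcal{E}_p$. (W4) If $U_{\mathfrak{d}_p}\cap U_{\mathfrak{d}_{p+1}}=\emptyset$, there exist $K_{31}>0$, $K_{41}\in\mathbb{R}$ with $|\mathcal{L}^{\mathfrak{d}_{p+1}}_{q;1/\kappa}(w_{k_1}^{\mathfrak{d}_{p+1}})(\tau)-\mathcal{L}^{\mathfrak{d}_p}_{q;1/\kappa}(w_{k_1}^{\mathfrak{d}_p})(\tau)|\le K_{31}e^{-\beta|m|}(1+|m|)^{-\mu}\exp(-\frac{\kappa}{2\log q}\log^2|\tau|)|\tau|^{K_{41}}$ for $\tau\in\mathcal{R}^b_{\mathfrak{d}_p}\cap\mathcal{R}^b_{\mathfrak{d}_{p+1}}$, $m\in\mathbb{R}$, $\epsilon\in\mathcal{E}_p\cap\mathcal{E}_{p+1}$. *)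

(* Defs.v *)
From Stdlib Require Export Reals List.
From Coquelicot Require Export Coquelicot.

Open Scope R_scope.

Definition Cexp (z : C) : C := (exp (Re z) * cos (Im z), exp (Re z) * sin (Im z)).

Definition cis (th : R) : C := (cos th, sin th).

(** Coquelicot's [Series] is real-valued: complex series are summed
    componentwise. *)
Definition CSeries (a : nat -> C) : C :=
  (Series (fun n => Re (a n)), Series (fun n => Im (a n))).

Definition disc (r : R) (z : C) : Prop := Cmod z < r.

Definition strip (b : R) (z : C) : Prop := Rabs (Im z) < b.

Definition holomorphic_on (V : C -> Prop) (f : C -> C) : Prop :=
  forall z, V z -> ex_derive (K := C_AbsRing) (V := C_NormedModule) f z.

(** Complex Frechet differentiability with respect to three variables. *)
Definition holomorphic3_on (V : C * C * C -> Prop) (f : C -> C -> C -> C) : Prop :=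
  forall x, V x ->
    ex_filterdiff (K := C_AbsRing)
      (U := prod_NormedModule C_AbsRing
              (prod_NormedModule C_AbsRing C_NormedModule C_NormedModule)
              C_NormedModule)
      (V := C_NormedModule)
      (fun y => f (fst (fst y)) (snd (fst y)) (snd y)) (locally x).

Definition line_int (f : R -> C) : C :=
  RInt_gen (V := C_R_CompleteNormedModule) f
    (Rbar_locally m_infty) (Rbar_locally p_infty).

(** Path integral of [g] along the half-line [L_d], with [u = r e^{id}] and
    [du = e^{id} dr]. *)
Definition ray_int (d : R) (g : C -> C) : C :=
  RInt_gen (V := C_R_CompleteNormedModule)
    (fun r => Cmult (g (Cmult (RtoC r) (cis d))) (cis d))
    (at_right 0) (Rbar_locally p_infty).

Definition inv_fourier (f : R -> C) (x : C) : C :=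
  (RtoC (/ sqrt (2 * PI)) * line_int (fun m => f m * Cexp (Ci * x * RtoC m)))%C.

(** The sum over [n < 0] is reindexed by [n = - (i + 1)], so that
    [n (n - 1) = (i + 1) (i + 2)]. *)
Definition Theta (q k : R) (z : C) : C :=
  (CSeries (fun n => RtoC (Rpower q (- (INR n * (INR n - 1) / (2 * k)))) * z ^ n)
   + CSeries (fun i =>
       RtoC (Rpower q (- ((INR i + 1) * (INR i + 2) / (2 * k)))) * (/ z) ^ (S i)))%C.

Definition qLaplace (q k d : R) (f : C -> C) (T : C) : C :=
  (RtoC (k / ln q) * ray_int d (fun u => f u / Theta q k (u / T) / u))%C.

(** Sectors have vertex [0] and bisecting direction [d]; the half-opening
    [eta] is at most [PI]. *)
Definition infinite_sector (d : R) (A : C -> Prop) : Prop :=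
  exists eta, 0 < eta <= PI /\
    forall z, A z <->
      exists r th, 0 < r /\ Rabs (th - d) < eta /\ z = (RtoC r * cis th)%C.

Definition finite_sector (d : R) (A : C -> Prop) : Prop :=
  exists eta r0, 0 < eta <= PI /\ 0 < r0 /\
    forall z, A z <->
      exists r th, 0 < r < r0 /\ Rabs (th - d) < eta /\ z = (RtoC r * cis th)%C.

(** [{ z : |z| >= r0, |arg z - d| <= nu }] *)
Definition outer_sector (r0 d nu : R) (z : C) : Prop :=
  exists r th, r0 <= r /\ Rabs (th - d) <= nu /\ z = (RtoC r * cis th)%C.

(** Polynomials over [C]: coefficient lists, lowest degree first, with a
    nonzero last entry; the zero polynomial is the empty list, of degree 0 by
    convention. *)
Record Cpoly := MkCpoly {
  coefs :> list C;
  coefs_normal : last coefs (RtoC 1) <> RtoC 0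
}.

Definition deg (P : Cpoly) : nat := (length P - 1)%nat.

Definition coef (P : Cpoly) (n : nat) : C := nth n P (RtoC 0).

Definition peval (P : Cpoly) (x : C) : C :=
  sum_n (fun n => (coef P n * x ^ n)%C) (deg P).

(** [P(d/dz) v], for [v] a function of [(t, z, eps)]. *)
Definition pdz (P : Cpoly) (v : C -> C -> C -> C) (t z e : C) : C :=
  sum_n (fun n => (coef P n * Nat.iter n C_derive (fun x => v t x e) z)%C) (deg P).

Class setting := {
  q : R; k1 : R; k2 : R;
  nD : nat; nD1 : nat; nD2 : nat;  (* [nD1], [nD2] occur only as the labels $D_1$, $D_2$ *)
  dD : nat -> nat;              (* [dD j] is $d_{D_j}$, j = 1, 2 *)
  Delta : nat -> nat; d : nat -> nat; delta : nat -> nat;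
  mu : R; beta : R; eps0 : R; T0 : R;
  Q : Cpoly; Rl : nat -> Cpoly;
  RD : nat -> Cpoly;            (* [RD j] is $R_{D_j}$, j = 1, 2 *)
  Ccoef : nat -> nat -> R -> C -> C; Fcoef : nat -> R -> C -> C;
  DeltaC : nat -> R; DeltaF : R;
  vsig : nat;                   (* number $\varsigma$ of sectors of the covering *)
  Eps : nat -> C -> Prop;       (* $\mathcal{E}_p$ *)
  alpha : R; nu : R;
  Tau : C -> Prop; rTau : R;
  dir : nat -> R; tdelta : R;
  rQ : nat -> R; dQ : nat -> R; nuQ : nat -> R;  (* $S_{Q,R_{D_j}}$, j = 1, 2 *)
  qroot : nat -> nat -> R -> C; (* [qroot l j m] is $q_{\ell,j}(m)$ *)
  rho : R;
  Usec : nat -> C -> Prop; Ssec : nat -> C -> Prop;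
  Sfin : nat -> C -> Prop;      (* the finite sector $S^b_{\mathfrak{d}_p}$ *)
  wk1 : nat -> C -> R -> C -> C; wk2 : nat -> C -> R -> C -> C;
  u : nat -> C -> C -> C -> C
}.

Definition kappa {X : setting} : R := / (/ k1 - / k2).

Definition kj {X : setting} (j : nat) : R := match j with 1%nat => k1 | _ => k2 end.

Definition shift {X : setting} (s : R) (v : C -> C -> C -> C) (t z e : C) : C :=
  v (RtoC (Rpower q s) * t)%C z e.

Definition weight {X : setting} (m : R) : R :=
  Rpower (1 + Rabs m) (- mu) * exp (- beta * Rabs m).

Definition cfun {X : setting} (l : nat) (t z e : C) : C :=
  inv_fourier (fun m => CSeries (fun n => Ccoef l n m e * (e * t) ^ n)%C) z.

Definition ffun {X : setting} (t z e : C) : C :=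
  inv_fourier (fun m => CSeries (fun n => Fcoef n m e * (e * t) ^ n)%C) z.

Definition equation_at {X : setting} (v : C -> C -> C -> C) (t z e : C) : Prop :=
  pdz Q (shift 1 v) t z e =
  (sum_n_m (fun j =>
      (e * t) ^ dD j * shift (INR (dD j) / kj j + 1) (pdz (RD j) v) t z e) 1 2
   + sum_n_m (fun l =>
      e ^ Delta l * t ^ d l *
      shift (INR (delta l))
        (fun t' z' e' => cfun l t' z' e' * pdz (Rl l) v t' z' e') t z e) 1 (nD - 1)
   + shift 1 ffun t z e)%C.

(** All terms of the equation make sense at [(t, z, e)] for a function of [t] in
    [Tau]: the dilated times stay in [Tau], and the power series in [e t]
    defining the forcing term converges at the dilated time. *)
Definition equation_domain {X : setting} (t e : C) : Prop :=
  Tau t /\ Tau (RtoC q * t)%C /\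
  (forall j, (1 <= j <= 2)%nat ->
     Tau (RtoC (Rpower q (INR (dD j) / kj j + 1)) * t)%C) /\
  (forall l, (1 <= l <= nD - 1)%nat -> Tau (RtoC (Rpower q (INR (delta l))) * t)%C) /\
  q * Cmod (e * t)%C < T0.

Record equation_assumptions {X : setting} : Prop := {
  q_gt1 : 1 < q;
  k_order : 1 <= k1 /\ k1 < k2;
  nD_ge3 : (3 <= nD)%nat /\ (3 <= nD1)%nat /\ (3 <= nD2)%nat;
  dD_pos : (1 <= dD 1)%nat /\ (1 <= dD 2)%nat;
  d_delta_pos : forall j, (1 <= j <= nD - 1)%nat -> (1 <= d j)%nat /\ (1 <= delta j)%nat;
  delta_1 : delta 1 = 1%nat;
  delta_incr : forall j, (1 <= j <= nD - 2)%nat -> (delta j < delta (S j))%nat;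
  exponents : forall j, (1 <= j <= nD - 1)%nat ->
    (d j <= Delta j)%nat /\
    (INR (dD 1) - 1) / kappa + INR (d j) / k2 + 1 >= INR (delta j) /\
    INR (d j) / k1 + 1 >= INR (delta j) /\
    (INR (dD 2) - 1) / k2 >= INR (delta j) - 1;
  exponents_D : k1 * (INR (dD 2) - 1) > k2 * INR (dD 1);
  mu_pos : 0 < mu;
  mu_deg : forall j, (1 <= j <= 2)%nat -> mu > INR (deg (RD j)) + 1;
  Q_nonzero : forall m : R, peval Q (Ci * RtoC m)%C <> RtoC 0;
  RD_nonzero : forall j (m : R), (1 <= j <= 2)%nat ->
    peval (RD j) (Ci * RtoC m)%C <> RtoC 0;
  degrees : (deg (RD 1) <= deg Q)%nat /\ deg (RD 1) = deg (RD 2) /\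
    (forall l, (1 <= l <= nD - 1)%nat -> (deg (Rl l) <= deg (RD 2))%nat);
  beta_pos : 0 < beta;
  eps0_range : 0 < eps0 < 1;
  T0_pos : 0 < T0;
  DeltaC_pos : forall l, (1 <= l <= nD - 1)%nat -> 0 < DeltaC l;
  DeltaF_pos : 0 < DeltaF;
  Ccoef_continuous : forall l n e (m : R), (1 <= l <= nD - 1)%nat -> disc eps0 e ->
    continuous (fun m => Ccoef l n m e) m;
  Ccoef_holomorphic : forall l n m, (1 <= l <= nD - 1)%nat ->
    holomorphic_on (disc eps0) (Ccoef l n m);
  Ccoef_bound : forall l n m e, (1 <= l <= nD - 1)%nat -> disc eps0 e ->
    Cmod (Ccoef l n m e) <=
      DeltaC l * / T0 ^ n * Rpower q (- (INR n ^ 2 * kappa / (2 * k1 * k2))) * weight m;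
  Fcoef_continuous : forall n e (m : R), disc eps0 e ->
    continuous (fun m => Fcoef n m e) m;
  Fcoef_holomorphic : forall n m, holomorphic_on (disc eps0) (Fcoef n m);
  Fcoef_bound : forall n m e, disc eps0 e ->
    Cmod (Fcoef n m e) <= DeltaF * / T0 ^ n * weight m
}.

(** Index [p + 1], with [vsig] identified with [0]. *)
Definition next {X : setting} (p : nat) : nat := Nat.modulo (S p) vsig.

Definition good_covering {X : setting} : Prop :=
  (forall p, (p < vsig)%nat -> exists th, finite_sector th (Eps p)) /\
  (forall j k, (j < vsig)%nat -> (k < vsig)%nat ->
     ((exists z, Eps j z /\ Eps k z) <-> (j = k \/ k = next j \/ j = next k))) /\
  (exists V : C -> Prop, locally (RtoC 0) V /\
     forall z, (exists p, (p < vsig)%nat /\ Eps p z) <-> (V z /\ z <> RtoC 0)).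

(** $\mathcal{R}_{\mathfrak{d},\tilde\delta}$ *)
Definition Rset {X : setting} (th : R) (T : C) : Prop :=
  T <> RtoC 0 /\ forall r : R, 0 <= r -> Cmod (1 + RtoC r * cis th / T)%C > tdelta.

(** $\mathcal{R}^b_{\mathfrak{d}}$ *)
Definition Rbset {X : setting} (th : R) (T : C) : Prop :=
  Rset th T /\ disc (eps0 * rTau) T.

Definition Pm {X : setting} (m : R) (j : nat) (tau : C) : C :=
  let qk := Rpower q (1 / kj j) in
  (peval Q (Ci * RtoC m) / RtoC (Rpower qk (kj j * (kj j - 1) / 2))
   - peval (RD j) (Ci * RtoC m)
     / RtoC (Rpower qk ((INR (dD j) + kj j) * (INR (dD j) + kj j - 1) / 2))
     * tau ^ dD j)%C.

Record geometry_assumptions {X : setting} : Prop := {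
  vsig_ge2 : (2 <= vsig)%nat;
  covering : good_covering;
  Eps_small : forall p e, (p < vsig)%nat -> Eps p e -> disc eps0 e;
  nu_lt : nu < 1 / 2;
  rTau_range : 0 < rTau < 1;
  Tau_sector : exists th, finite_sector th Tau;
  Tau_small : forall t, Tau t -> disc rTau t;
  nu_rTau : nu + k2 / ln q * ln rTau < 0;
  alpha_rTau : alpha + kappa / ln q * ln (eps0 * rTau) < 0;
  eps0_rTau : eps0 * rTau <= Rpower q ((1 / 2 - nu) / k2) / 2;
  tdelta_range : 0 < tdelta < 1;
  rQ_nuQ_pos : forall j, (1 <= j <= 2)%nat -> 0 < rQ j /\ 0 < nuQ j;
  Q_over_RD : forall j (m : R), (1 <= j <= 2)%nat ->
    outer_sector (rQ j) (dQ j) (nuQ j)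
      (peval Q (Ci * RtoC m) / peval (RD j) (Ci * RtoC m))%C;
  (* [Pm m j] has exactly [dD j] roots, all simple, hence this enumerates them *)
  qroot_roots : forall j m tau, (1 <= j <= 2)%nat ->
    (Pm m j tau = RtoC 0 <-> exists l, (l < dD j)%nat /\ tau = qroot l j m);
  rho_pos : 0 < rho;
  Usec_sector : forall p, (p < vsig)%nat -> infinite_sector (dir p) (Usec p);
  Ssec_sector : forall p, (p < vsig)%nat -> infinite_sector (dir p) (Ssec p);
  roots_separated : exists M1 M2 M12 M22 : R,
    0 < M1 /\ 0 < M2 /\ 0 < M12 /\ 0 < M22 /\
    (forall p l (m : R) tau, (p < vsig)%nat -> (l < dD 1)%nat ->
       Usec p tau \/ Cmod tau <= rho ->
       Cmod (tau - qroot l 1 m)%C >= M1 * (1 + Cmod tau) /\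
       Cmod (tau - qroot l 1 m)%C >= M2 * Cmod (qroot l 1 m)) /\
    (forall p l (m : R) tau, (p < vsig)%nat -> (l < dD 2)%nat ->
       Ssec p tau ->
       Cmod (tau - qroot l 2 m)%C >= M12 * (1 + Cmod tau) /\
       Cmod (tau - qroot l 2 m)%C >= M22 * Cmod (qroot l 2 m));
  Rb_meet : forall p, (p < vsig)%nat ->
    exists T, Rbset (dir p) T /\ Rbset (dir (next p)) T;
  Rb_contains : forall p t e, (p < vsig)%nat -> Tau t -> Eps p e ->
    Rbset (dir p) (e * t)%C
}.

Definition Usec_disjoint {X : setting} (p : nat) : Prop :=
  forall z, ~ (Usec p z /\ Usec (next p) z).

Definition Lwk1 {X : setting} (p : nat) (m : R) (e tau : C) : C :=
  qLaplace q kappa (dir p) (fun v => wk1 p v m e) tau.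

Record W1 {X : setting} (p : nat) : Prop := {
  wk2_continuous :
    continuous_on
      (T := prod_UniformSpace (prod_UniformSpace C_UniformSpace R_UniformSpace)
              C_UniformSpace) (U := C_UniformSpace)
      (fun x => Ssec p (fst (fst x)) /\ disc eps0 (snd x))
      (fun x => wk2 p (fst (fst x)) (snd (fst x)) (snd x));
  wk2_holomorphic_u : forall m e, disc eps0 e ->
    holomorphic_on (Ssec p) (fun v => wk2 p v m e);
  wk2_holomorphic_e : forall v m, Ssec p v -> holomorphic_on (disc eps0) (wk2 p v m);
  wk2_bound : exists C0, 0 < C0 /\ forall v m e, Ssec p v -> disc eps0 e ->
    Cmod (wk2 p v m e) <=
      C0 * weight m * exp (k2 / (2 * ln q) * ln (Cmod v) ^ 2 + nu * ln (Cmod v))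
}.

Record W2 {X : setting} (p : nat) : Prop := {
  wk1_continuous :
    continuous_on
      (T := prod_UniformSpace (prod_UniformSpace C_UniformSpace R_UniformSpace)
              C_UniformSpace) (U := C_UniformSpace)
      (fun x => (Usec p (fst (fst x)) \/ Cmod (fst (fst x)) <= rho) /\ Eps p (snd x))
      (fun x => wk1 p (fst (fst x)) (snd (fst x)) (snd x));
  wk1_holomorphic_u : forall m e, Eps p e ->
    holomorphic_on (fun v => Usec p v \/ disc rho v) (fun v => wk1 p v m e);
  wk1_holomorphic_e : forall v m, Usec p v \/ disc rho v ->
    holomorphic_on (Eps p) (wk1 p v m);
  (* At [v = - dlt] the right-hand side is infinite, so the bound says nothing
     there; this point is excluded because [ln 0] has a junk value. *)
  wk1_bound : exists Cp1 dlt, 0 < Cp1 /\ 0 < dlt /\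
    forall v m e, Usec p v \/ Cmod v <= rho -> Eps p e -> (v + RtoC dlt)%C <> RtoC 0 ->
    Cmod (wk1 p v m e) <=
      Cp1 * weight m *
      exp (kappa / 2 * (ln (Cmod (v + RtoC dlt)%C) ^ 2 / ln q)
           + alpha * ln (Cmod (v + RtoC dlt)%C))
}.

Record W3 {X : setting} (p : nat) : Prop := {
  Lwk1_holomorphic : forall r1 m e,
    0 < r1 <= Rpower q ((1 / 2 - alpha) / kappa) / 2 -> Eps p e ->
    holomorphic_on (fun tau => Rset (dir p) tau /\ disc r1 tau) (Lwk1 p m e);
  Sfin_sector : finite_sector (dir p) (Sfin p);
  (* the equality is asserted wherever both sides are known to be defined *)
  Lwk1_eq_wk2 : forall tau m e,
    Sfin p tau -> Ssec p tau -> Rset (dir p) tau ->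
    Cmod tau < Rpower q ((1 / 2 - alpha) / kappa) / 2 -> Eps p e ->
    Lwk1 p m e tau = wk2 p tau m e
}.

Definition W4 {X : setting} (p : nat) : Prop :=
  Usec_disjoint p ->
  exists K31 K41, 0 < K31 /\
    forall tau m e,
      Rbset (dir p) tau -> Rbset (dir (next p)) tau -> Eps p e -> Eps (next p) e ->
      Cmod (Lwk1 (next p) m e tau - Lwk1 p m e tau)%C <=
        K31 * weight m * exp (- (kappa / (2 * ln q)) * ln (Cmod tau) ^ 2)
        * Rpower (Cmod tau) K41.

Record solution_assumptions {X : setting} : Prop := {
  u_holomorphic : forall p beta', (p < vsig)%nat -> 0 < beta' < beta ->
    holomorphic3_on
      (fun x => Tau (fst (fst x)) /\ strip beta' (snd (fst x)) /\ Eps p (snd x)) (u p);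
  u_solves : forall p t z e, (p < vsig)%nat ->
    equation_domain t e -> strip beta z -> Eps p e -> equation_at (u p) t z e;
  u_formula : forall p t z e, (p < vsig)%nat -> Tau t -> strip beta z -> Eps p e ->
    u p t z e =
    (RtoC (/ sqrt (2 * PI)) * RtoC (k2 / ln q) *
     line_int (fun m =>
       ray_int (dir p) (fun v => wk2 p v m e / Theta q k2 (v / (e * t)) / v)
       * Cexp (Ci * z * RtoC m)))%C;
  u_W1 : forall p, (p < vsig)%nat -> W1 p;
  u_W2 : forall p, (p < vsig)%nat -> W2 p;
  u_W3 : forall p, (p < vsig)%nat -> W3 p;
  u_W4 : forall p, (p < vsig)%nat -> W4 p
}.

(* Main.v *)
Require Import Defs.
From Stdlib Require Import Lra Lia Psatz.

(** Write [T = e * t] and [L = ln q]. Up to a constant, [u p t z e] is the Fourier integral in [m] of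
    the integral of [wk2 p v m e / Theta q k2 (v / T)] against [dv / v] along the ray of direction
    [dir p]. It suffices to compare these inner integrals for [p] and [next p] at fixed [m],
    with a bound that is [weight m] times a function of [|T|]; since [beta' < beta] the weight
    leaves an integrable factor ([u_difference]).

    Close to the vertex [wk2 p] coincides on its ray with [Lwk1 p], which is holomorphic in every
    direction not opposite to [dir p]. Cauchy's theorem turns the initial segment of the ray,
    up to radius [e^x0], into the segment of the same length that points in the direction of [T].
    The turn takes the shorter way round, so it stays away both from the direction
    opposite to [dir p] and from the one opposite to [T], where [Theta q k2 (v / T)] has its zeros:
    both facts follow from [T] being in [Rset (dir p)] by the monotonicity of [|1 + r cis psi|]
    in [|psi|] ([seen_mono]). The directions [dir p] and [dir (next p)] thus lead to one and the same
    segment ([rotated_ray_int]), and what separates the two inner integrals is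
    - the tails beyond [e^x0] and the arcs at radius [e^x0], where the kernel
      contributes [exp (- k2 / (2 L) * ln^2 |T|)] times a power of [|T|];
    - the integral over the common segment, where the flatness assumption [W4] gives
      a Gaussian of order [kappa] in [ln |v|] and the kernel one of order [k2] in
      [ln |v / T|]. Completing the square leaves order [k1], because
      [1 / k1 = 1 / kappa + 1 / k2] ([growth_combine]).
    As [k1 < k2], the second term is the larger one. The bounds for all [N] follow from the first
    bound, because [exp (- k1 / (2 L) * x^2 + (K4 - N) * x)] is at most
    [q^((K4 - N)^2 / (2 k1))].

    The analysis behind this rests on three facts. The kernel bound [theta_lower] comes from Jacobi's
    triple product, whose factors are bounded below one by one on a fundamental annulus and carried to
    all radii by the functional equation. Cauchy's theorem is Goursat's theorem on rectangles, applied
    in the coordinate [ln v] ([goursat], [log_cauchy]). Finally, every improper integral has to be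
    shown to exist before it can be estimated: the integrands are continuous and decay exponentially
    in [ln |v|], respectively in [m] ([dominated_line_int], [line_int_param_cont]). *)

Open Scope R_scope.

Ltac cring := match goal with |- ?a = ?b => change (@eq C a b); ring end.

Lemma RtoC_neq_0 x : x <> 0 -> RtoC x <> 0.
Proof. intros H E. apply RtoC_inj in E. contradiction. Qed.

Lemma exp_neq_0 x : RtoC (exp x) <> 0.
Proof. apply RtoC_neq_0. pose proof (exp_pos x). lra. Qed.

Lemma exp_le_mono x y : x <= y -> exp x <= exp y.
Proof. intros [H|H]; [left; now apply exp_increasing|right; now rewrite H]. Qed.

Lemma ln_le_mono x y : 0 < x -> x <= y -> ln x <= ln y.
Proof. intros Hx [H|H]; [left; now apply ln_increasing|right; now rewrite H]. Qed.

(** * Complex series *)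

Lemma Re_sum_n (a : nat -> C) N : Re (sum_n a N) = sum_n (fun n => Re (a n)) N.
Proof.
  induction N as [|N IH].
  - now rewrite !sum_O.
  - rewrite !sum_Sn, <- IH. reflexivity.
Qed.

Lemma Im_sum_n (a : nat -> C) N : Im (sum_n a N) = sum_n (fun n => Im (a n)) N.
Proof.
  induction N as [|N IH].
  - now rewrite !sum_O.
  - rewrite !sum_Sn, <- IH. reflexivity.
Qed.

Lemma sum_Sn_R (a : nat -> R) n : sum_n a (S n) = sum_n a n + a (S n).
Proof. exact (sum_Sn a n). Qed.

Lemma sum_Sn_C (a : nat -> C) n : sum_n a (S n) = (sum_n a n + a (S n))%C.
Proof. exact (sum_Sn a n). Qed.

Lemma sum_n_ext_C (a b : nat -> C) n : (forall i, (i <= n)%nat -> a i = b i) -> sum_n a n = sum_n b n.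
Proof. exact (sum_n_ext_loc a b n). Qed.

Lemma Cmod_le_ReIm (z : C) : Cmod z <= Rabs (Re z) + Rabs (Im z).
Proof.
  unfold Cmod, Re, Im. destruct z as [x y]; simpl.
  assert (Hx := Rabs_pos x). assert (Hy := Rabs_pos y).
  apply Rsqr_incr_0_var; [|lra].
  rewrite Rsqr_sqrt by nra. unfold Rsqr.
  assert (H1 : x * x = Rabs x * Rabs x) by (rewrite <- Rabs_mult, Rabs_pos_eq; nra).
  assert (H2 : y * y = Rabs y * Rabs y) by (rewrite <- Rabs_mult, Rabs_pos_eq; nra).
  nra.
Qed.

Lemma im_le_Cmod (z : C) : Rabs (Im z) <= Cmod z.
Proof. eapply Rle_trans; [|apply Rmax_Cmod]. apply Rmax_r. Qed.

Lemma Cmod_sum_n (a : nat -> C) N : Cmod (sum_n a N) <= sum_n (fun n => Cmod (a n)) N.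
Proof.
  induction N as [|N IH].
  - rewrite !sum_O. apply Rle_refl.
  - rewrite sum_Sn_C, sum_Sn_R. eapply Rle_trans; [apply Cmod_triangle|]. lra.
Qed.

Lemma CSeries_lim (a : nat -> C) :
  ex_series (fun n => Cmod (a n)) ->
  is_lim_seq (fun N => Cmod (sum_n a N - CSeries a)%C) 0.
Proof.
  intros Ha.
  assert (HR : ex_series (fun n => Re (a n))).
  { apply (ex_series_le (V := R_CompleteNormedModule)) with (2 := Ha).
    intros n. apply re_le_Cmod. }
  assert (HI : ex_series (fun n => Im (a n))).
  { apply (ex_series_le (V := R_CompleteNormedModule)) with (2 := Ha).
    intros n. apply im_le_Cmod. }
  apply Series_correct in HR. apply Series_correct in HI.
  assert (LR : is_lim_seq (fun N => Rabs (sum_n (fun n => Re (a n)) N - Series (fun n => Re (a n)))) 0).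
  { rewrite <- Rabs_R0. apply (is_lim_seq_abs _ 0).
    rewrite <- (Rminus_diag (Series (fun n => Re (a n)))).
    apply is_lim_seq_minus'; [exact HR|apply is_lim_seq_const]. }
  assert (LI : is_lim_seq (fun N => Rabs (sum_n (fun n => Im (a n)) N - Series (fun n => Im (a n)))) 0).
  { rewrite <- Rabs_R0. apply (is_lim_seq_abs _ 0).
    rewrite <- (Rminus_diag (Series (fun n => Im (a n)))).
    apply is_lim_seq_minus'; [exact HI|apply is_lim_seq_const]. }
  apply (is_lim_seq_le_le (fun _ => 0) _
    (fun N => Rabs (sum_n (fun n => Re (a n)) N - Series (fun n => Re (a n)))
      + Rabs (sum_n (fun n => Im (a n)) N - Series (fun n => Im (a n))))).
  - intros N. split; [apply Cmod_ge_0|].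
    eapply Rle_trans; [apply Cmod_le_ReIm|].
    rewrite <- Re_sum_n, <- Im_sum_n. apply Rle_refl.
  - apply is_lim_seq_const.
  - rewrite <- (Rplus_0_l 0). now apply is_lim_seq_plus'.
Qed.

Lemma is_lim_seq_eventually_small (a : nat -> R) :
  is_lim_seq a 0 -> forall eps, 0 < eps -> exists N, forall n, (N <= n)%nat -> Rabs (a n) < eps.
Proof.
  intros H eps He. apply is_lim_seq_spec in H.
  destruct (H (mkposreal eps He)) as [N HN]. exists N. intros n Hn.
  specialize (HN n Hn). simpl in HN. now rewrite Rminus_0_r in HN.
Qed.

Lemma is_lim_seq_small (a : nat -> R) :
  (forall eps, 0 < eps -> exists N, forall n, (N <= n)%nat -> Rabs (a n) < eps) -> is_lim_seq a 0.
Proof.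
  intros H. apply is_lim_seq_spec. intros eps.
  destruct (H eps (cond_pos eps)) as [N HN]. exists N. intros n Hn.
  rewrite Rminus_0_r. now apply HN.
Qed.

Lemma sum_n_C_minus (a b : nat -> C) N :
  (sum_n a N - sum_n b N)%C = sum_n (fun n => (a n - b n)%C) N.
Proof.
  induction N as [|N IH].
  - now rewrite !sum_O.
  - rewrite !sum_Sn_C, <- IH. ring.
Qed.

Lemma sum_n_C_scal (c : C) (a : nat -> C) N :
  sum_n (fun n => (c * a n)%C) N = (c * sum_n a N)%C.
Proof. apply (sum_n_mult_l (K := C_Ring)). Qed.

(** Past an index chosen from the majorant [|x n|] the tail is small uniformly in [N]; only
    finitely many coefficients are left, and those converge. *)
Lemma tannery (c : nat -> nat -> R) (A B : R) (x : nat -> C) :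
  (forall n, is_lim_seq (fun N => c N n) A) ->
  (forall N n, Rabs (c N n) <= B) ->
  ex_series (fun n => Cmod (x n)) ->
  is_lim_seq (fun N => Cmod (sum_n (fun n => RtoC (c N n) * x n) N - RtoC A * CSeries x)%C) 0.
Proof.
  intros Hc HB Hx.
  assert (B0 : 0 <= B) by (eapply Rle_trans; [apply Rabs_pos|apply (HB O O)]).
  assert (Hx' := Hx). apply Series_correct in Hx'.
  set (S := Series (fun n => Cmod (x n))) in *.
  set (P := sum_n (fun n => Cmod (x n))).
  assert (HP : is_lim_seq P S) by exact Hx'.
  assert (Plt : forall n m, (n <= m)%nat -> P n <= P m).
  { intros n m Hnm. unfold P. induction Hnm; [lra|]. rewrite sum_Sn_R. pose proof (Cmod_ge_0 (x (Datatypes.S m))). lra. }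
  apply is_lim_seq_small. intros eps He.
  pose proof (is_lim_seq_eventually_small _ (CSeries_lim x Hx)) as HC.
  set (K := B + Rabs A + 1).
  assert (K0 : 0 < K) by (unfold K; pose proof (Rabs_pos A); lra).
  assert (exists M, forall n, (M <= n)%nat -> P n - P M <= eps / (3 * K)) as [M HM].
  { apply is_lim_seq_spec in HP.
    assert (Hp : 0 < eps / (6 * K)) by (apply Rdiv_lt_0_compat; lra).
    destruct (HP (mkposreal _ Hp)) as [M HM]. exists M. intros n Hn. simpl in HM.
    pose proof (HM n Hn) as H1. pose proof (HM M (le_n _)) as H2.
    apply Rabs_def2 in H1. apply Rabs_def2 in H2.
    replace (eps / (3 * K)) with (eps / (6 * K) + eps / (6 * K)) by (field; lra). lra. }
  assert (exists N1, forall N, (N1 <= N)%nat ->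
     sum_n (fun n => Rabs (c N n - A) * Cmod (x n)) M < eps / 3) as [N1 HN1].
  { assert (L : is_lim_seq (fun N => sum_n (fun n => Rabs (c N n - A) * Cmod (x n)) M) 0).
    { clear HM. induction M as [|M IH].
      - apply is_lim_seq_ext with (fun N => Rabs (c N O - A) * Cmod (x O)).
        { intros N. now rewrite sum_O. }
        replace 0 with (Rabs (A - A) * Cmod (x O)) by (rewrite Rminus_diag, Rabs_R0; ring).
        apply is_lim_seq_mult'; [|apply is_lim_seq_const].
        apply (is_lim_seq_abs _ (A - A)).
        apply is_lim_seq_minus'; [apply Hc|apply is_lim_seq_const].
      - apply is_lim_seq_ext with (fun N => sum_n (fun n => Rabs (c N n - A) * Cmod (x n)) M
           + Rabs (c N (Datatypes.S M) - A) * Cmod (x (Datatypes.S M))).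
        { intros N. now rewrite sum_Sn. }
        replace 0 with (0 + Rabs (A - A) * Cmod (x (Datatypes.S M))) by (rewrite Rminus_diag, Rabs_R0; ring).
        apply is_lim_seq_plus'; [exact IH|].
        apply is_lim_seq_mult'; [|apply is_lim_seq_const].
        apply (is_lim_seq_abs _ (A - A)).
        apply is_lim_seq_minus'; [apply Hc|apply is_lim_seq_const]. }
    destruct (is_lim_seq_eventually_small _ L (eps/3)) as [N HN]; [lra|].
    exists N. intros n Hn. specialize (HN n Hn). apply Rabs_def2 in HN. lra. }
  destruct (HC (eps / (3 * K))) as [N2 HN2]; [apply Rdiv_lt_0_compat; lra|].
  exists (Nat.max M (Nat.max N1 N2)). intros N HN.
  rewrite Rabs_pos_eq by apply Cmod_ge_0.
  replace (sum_n (fun n => RtoC (c N n) * x n) N - RtoC A * CSeries x)%C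
    with (sum_n (fun n => RtoC (c N n - A) * x n) N + RtoC A * (sum_n x N - CSeries x))%C.
  2:{ rewrite (sum_n_ext_C (fun n => RtoC (c N n - A) * x n)%C
        (fun n => (RtoC (c N n) * x n - RtoC A * x n)%C)).
      2:{ intros n _. rewrite RtoC_minus. ring. }
      rewrite <- sum_n_C_minus, sum_n_C_scal. ring. }
  eapply Rle_lt_trans; [apply Cmod_triangle|].
  rewrite Cmod_mult, Cmod_R.
  specialize (HN2 N ltac:(lia)). rewrite Rabs_pos_eq in HN2 by apply Cmod_ge_0.
  assert (E1 : Cmod (sum_n (fun n => RtoC (c N n - A) * x n)%C N) <=
     sum_n (fun n => Rabs (c N n - A) * Cmod (x n)) M + K * (P N - P M)).
  { eapply Rle_trans; [apply Cmod_sum_n|].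
    rewrite (sum_n_ext _ (fun n => Rabs (c N n - A) * Cmod (x n)))
      by (intros n; now rewrite Cmod_mult, Cmod_R).
    enough (HS : forall m, (M <= m)%nat -> sum_n (fun n => Rabs (c N n - A) * Cmod (x n)) m <=
      sum_n (fun n => Rabs (c N n - A) * Cmod (x n)) M + K * (P m - P M)) by (apply HS; lia).
    intros m HMm. induction HMm as [|m HMm IH]; [lra|].
    rewrite sum_Sn_R.
    replace (P (Datatypes.S m)) with (P m + Cmod (x (Datatypes.S m))) by (unfold P; now rewrite sum_Sn_R).
    assert (Rabs (c N (Datatypes.S m) - A) <= K).
    { unfold K, Rminus. eapply Rle_trans; [apply Rabs_triang|]. rewrite Rabs_Ropp.
      pose proof (HB N (Datatypes.S m)). lra. }
    pose proof (Cmod_ge_0 (x (Datatypes.S m))). nra. }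
  specialize (HN1 N ltac:(lia)). specialize (HM N ltac:(lia)).
  assert (E2 : K * (P N - P M) <= eps / 3).
  { replace (eps / 3) with (K * (eps / (3 * K))) by (field; lra).
    apply Rmult_le_compat_l; lra. }
  assert (E3 : Rabs A * Cmod (sum_n x N - CSeries x)%C <= eps / 3).
  { replace (eps / 3) with (K * (eps / (3 * K))) by (field; lra).
    pose proof (Rabs_pos A). pose proof (Cmod_ge_0 (sum_n x N - CSeries x)%C).
    apply Rmult_le_compat; try lra. unfold K; lra. }
  lra.
Qed.

(** * The finite triple product *)

Lemma sum_n_head (a : nat -> C) n :
  sum_n a (S n) = (a O + sum_n (fun i => a (S i)) n)%C.
Proof.
  induction n as [|n IH].
  - rewrite sum_Sn_C, !sum_O. reflexivity.
  - rewrite sum_Sn_C, IH, sum_Sn_C. cring.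
Qed.

Lemma pow_exp (x : R) n : exp x ^ n = exp (INR n * x).
Proof.
  induction n as [|n IH].
  - simpl. rewrite Rmult_0_l. symmetry. apply exp_0.
  - rewrite S_INR. simpl. rewrite IH, <- exp_plus. f_equal. ring.
Qed.

(** The Pochhammer symbol of [q]-calculus, with base [exp (- lam)]. *)
Fixpoint poch (lam : R) (n : nat) : R :=
  match n with
  | O => 1
  | S m => poch lam m * (1 - exp (- (lam * INR (S m))))
  end.

Definition gauss_binom (lam : R) (M i : nat) : R :=
  if (i <=? M)%nat then poch lam M / (poch lam i * poch lam (M - i)) else 0.

(** The coefficient of [z^t], defined for real [t] so that the two halves of the Laurent
    series share one formula. *)
Definition gauss (lam t : R) : R := exp (- (lam * (t * (t - 1) / 2))).

Fixpoint qprod (lam : R) (M : nat) (z : C) : C :=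
  match M with
  | O => 1
  | S m => qprod lam m z * (1 + RtoC (exp (- (lam * INR m))) * z)
  end%C.

Fixpoint triple_prod (lam : R) (N : nat) (z : C) : C :=
  match N with
  | O => 1
  | S m => triple_prod lam m z * (1 + RtoC (exp (- (lam * INR m))) * z)
             * (1 + RtoC (exp (- (lam * INR (S m)))) / z)
  end%C.

Section Theta.
Variable lam : R.
Hypothesis lam_pos : 0 < lam.

Lemma qpow_lt1 n : exp (- (lam * INR (S n))) < 1.
Proof.
  rewrite <- exp_0. apply exp_increasing.
  pose proof (lt_0_INR (S n) ltac:(lia)). nra.
Qed.

Lemma poch_pos n : 0 < poch lam n.
Proof.
  induction n as [|n IH]; [simpl; lra|].
  change (0 < poch lam n * (1 - exp (- (lam * INR (S n))))).
  pose proof (qpow_lt1 n). apply Rmult_lt_0_compat; lra.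
Qed.

Lemma poch_decr n : poch lam (S n) <= poch lam n.
Proof.
  change (poch lam n * (1 - exp (- (lam * INR (S n)))) <= poch lam n).
  pose proof (poch_pos n). pose proof (exp_pos (- (lam * INR (S n)))). nra.
Qed.

Lemma poch_le1 n : poch lam n <= 1.
Proof. induction n as [|n IH]; [simpl; lra|]. pose proof (poch_decr n). lra. Qed.

Lemma qpow_pow n : exp (- (lam * INR n)) = exp (- lam) ^ n.
Proof.
  rewrite pow_exp. f_equal. ring.
Qed.

(** A product of factors [1 - x_j] is at least [1] minus the sum of the [x_j];
    past an index where the geometric tail is below [1/2] this keeps the
    product away from [0]. *)
Lemma poch_lower : exists L, 0 < L /\ forall n, L <= poch lam n.
Proof.
  set (r := exp (- lam)).
  assert (r0 : 0 < r) by apply exp_pos.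
  assert (r1 : r < 1) by (unfold r; rewrite <- exp_0; apply exp_increasing; lra).
  assert (exists m, r ^ m < (1 - r) / 2) as [m Hm].
  { destruct (pow_lt_1_zero r ltac:(rewrite Rabs_pos_eq; lra) ((1 - r)/2) ltac:(lra)) as [m Hm].
    exists m. specialize (Hm m (le_n _)). rewrite Rabs_pos_eq in Hm; [lra|].
    apply pow_le; lra. }
  assert (Hdec : forall n k, poch lam (n + k) <= poch lam n).
  { intros n k. induction k as [|k IH]; [rewrite Nat.add_0_r; lra|].
    rewrite Nat.add_succ_r. pose proof (poch_decr (n + k)). lra. }
  exists (poch lam m / 2). split; [pose proof (poch_pos m); lra|].
  assert (Hlow : forall k, poch lam m * (1 - r ^ m * (1 - r ^ k) / (1 - r)) <= poch lam (m + k)).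
  { induction k as [|k IH].
    - rewrite Nat.add_0_r. simpl. right. field. lra.
    - rewrite Nat.add_succ_r.
      change (poch lam (S (m + k))) with (poch lam (m + k) * (1 - exp (- (lam * INR (S (m + k)))))).
      rewrite qpow_pow. fold r. simpl. rewrite pow_add.
      pose proof (Hdec m k). pose proof (poch_pos m). pose proof (poch_pos (m + k)).
      pose proof (pow_lt r m r0). pose proof (pow_lt r k r0).
      set (x := r ^ m) in *. set (y := r ^ k) in *. set (P := poch lam m) in *.
      set (Pk := poch lam (m + k)) in *.
      replace (P * (1 - x * (1 - r * y) / (1 - r))) with
        (P * (1 - x * (1 - y) / (1 - r)) - P * (x * y)) by (field; lra).
      assert (Pk * (r * (x * y)) <= P * (x * y)).
      { assert (0 < x * y) by nra. rewrite <- Rmult_assoc. apply Rmult_le_compat_r; nra. }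
      lra. }
  intros n. destruct (Nat.le_gt_cases n m) as [Hn|Hn].
  - pose proof (Hdec n (m - n)%nat) as Hd. replace (n + (m - n))%nat with m in Hd by lia.
    pose proof (poch_pos m). lra.
  - specialize (Hlow (n - m)%nat). replace (m + (n - m))%nat with n in Hlow by lia.
    pose proof (pow_lt r (n - m) r0). pose proof (pow_lt r m r0). pose proof (poch_pos m).
    assert (r ^ m * (1 - r ^ (n - m)) / (1 - r) <= 1 / 2).
    { apply Rmult_le_reg_r with (1 - r); [lra|]. unfold Rdiv at 1.
      rewrite Rmult_assoc, Rinv_l, Rmult_1_r by lra. nra. }
    eapply Rle_trans; [|exact Hlow]. unfold Rdiv at 1. apply Rmult_le_compat_l; lra.
Qed.

Lemma poch_lim : exists L, 0 < L /\ (forall n, L <= poch lam n) /\ is_lim_seq (poch lam) L.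
Proof.
  destruct poch_lower as [L0 [HL0 Hlow]].
  destruct (ex_finite_lim_seq_decr (poch lam) L0 poch_decr Hlow) as [L HL].
  exists L. split; [|split; [|exact HL]].
  - apply Rlt_le_trans with L0; [exact HL0|].
    apply (is_lim_seq_le (fun _ => L0) (poch lam) L0 L); [exact Hlow|apply is_lim_seq_const|exact HL].
  - intros n. apply (is_lim_seq_decr_compare _ L HL poch_decr).
Qed.

Lemma gauss_binom_pascal M i : (i <= M)%nat ->
  gauss_binom lam (S M) (S i) =
  gauss_binom lam M (S i) + gauss_binom lam M i * exp (- (lam * INR (M - i))).
Proof.
  intros Hi. unfold gauss_binom.
  rewrite (proj2 (Nat.leb_le (S i) (S M)) ltac:(lia)), (proj2 (Nat.leb_le i M) Hi).
  destruct (Nat.eq_dec i M) as [->|Hne].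
  - rewrite (proj2 (Nat.leb_gt (S M) M) ltac:(lia)).
    replace (S M - S M)%nat with O by lia. rewrite Nat.sub_diag. simpl INR.
    rewrite Rmult_0_r, Ropp_0, exp_0. pose proof (poch_pos (S M)). pose proof (poch_pos M).
    change (poch lam 0) with 1. field. split; lra.
  - rewrite (proj2 (Nat.leb_le (S i) M) ltac:(lia)).
    replace (S M - S i)%nat with (S (M - S i)) by lia.
    replace (M - i)%nat with (S (M - S i)) by lia.
    pose proof (poch_pos (S i)) as Hi1. pose proof (poch_pos (S (M - S i))) as Hd1.
    pose proof (poch_pos i). pose proof (poch_pos (M - S i)). pose proof (poch_pos M).
    cbn [poch] in *.
    pose proof (qpow_lt1 i). pose proof (qpow_lt1 (M - S i)).
    replace (exp (- (lam * INR (S M)))) with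
      (exp (- (lam * INR (S i))) * exp (- (lam * INR (S (M - S i))))).
    2:{ rewrite <- exp_plus. f_equal. rewrite <- Ropp_plus_distr, <- Rmult_plus_distr_l, <- plus_INR.
        do 3 f_equal. lia. }
    set (a := exp (- (lam * INR (S i)))) in *. set (b := exp (- (lam * INR (S (M - S i))))) in *.
    field. repeat split; lra.
Qed.

Lemma gauss_succ i : gauss lam (INR (S i)) = gauss lam (INR i) * exp (- (lam * INR i)).
Proof. unfold gauss. rewrite <- exp_plus. f_equal. rewrite S_INR. field. Qed.

(** Multiplying by one more factor adds [e^{- lam M} z] times the previous sum, shifted by one; the
    [q]-Pascal rule identifies the coefficients. *)
Lemma q_binomial M z :
  qprod lam M z =
  sum_n (fun i => RtoC (gauss_binom lam M i * gauss lam (INR i)) * z ^ i)%C M.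
Proof.
  induction M as [|M IH].
  - rewrite sum_O. unfold gauss_binom, gauss. simpl.
    replace (1 / (1 * 1) * _) with 1; [ring|].
    replace (- (lam * (0 * (0 - 1) / 2))) with 0 by field. rewrite exp_0. field.
  - cbn [qprod]. rewrite IH. set (a := fun i => (RtoC (gauss_binom lam M i * gauss lam (INR i)) * z ^ i)%C).
    rewrite sum_n_head.
    rewrite (sum_n_ext_C
      (fun i => RtoC (gauss_binom lam (S M) (S i) * gauss lam (INR (S i))) * z ^ S i)%C
      (fun i => (a (S i) + RtoC (exp (- (lam * INR M))) * z * a i)%C)).
    2:{ intros i Hi. unfold a. rewrite gauss_binom_pascal by exact Hi.
        rewrite gauss_succ.
        replace (exp (- (lam * INR M))) with (exp (- (lam * INR (M - i))) * exp (- (lam * INR i))).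
        2:{ rewrite <- exp_plus. f_equal. rewrite minus_INR by exact Hi. ring. }
        rewrite ?RtoC_mult, ?RtoC_plus, ?RtoC_mult. simpl Cpow. cring. }
    replace (sum_n (fun i => (a (S i) + RtoC (exp (- (lam * INR M))) * z * a i)%C) M)
      with (sum_n (fun i => a (S i)) M + RtoC (exp (- (lam * INR M))) * z * sum_n a M)%C.
    2:{ rewrite <- sum_n_C_scal. clear. generalize M at 1 3 5. intros n. induction n as [|n IH].
        - rewrite !sum_O. reflexivity.
        - rewrite !sum_Sn_C, <- IH. cring. }
    assert (E : (a O + sum_n (fun i => a (S i)) M)%C = sum_n a M).
    { rewrite <- sum_n_head, sum_Sn_C. unfold a at 2, gauss_binom.
      rewrite (proj2 (Nat.leb_gt (S M) M) ltac:(lia)), Rmult_0_l. cring. }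
    replace (gauss_binom lam (S M) 0) with (gauss_binom lam M 0).
    2:{ unfold gauss_binom. rewrite !Nat.sub_0_r. simpl (0 <=? _)%nat. cbv iota.
        pose proof (poch_pos M). pose proof (poch_pos (S M)).
        change (poch lam 0) with 1. field. split; lra. }
    change (sum_n a M * (1 + RtoC (exp (- (lam * INR M))) * z) = a O +
      (sum_n (fun i => a (S i)) M + RtoC (exp (- (lam * INR M))) * z * sum_n a M))%C.
    transitivity ((a O + sum_n (fun i => a (S i)) M) + RtoC (exp (- (lam * INR M))) * z * sum_n a M)%C;
      [rewrite E|]; cring.
Qed.

Lemma qprod_scale M (z : C) : z <> 0 ->
  qprod lam (S M) (RtoC (exp lam) * z) = ((1 + RtoC (exp lam) * z) * qprod lam M z)%C.
Proof.
  intros Hz. induction M as [|M IH].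
  - simpl. rewrite Rmult_0_r, Ropp_0, exp_0. ring.
  - change (qprod lam (S (S M)) (RtoC (exp lam) * z))
      with (qprod lam (S M) (RtoC (exp lam) * z) * (1 + RtoC (exp (- (lam * INR (S M)))) * (RtoC (exp lam) * z)))%C.
    rewrite IH. cbn [qprod].
    replace (exp (- (lam * INR M))) with (exp (- (lam * INR (S M))) * exp lam).
    2:{ rewrite <- exp_plus. f_equal. rewrite S_INR. ring. }
    rewrite RtoC_mult. ring.
Qed.

(** Centring the finite product of length [2N] at the unit circle turns it into the
    two-sided product. *)
Lemma triple_prod_qprod N (z : C) : z <> 0 ->
  (qprod lam (2 * N) (RtoC (exp (lam * INR N)) * z)
   = RtoC (exp (lam * (INR N * (INR N + 1) / 2))) * z ^ N * triple_prod lam N z)%C.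
Proof.
  intros Hz. induction N as [|N IH].
  - simpl. replace (lam * (0 * (0 + 1) / 2)) with 0 by field. rewrite exp_0. ring.
  - replace (2 * S N)%nat with (S (S (2 * N))) by lia.
    replace (RtoC (exp (lam * INR (S N))) * z)%C with (RtoC (exp lam) * (RtoC (exp (lam * INR N)) * z))%C.
    2:{ rewrite S_INR, Rmult_plus_distr_l, exp_plus, Rmult_1_r, RtoC_mult. ring. }
    pose proof exp_neq_0 as He.
    rewrite qprod_scale by (apply Cmult_neq_0; auto).
    cbn [qprod triple_prod]. rewrite IH.
    replace (exp (lam * (INR (S N) * (INR (S N) + 1) / 2))) with
      (exp (lam * (INR N * (INR N + 1) / 2)) * exp (lam * INR (S N))).
    2:{ rewrite <- exp_plus. f_equal. rewrite S_INR. field. }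
    replace (RtoC (exp lam) * (RtoC (exp (lam * INR N)) * z))%C with (RtoC (exp (lam * INR (S N))) * z)%C.
    2:{ rewrite S_INR, Rmult_plus_distr_l, exp_plus, Rmult_1_r, RtoC_mult. ring. }
    replace (RtoC (exp (- (lam * INR (2 * N)))) * (RtoC (exp (lam * INR N)) * z))%C
      with (RtoC (exp (- (lam * INR N))) * z)%C.
    2:{ rewrite Cmult_assoc, <- RtoC_mult, <- exp_plus. do 3 f_equal. rewrite mult_INR. simpl. ring. }
    rewrite (exp_Ropp (lam * INR (S N))).
    rewrite RtoC_mult, RtoC_inv by (pose proof (exp_pos (lam * INR (S N))); lra).
    simpl Cpow. field. split; auto.
Qed.

Lemma sum_n_split_centre (a : nat -> C) N K :
  sum_n a (N + K) =
  (sum_n (fun n => a (N + n)%nat) K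
   + sum_n (fun j => if (j <? N)%nat then a (N - 1 - j)%nat else RtoC 0) N)%C.
Proof.
  revert a. induction N as [|N IH]; intros a.
  - rewrite sum_O. change (sum_n a K = (sum_n a K + RtoC 0)%C). now rewrite Cplus_0_r.
  - change (S N + K)%nat with (S (N + K)). rewrite sum_n_head, IH.
    rewrite !(sum_Sn_C _ N).
    rewrite (proj2 (Nat.ltb_ge (S N) (S N)) ltac:(lia)).
    enough (E : sum_n (fun j => if (j <? S N)%nat then a (S N - 1 - j)%nat else RtoC 0) N =
      (a O + sum_n (fun j => if (j <? N)%nat then a (S (N - 1 - j)) else RtoC 0) N)%C)
      by (rewrite E; simpl; cring).
    destruct N as [|N].
    + rewrite !sum_O. simpl. cring.
    + rewrite !(sum_Sn_C _ N).
      rewrite (proj2 (Nat.ltb_ge (S N) (S N)) ltac:(lia)).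
      rewrite (proj2 (Nat.ltb_lt (S N) (S (S N))) ltac:(lia)).
      replace (S (S N) - 1 - S N)%nat with O by lia.
      rewrite (sum_n_ext_C (fun j => if (j <? S (S N))%nat then a (S (S N) - 1 - j)%nat else RtoC 0)
         (fun j => if (j <? S N)%nat then a (S (S N - 1 - j)) else RtoC 0)).
      * rewrite Cplus_0_r. apply Cplus_comm.
      * intros j Hj. rewrite (proj2 (Nat.ltb_lt j (S (S N))) ltac:(lia)).
        rewrite (proj2 (Nat.ltb_lt j (S N)) ltac:(lia)). f_equal. lia.
Qed.

(** The [q]-binomial theorem for [2 N] factors, with the summation index recentred at [N]. *)
Lemma triple_prod_sum N (z : C) : z <> 0 ->
  triple_prod lam N z =
  (sum_n (fun n => RtoC (gauss_binom lam (2 * N) (N + n)) * (RtoC (gauss lam (INR n)) * z ^ n)) N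
   + sum_n (fun j => RtoC (if (j <? N)%nat then gauss_binom lam (2 * N) (N - 1 - j) else 0)
               * (RtoC (gauss lam (- (INR j + 1))) * (/ z) ^ S j)) N)%C.
Proof.
  intros Hz.
  pose proof exp_neq_0 as He.
  set (c := (RtoC (exp (lam * (INR N * (INR N + 1) / 2))) * z ^ N)%C).
  assert (Hc : c <> 0) by (apply Cmult_neq_0; [apply He|now apply Cpow_nz]).
  enough (E : (c * triple_prod lam N z)%C = (c *
    (sum_n (fun n => RtoC (gauss_binom lam (2 * N) (N + n)) * (RtoC (gauss lam (INR n)) * z ^ n)) N
     + sum_n (fun j => RtoC (if (j <? N)%nat then gauss_binom lam (2 * N) (N - 1 - j) else 0)
               * (RtoC (gauss lam (- (INR j + 1))) * (/ z) ^ S j)) N))%C).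
  { apply (f_equal (Cmult (/ c))) in E. rewrite !Cmult_assoc, Cinv_l, !Cmult_1_l in E by exact Hc.
    exact E. }
  unfold c. rewrite <- triple_prod_qprod by exact Hz. rewrite q_binomial. fold c.
  replace (2 * N)%nat with (N + N)%nat by lia.
  rewrite sum_n_split_centre, Cmult_plus_distr_l, <- !sum_n_C_scal.
  apply f_equal2; apply sum_n_ext_C.
  - intros n Hn. unfold c. rewrite Cpow_mult_l, <- RtoC_pow.
    rewrite RtoC_mult, <- Cmult_assoc.
    replace (z ^ (N + n))%C with (z ^ N * z ^ n)%C by (now rewrite <- Cpow_add_r).
    assert (HR : gauss lam (INR (N + n)) * exp (lam * INR N) ^ (N + n) =
                 exp (lam * (INR N * (INR N + 1) / 2)) * gauss lam (INR n)).
    { unfold gauss. rewrite pow_exp, <- !exp_plus. f_equal. rewrite plus_INR. field. }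
    apply (f_equal RtoC) in HR. rewrite !RtoC_mult in HR.
    transitivity (RtoC (gauss_binom lam (N + N) (N + n)) * ((RtoC (gauss lam (INR (N + n)))
      * RtoC (exp (lam * INR N) ^ (N + n))) * (z ^ N * z ^ n)))%C; [ring|].
    rewrite HR. cring.
  - intros j Hj. destruct (j <? N)%nat eqn:HjN; [|rewrite Cmult_0_l; cring].
    apply Nat.ltb_lt in HjN. unfold c. rewrite Cpow_mult_l, <- RtoC_pow.
    assert (Hz' : (z ^ (N - 1 - j))%C = (z ^ N * (/ z) ^ S j)%C).
    { replace N with ((N - 1 - j) + S j)%nat at 2 by lia.
      rewrite Cpow_add_r, Cpow_inv by exact Hz.
      rewrite <- Cmult_assoc, Cinv_r by (now apply Cpow_nz). cring. }
    rewrite Hz'.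
    assert (HR : gauss lam (INR (N - 1 - j)) * exp (lam * INR N) ^ (N - 1 - j) =
                 exp (lam * (INR N * (INR N + 1) / 2)) * gauss lam (- (INR j + 1))).
    { unfold gauss. rewrite pow_exp, <- !exp_plus. f_equal. rewrite !minus_INR by lia.
      simpl INR. field. }
    apply (f_equal RtoC) in HR. rewrite !RtoC_mult in HR. rewrite RtoC_mult.
    transitivity (RtoC (gauss_binom lam (N + N) (N - 1 - j)) * ((RtoC (gauss lam (INR (N - 1 - j)))
      * RtoC (exp (lam * INR N) ^ (N - 1 - j))) * (z ^ N * (/ z) ^ S j)))%C; [ring|].
    rewrite HR. cring.
Qed.

End Theta.

(** * Lower bound for the Theta function *)

Definition theta (lam : R) (z : C) : C :=
  (CSeries (fun n => RtoC (gauss lam (INR n)) * z ^ n)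
   + CSeries (fun j => RtoC (gauss lam (- (INR j + 1))) * (/ z) ^ S j))%C.

Lemma Theta_theta (q k : R) (z : C) : 0 < k -> Theta q k z = theta (ln q / k) z.
Proof.
  intros Hk.
  assert (Hext : forall a b : nat -> C, (forall n, a n = b n) -> CSeries a = CSeries b).
  { intros a b Hab. unfold CSeries. f_equal; apply Series_ext; intros n; now rewrite Hab. }
  unfold Theta, theta. f_equal; apply Hext; intros n; unfold Rpower, gauss.
  - do 3 f_equal. field. lra.
  - do 3 f_equal. field. lra.
Qed.

Lemma is_lim_seq_cofinal (a : nat -> R) (h : nat -> nat) (l : R) :
  is_lim_seq a l -> (forall M, exists N0, forall N, (N0 <= N)%nat -> (M <= h N)%nat) ->
  is_lim_seq (fun N => a (h N)) l.
Proof.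
  intros Ha Hh. apply (is_lim_seq_subseq a); [|exact Ha].
  intros P [M HM]. destruct (Hh M) as [N0 HN]. exists N0. intros n Hn. apply HM, HN, Hn.
Qed.

Lemma is_lim_seq_plus_0 (a b : nat -> R) :
  is_lim_seq a 0 -> is_lim_seq b 0 -> is_lim_seq (fun n => a n + b n) 0.
Proof.
  intros Ha Hb. pose proof (is_lim_seq_plus' _ _ _ _ Ha Hb) as H. now rewrite Rplus_0_l in H.
Qed.

Section Theta.
Variable lam : R.
Hypothesis lam_pos : 0 < lam.

Lemma gauss_pos t : 0 < gauss lam t.
Proof. apply exp_pos. Qed.

Lemma ex_series_gauss (r : R) : 0 < r -> ex_series (fun n => gauss lam (INR n) * r ^ n).
Proof.
  intros Hr. apply ex_series_Rabs, ex_series_DAlembert with 0; [lra| |].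
  - intros n. pose proof (gauss_pos (INR n)). pose proof (pow_lt r n Hr). nra.
  - apply is_lim_seq_ext with (fun n => r * exp (- lam) ^ n).
    + intros n. rewrite gauss_succ. pose proof (gauss_pos (INR n)). pose proof (pow_lt r n Hr).
      pose proof (exp_pos (- (lam * INR n))).
      replace (gauss lam (INR n) * exp (- (lam * INR n)) * r ^ S n / (gauss lam (INR n) * r ^ n))
        with (r * exp (- (lam * INR n))) by (simpl; field; split; lra).
      rewrite pow_exp. rewrite Rabs_pos_eq by nra. do 2 f_equal. ring.
    + replace 0 with (r * 0) by ring. apply is_lim_seq_mult'; [apply is_lim_seq_const|].
      apply is_lim_seq_geom. rewrite Rabs_pos_eq by (left; apply exp_pos).
      rewrite <- exp_0. apply exp_increasing. lra.
Qed.

Lemma ex_series_gauss_C (z : C) :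
  ex_series (fun n => Cmod (RtoC (gauss lam (INR n)) * z ^ n)%C).
Proof.
  apply (ex_series_le (V := R_CompleteNormedModule)) with (fun n => gauss lam (INR n) * (Cmod z + 1) ^ n).
  - intros n. change norm with Rabs. rewrite Rabs_pos_eq by apply Cmod_ge_0.
    rewrite Cmod_mult, Cmod_R, Cmod_pow, Rabs_pos_eq by (left; apply gauss_pos).
    apply Rmult_le_compat_l; [left; apply gauss_pos|].
    apply pow_incr. pose proof (Cmod_ge_0 z). lra.
  - apply ex_series_gauss. pose proof (Cmod_ge_0 z). lra.
Qed.

(** Lets the series in [/ z] be dominated by the one in positive powers. *)
Lemma gauss_neg_le j : gauss lam (- (INR j + 1)) <= gauss lam (INR (S j)).
Proof.
  unfold gauss. destruct (Req_dec (INR j) (-1)) as [H|H].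
  - pose proof (pos_INR j). lra.
  - pose proof (pos_INR j). rewrite S_INR.
    apply Rlt_le, exp_increasing. nra.
Qed.

Lemma ex_series_gauss_neg_C (z : C) :
  ex_series (fun j => Cmod (RtoC (gauss lam (- (INR j + 1))) * z ^ S j)%C).
Proof.
  apply (ex_series_le (V := R_CompleteNormedModule))
    with (fun j => Cmod (RtoC (gauss lam (INR (S j))) * z ^ S j)%C).
  - intros n. change norm with Rabs. rewrite Rabs_pos_eq by apply Cmod_ge_0.
    rewrite !Cmod_mult, !Cmod_R, !Rabs_pos_eq by (left; apply gauss_pos).
    apply Rmult_le_compat_r; [apply Cmod_ge_0|apply gauss_neg_le].
  - apply (ex_series_incr_1 (fun n => Cmod (RtoC (gauss lam (INR n)) * z ^ n)%C)).
    apply ex_series_gauss_C.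
Qed.

(** Jacobi's triple product: the coefficients [gauss_binom] of the finite products tend to the
    constant [A] and stay bounded, so the limit may be taken under the sum. *)
Lemma theta_triple_prod : exists A, 0 < A /\ forall z : C, z <> 0 ->
  is_lim_seq (fun N => Cmod (triple_prod lam N z - RtoC A * theta lam z)%C) 0.
Proof.
  destruct (poch_lim lam lam_pos) as [L [L0 [Llow Llim]]].
  exists (/ L). split; [now apply Rinv_0_lt_compat|]. intros z Hz.
  assert (Hb : forall M i, Rabs (gauss_binom lam M i) <= / (L * L)).
  { intros M i. unfold gauss_binom. destruct (i <=? M)%nat.
    - pose proof (poch_pos lam lam_pos M). pose proof (poch_le1 lam lam_pos M).
      pose proof (Llow i). pose proof (Llow (M - i)%nat).
      rewrite Rabs_pos_eq.
      + unfold Rdiv. rewrite <- (Rmult_1_l (/ (L * L))). apply Rmult_le_compat; try lra.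
        * left. apply Rinv_0_lt_compat. nra.
        * apply Rinv_le_contravar; nra.
      + apply Rlt_le, Rdiv_lt_0_compat; nra.
    - rewrite Rabs_R0. left. apply Rinv_0_lt_compat. nra. }
  assert (Hlim : forall h : nat -> nat, (forall N, (N <= h N)%nat) -> forall g g' : nat -> nat,
      (forall M, exists N0, forall N, (N0 <= N)%nat -> (M <= g N)%nat) ->
      (forall M, exists N0, forall N, (N0 <= N)%nat -> (M <= g' N)%nat) ->
      is_lim_seq (fun N => poch lam (h N) / (poch lam (g N) * poch lam (g' N))) (/ L)).
  { intros h Hh g g' Hg Hg'. replace (/ L) with (L / (L * L)) by (field; lra).
    apply is_lim_seq_div'; [|apply is_lim_seq_mult'|nra]; apply is_lim_seq_cofinal; auto.
    intros M. exists M. intros N HN. specialize (Hh N). lia. }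
  assert (T1 := tannery (fun N n => gauss_binom lam (2 * N) (N + n)) (/ L) (/ (L * L))
     (fun n => RtoC (gauss lam (INR n)) * z ^ n)%C).
  assert (T2 := tannery (fun N j => if (j <? N)%nat then gauss_binom lam (2 * N) (N - 1 - j) else 0)
     (/ L) (/ (L * L)) (fun j => RtoC (gauss lam (- (INR j + 1))) * (/ z) ^ S j)%C).
  apply (is_lim_seq_le_le (fun _ => 0) _ (fun N =>
    Cmod (sum_n (fun n => RtoC (gauss_binom lam (2 * N) (N + n)) * (RtoC (gauss lam (INR n)) * z ^ n)) N
      - RtoC (/ L) * CSeries (fun n => RtoC (gauss lam (INR n)) * z ^ n))%C
    + Cmod (sum_n (fun j => RtoC (if (j <? N)%nat then gauss_binom lam (2 * N) (N - 1 - j) else 0)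
               * (RtoC (gauss lam (- (INR j + 1))) * (/ z) ^ S j)) N
      - RtoC (/ L) * CSeries (fun j => RtoC (gauss lam (- (INR j + 1))) * (/ z) ^ S j))%C)).
  - intros N. split; [apply Cmod_ge_0|].
    eapply Rle_trans; [|apply Cmod_triangle]. right. f_equal.
    rewrite (triple_prod_sum lam lam_pos N z Hz). unfold theta. cring.
  - apply is_lim_seq_const.
  - apply is_lim_seq_plus_0; [apply T1|apply T2].
    + intros n. apply is_lim_seq_ext_loc with
        (fun N => poch lam (2 * N) / (poch lam (N + n) * poch lam (N - n))).
      * exists n. intros N HN. unfold gauss_binom.
        rewrite (proj2 (Nat.leb_le (N + n) (2 * N)) ltac:(lia)).
        do 3 f_equal. lia.
      * apply Hlim; [lia| |]; intros M; exists (M + n)%nat; lia.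
    + intros N n. apply Hb.
    + apply ex_series_gauss_C.
    + intros n. apply is_lim_seq_ext_loc with
        (fun N => poch lam (2 * N) / (poch lam (N - 1 - n) * poch lam (N + 1 + n))).
      * exists (S n). intros N HN. unfold gauss_binom.
        rewrite (proj2 (Nat.ltb_lt n N) ltac:(lia)).
        rewrite (proj2 (Nat.leb_le (N - 1 - n) (2 * N)) ltac:(lia)).
        do 3 f_equal. lia.
      * apply Hlim; [lia| |]; intros M; exists (M + n + 1)%nat; lia.
    + intros N n. destruct (n <? N)%nat; [apply Hb|].
      rewrite Rabs_R0. left. apply Rinv_0_lt_compat. nra.
    + apply ex_series_gauss_neg_C.
Qed.

(** Replacing [z] by [e^{-lam} z] shifts both families of factors by one; everything
    telescopes except the end factors. *)
Lemma triple_prod_shift N (z : C) : z <> 0 ->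
  (triple_prod lam N (RtoC (exp (- lam)) * z) * (z + RtoC (exp (- (lam * INR N)))) =
   triple_prod lam N z * (1 + RtoC (exp (- (lam * INR N))) * z))%C.
Proof.
  intros Hz. 
  pose proof exp_neq_0 as He.
  induction N as [|N IH].
  - simpl. rewrite Rmult_0_r, Ropp_0, exp_0. ring.
  - cbn [triple_prod].
    replace (RtoC (exp (- (lam * INR (S N))))) with (RtoC (exp (- (lam * INR N))) * RtoC (exp (- lam)))%C in *.
    2:{ rewrite <- RtoC_mult, <- exp_plus. do 2 f_equal. rewrite S_INR. ring. }
    set (a := RtoC (exp (- (lam * INR N)))) in *. set (r := RtoC (exp (- lam))) in *.
    assert (Hr : r <> 0) by apply He. assert (Ha : a <> 0) by apply He.
    replace (1 + a * r / (r * z))%C with ((z + a) / z)%C by (field; auto).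
    transitivity ((triple_prod lam N (r * z) * (z + a)) * ((1 + a * (r * z)) / z) * (z + a * r))%C;
      [field; auto|].
    rewrite IH. field; auto.
Qed.

(** In [triple_prod_shift] the end factors tend to [z] and to [1]. *)
Lemma theta_shift (z : C) : z <> 0 ->
  (z * theta lam (RtoC (exp (- lam)) * z) = theta lam z)%C.
Proof.
  intros Hz. destruct theta_triple_prod as [A [A0 HA]].
  pose proof exp_neq_0 as He.
  set (r := RtoC (exp (- lam))).
  assert (H1 := HA z Hz). assert (H2 := HA (r * z)%C ltac:(apply Cmult_neq_0; auto; apply He)).
  set (e := fun N => exp (- (lam * INR N))).
  assert (Le : is_lim_seq e 0).
  { apply is_lim_seq_ext with (fun n => exp (- lam) ^ n).
    - intros n. unfold e. rewrite pow_exp. f_equal. ring.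
    - apply is_lim_seq_geom. rewrite Rabs_pos_eq by (left; apply exp_pos).
      rewrite <- exp_0. apply exp_increasing. lra. }
  set (D := Cmod (RtoC A * (z * theta lam (r * z)) - RtoC A * theta lam z)%C).
  set (a := fun N => Cmod (triple_prod lam N z - RtoC A * theta lam z)%C) in *.
  set (b := fun N => Cmod (triple_prod lam N (r * z) - RtoC A * theta lam (r * z))%C) in *.
  set (ta := Cmod (RtoC A * theta lam z)). set (tb := Cmod (RtoC A * theta lam (r * z))).
  assert (HD : D <= 0).
  { apply (is_lim_seq_le (fun _ => D) (fun N => (b N * (Cmod z + e N) + e N * tb)
       + (a N * (1 + e N * Cmod z) + e N * (Cmod z * ta))) D 0).
    - intros N. unfold D.
      assert (Hs := triple_prod_shift N z Hz). fold r in Hs. fold (e N) in Hs.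
      replace (RtoC A * (z * theta lam (r * z)) - RtoC A * theta lam z)%C with
        ((- ((triple_prod lam N (r * z) - RtoC A * theta lam (r * z)) * (z + RtoC (e N)))
           + - (RtoC (e N) * (RtoC A * theta lam (r * z))))
         + ((triple_prod lam N z - RtoC A * theta lam z) * (1 + RtoC (e N) * z)
           + RtoC (e N) * (z * (RtoC A * theta lam z)))
         + (triple_prod lam N (r * z) * (z + RtoC (e N)) - triple_prod lam N z * (1 + RtoC (e N) * z)))%C
        by ring.
      rewrite (proj1 (Ceq_minus _ _) Hs), Cplus_0_r.
      assert (e0 : 0 < e N) by apply exp_pos.
      eapply Rle_trans; [apply Cmod_triangle|]. apply Rplus_le_compat.
      + eapply Rle_trans; [apply Cmod_triangle|]. rewrite !Cmod_opp, !Cmod_mult, !Cmod_R.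
        rewrite (Rabs_pos_eq (e N)) by lra. unfold tb. rewrite Cmod_mult, Cmod_R.
        apply Rplus_le_compat_r. apply Rmult_le_compat_l; [apply Cmod_ge_0|].
        eapply Rle_trans; [apply Cmod_triangle|]. rewrite Cmod_R, Rabs_pos_eq; lra.
      + eapply Rle_trans; [apply Cmod_triangle|]. rewrite !Cmod_mult, !Cmod_R.
        rewrite (Rabs_pos_eq (e N)) by lra. unfold ta. rewrite Cmod_mult, Cmod_R.
        apply Rplus_le_compat_r. apply Rmult_le_compat_l; [apply Cmod_ge_0|].
        eapply Rle_trans; [apply Cmod_triangle|]. rewrite Cmod_1, Cmod_mult, Cmod_R, Rabs_pos_eq; lra.
    - apply is_lim_seq_const.
    - replace 0 with ((0 * (Cmod z + 0) + 0 * tb) + (0 * (1 + 0 * Cmod z) + 0 * (Cmod z * ta))) by ring.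
      apply is_lim_seq_plus'; apply is_lim_seq_plus'; apply is_lim_seq_mult'.
      + exact H2.
      + apply is_lim_seq_plus'; [apply is_lim_seq_const|exact Le].
      + exact Le.
      + apply is_lim_seq_const.
      + exact H1.
      + apply is_lim_seq_plus'; [apply is_lim_seq_const|].
        apply is_lim_seq_mult'; [exact Le|apply is_lim_seq_const].
      + exact Le.
      + apply is_lim_seq_const. }
  assert (D0 : D = 0) by (apply Rle_antisym; [exact HD|apply Cmod_ge_0]).
  apply Cmod_eq_0 in D0. apply Ceq_minus in D0.
  assert (HA0 : RtoC A <> 0) by (intros H; apply RtoC_inj in H; lra).
  apply (f_equal (Cmult (/ RtoC A))) in D0. rewrite !Cmult_assoc, Cinv_l, !Cmult_1_l in D0 by exact HA0.
  exact D0.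
Qed.

(** The logarithm of the size of [theta] at modulus [e^x]: the maximum over real [n] of
    [n x - lam n (n - 1) / 2], up to a constant. *)
Definition theta_growth (x : R) : R := x ^ 2 / (2 * lam) + x / 2.

(** The growth obeys the same functional equation as [theta], so their ratio is invariant under
    [z -> e^{-lam} z]. *)
Lemma theta_growth_shift x : theta_growth (x - lam) = theta_growth x - x.
Proof. unfold theta_growth. field. lra. Qed.

Lemma Cmod_1_plus_ge (w : C) : 1 - Cmod w <= Cmod (1 + w).
Proof.
  assert (H := Cmod_triangle (1 + w) (- w)).
  replace (1 + w + - w)%C with (RtoC 1) in H by ring.
  rewrite Cmod_1, Cmod_opp in H. lra.
Qed.

(** The condition is invariant under dilations of [w], unlike a bound on the distance to the
    negative axis. *)
Definition off_negative (del : R) (w : C) : Prop :=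
  forall r, 0 <= r -> del <= Cmod (1 + RtoC r * w)%C.

Lemma off_negative_scale del s w : 0 <= s -> off_negative del w -> off_negative del (RtoC s * w)%C.
Proof.
  intros Hs Hw r Hr. specialize (Hw (r * s) ltac:(nra)). rewrite RtoC_mult in Hw.
  now rewrite Cmult_assoc.
Qed.

(** On the fundamental annulus the first two factors are controlled by the distance to the
    negative axis, and the others are at least [1 - e^{- lam j}]. *)
Lemma triple_prod_lower del (z : C) : 0 < del -> off_negative del z -> exp (- lam) <= Cmod z <= 1 ->
  forall N, del * (exp (- lam) * del) * (poch lam N * poch lam N) <= Cmod (triple_prod lam (S N) z).
Proof.
  intros Hd Hz Hm N. assert (Hz0 : z <> 0).
  { intros ->. rewrite Cmod_0 in Hm. pose proof (exp_pos (- lam)). lra. }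
  induction N as [|N IH].
  - cbn [triple_prod]. simpl INR. simpl poch.
    rewrite !Rmult_1_r, Rmult_0_r, Ropp_0, exp_0.
    replace (1 * (1 + 1 * z) * (1 + RtoC (exp (- lam)) / z))%C with
      ((1 + RtoC 1 * z) * (RtoC (exp (- lam)) / z * (1 + RtoC (/ exp (- lam)) * z)))%C.
    2:{ rewrite RtoC_inv by (pose proof (exp_pos (- lam)); lra). field. split; auto.
        intros H. apply RtoC_inj in H. pose proof (exp_pos (- lam)). lra. }
    rewrite !Cmod_mult, Cmod_div, Cmod_R by exact Hz0.
    pose proof (exp_pos (- lam)) as E0. rewrite (Rabs_pos_eq (exp (- lam))) by lra.
    pose proof (Hz 1 ltac:(lra)) as Z1.
    pose proof (Hz (/ exp (- lam)) ltac:(left; now apply Rinv_0_lt_compat)) as Z2.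
    assert (exp (- lam) <= exp (- lam) / Cmod z).
    { unfold Rdiv. rewrite <- (Rmult_1_r (exp (- lam))) at 1. apply Rmult_le_compat_l; [lra|].
      rewrite <- Rinv_1. apply Rinv_le_contravar; lra. }
    apply Rmult_le_compat; try lra.
    + nra.
    + apply Rmult_le_compat; lra.
  - change (triple_prod lam (S (S N)) z) with
      (triple_prod lam (S N) z * (1 + RtoC (exp (- (lam * INR (S N)))) * z)
             * (1 + RtoC (exp (- (lam * INR (S (S N))))) / z))%C.
    change (poch lam (S N)) with (poch lam N * (1 - exp (- (lam * INR (S N))))).
    rewrite !Cmod_mult. 
    pose proof (qpow_lt1 lam lam_pos N) as L1.
    pose proof (exp_pos (- (lam * INR (S N)))) as E0.
    assert (F1 : 1 - exp (- (lam * INR (S N))) <= Cmod (1 + RtoC (exp (- (lam * INR (S N)))) * z)).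
    { eapply Rle_trans; [|apply Cmod_1_plus_ge]. rewrite Cmod_mult, Cmod_R, Rabs_pos_eq by lra. nra. }
    assert (F2 : 1 - exp (- (lam * INR (S N))) <= Cmod (1 + RtoC (exp (- (lam * INR (S (S N))))) / z)).
    { eapply Rle_trans; [|apply Cmod_1_plus_ge]. rewrite Cmod_div, Cmod_R by exact Hz0.
      rewrite Rabs_pos_eq by (left; apply exp_pos).
      replace (exp (- (lam * INR (S (S N))))) with (exp (- (lam * INR (S N))) * exp (- lam)).
      2:{ rewrite <- exp_plus. f_equal. rewrite (S_INR (S N)). ring. }
      apply Rplus_le_compat_l, Ropp_le_contravar.
      apply Rmult_le_reg_r with (Cmod z); [pose proof (exp_pos (- lam)); lra|].
      unfold Rdiv. rewrite Rmult_assoc, Rinv_l, Rmult_1_r by (pose proof (exp_pos (- lam)); lra). nra. }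
    pose proof (poch_pos lam lam_pos N) as P0. pose proof (exp_pos (- lam)).
    set (x := 1 - exp (- (lam * INR (S N)))) in *.
    replace (del * (exp (- lam) * del) * (poch lam N * x * (poch lam N * x)))
      with ((del * (exp (- lam) * del) * (poch lam N * poch lam N)) * x * x) by ring.
    assert (0 <= del * (exp (- lam) * del) * (poch lam N * poch lam N)).
    { apply Rmult_le_pos; [|nra]. apply Rmult_le_pos; [lra|nra]. }
    assert (0 <= x) by (unfold x; lra).
    apply Rmult_le_compat; try lra; [nra|]. apply Rmult_le_compat; lra.
Qed.

Lemma theta_lower_annulus del : 0 < del -> exists c, 0 < c /\
  forall z, off_negative del z -> exp (- lam) <= Cmod z <= 1 -> c <= Cmod (theta lam z).
Proof.
  intros Hd. destruct theta_triple_prod as [A [A0 HA]].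
  destruct (poch_lower lam lam_pos) as [L [L0 Llow]].
  pose proof (exp_pos (- lam)) as E0.
  set (c0 := del * (exp (- lam) * del) * (L * L)).
  assert (c0_pos : 0 < c0) by (unfold c0; repeat apply Rmult_lt_0_compat; lra).
  exists (c0 / A). split; [now apply Rdiv_lt_0_compat|]. intros z Hz Hm.
  assert (Hz0 : z <> 0).
  { intros ->. rewrite Cmod_0 in Hm. lra. }
  apply Rmult_le_reg_r with A; [lra|]. unfold Rdiv. rewrite Rmult_assoc, Rinv_l, Rmult_1_r by lra.
  assert (HL := HA z Hz0).
  apply (is_lim_seq_le (fun _ => c0)
    (fun N => Cmod (triple_prod lam (S N) z - RtoC A * theta lam z)%C + Cmod (theta lam z) * A)
    c0 (Cmod (theta lam z) * A)).
  - intros N. assert (HN := triple_prod_lower del z Hd Hz Hm N).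
    assert (c0 <= del * (exp (- lam) * del) * (poch lam N * poch lam N)).
    { unfold c0. pose proof (Llow N). apply Rmult_le_compat_l; [|nra].
      apply Rmult_le_pos; [lra|nra]. }
    assert (HT := Cmod_triangle (triple_prod lam (S N) z - RtoC A * theta lam z) (RtoC A * theta lam z)).
    replace (triple_prod lam (S N) z - RtoC A * theta lam z + RtoC A * theta lam z)%C
      with (triple_prod lam (S N) z) in HT by ring.
    rewrite (Cmod_mult (RtoC A)), Cmod_R, (Rabs_pos_eq A) in HT by lra. lra.
  - apply is_lim_seq_const.
  - rewrite <- (Rplus_0_l (Cmod (theta lam z) * A)) at 1. apply is_lim_seq_plus'; [|apply is_lim_seq_const].
    apply (is_lim_seq_incr_1 (fun N => Cmod (triple_prod lam N z - RtoC A * theta lam z)%C)), HL.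
Qed.

Lemma theta_lower_step del (z : C) c : z <> 0 ->
  (c * exp (theta_growth (ln (Cmod (RtoC (exp (- lam)) * z)))) <= Cmod (theta lam (RtoC (exp (- lam)) * z)) <->
   c * exp (theta_growth (ln (Cmod z))) <= Cmod (theta lam z))
  /\ (off_negative del (RtoC (exp (- lam)) * z) <-> off_negative del z)
  /\ ln (Cmod (RtoC (exp (- lam)) * z)) = ln (Cmod z) - lam.
Proof.
  intros Hz. assert (Hm : 0 < Cmod z) by now apply Cmod_gt_0.
  assert (Hln : ln (Cmod (RtoC (exp (- lam)) * z)) = ln (Cmod z) - lam).
  { rewrite Cmod_mult, Cmod_R, Rabs_pos_eq by (left; apply exp_pos).
    rewrite ln_mult, ln_exp by (exact Hm || apply exp_pos). ring. }
  split; [|split; [|exact Hln]].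
  - rewrite Hln, theta_growth_shift. rewrite <- (theta_shift z Hz), Cmod_mult.
    assert (HE : exp (theta_growth (ln (Cmod z))) = Cmod z * exp (theta_growth (ln (Cmod z)) - ln (Cmod z))).
    { rewrite <- (exp_ln (Cmod z)) at 2 by exact Hm. rewrite <- exp_plus. f_equal. ring. }
    rewrite HE.
    replace (c * (Cmod z * exp (theta_growth (ln (Cmod z)) - ln (Cmod z))))
      with (Cmod z * (c * exp (theta_growth (ln (Cmod z)) - ln (Cmod z)))) by ring.
    split; intros H; [now apply Rmult_le_compat_l; [lra|]|now apply Rmult_le_reg_l in H].
  - split; intros H.
    + apply (off_negative_scale del (exp lam)) in H; [|left; apply exp_pos].
      rewrite Cmult_assoc, <- RtoC_mult, <- exp_plus in H.
      replace (lam + - lam) with 0 in H by ring. now rewrite exp_0, Cmult_1_l in H.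
    + apply off_negative_scale; [left; apply exp_pos|exact H].
Qed.

(** Every modulus is reached from the annulus by finitely many shifts, in one direction or the
    other. *)
Lemma theta_lower del : 0 < del -> exists c, 0 < c /\
  forall z : C, z <> 0 -> off_negative del z ->
  c * exp (theta_growth (ln (Cmod z))) <= Cmod (theta lam z).
Proof.
  intros Hd. destruct (theta_lower_annulus del Hd) as [c0 [Hc0 Hann]].
  exists (c0 * exp (- (lam / 2))). split; [apply Rmult_lt_0_compat; [lra|apply exp_pos]|].
  set (c := c0 * exp (- (lam / 2))).
  pose proof exp_neq_0 as He.
  assert (Hbase : forall z : C, z <> 0 -> off_negative del z -> - lam <= ln (Cmod z) <= 0 ->
     c * exp (theta_growth (ln (Cmod z))) <= Cmod (theta lam z)).
  { intros z Hz Hneg Hln. assert (Hm : 0 < Cmod z) by now apply Cmod_gt_0.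
    assert (exp (- lam) <= Cmod z <= 1).
    { rewrite <- (exp_ln (Cmod z)) by exact Hm. rewrite <- exp_0. split; apply exp_le_mono; lra. }
    eapply Rle_trans; [|apply Hann; assumption].
    unfold c. rewrite Rmult_assoc, <- exp_plus. rewrite <- (Rmult_1_r c0) at 2.
    apply Rmult_le_compat_l; [lra|]. rewrite <- exp_0.
    apply exp_le_mono. unfold theta_growth. set (x := ln (Cmod z)) in *.
      apply Rmult_le_reg_r with (2 * lam); [lra|].
      replace ((- (lam / 2) + (x ^ 2 / (2 * lam) + x / 2)) * (2 * lam))
        with (- lam * lam + x * x + x * lam) by (field; lra). nra. }
  assert (Hup : forall n (z : C), z <> 0 -> off_negative del z ->
     - lam <= ln (Cmod z) <= INR n * lam ->
     c * exp (theta_growth (ln (Cmod z))) <= Cmod (theta lam z)).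
  { induction n as [|n IH]; intros z Hz Hneg Hln.
    - apply Hbase; auto. simpl in Hln. lra.
    - destruct (Rle_dec (ln (Cmod z)) 0) as [H|H]; [apply Hbase; auto; lra|].
      destruct (theta_lower_step del z c Hz) as [S1 [S2 S3]].
      apply S1, IH; [apply Cmult_neq_0; auto|now apply S2|].
      rewrite S3. rewrite S_INR in Hln. lra. }
  assert (Hdown : forall n (z : C), z <> 0 -> off_negative del z ->
     - (INR n + 1) * lam <= ln (Cmod z) <= 0 ->
     c * exp (theta_growth (ln (Cmod z))) <= Cmod (theta lam z)).
  { induction n as [|n IH]; intros z Hz Hneg Hln.
    - apply Hbase; auto. simpl in Hln. lra.
    - destruct (Rle_dec (- lam) (ln (Cmod z))) as [H|H]; [apply Hbase; auto; lra|].
      assert (Hz' : z = (RtoC (exp (- lam)) * (RtoC (exp lam) * z))%C).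
      { rewrite Cmult_assoc, <- RtoC_mult, <- exp_plus.
        replace (- lam + lam) with 0 by ring. now rewrite exp_0, Cmult_1_l. }
      set (w := (RtoC (exp lam) * z)%C) in *.
      assert (Hw : w <> 0) by (apply Cmult_neq_0; auto).
      destruct (theta_lower_step del w c Hw) as [S1 [S2 S3]].
      rewrite Hz'. apply S1, IH; auto.
      + apply S2. now rewrite <- Hz'.
      + rewrite <- Hz' in S3. rewrite S_INR in Hln. lra. }
  intros z Hz Hneg. destruct (INR_unbounded (Rabs (ln (Cmod z)) / lam)) as [n Hn].
  assert (Hn' : Rabs (ln (Cmod z)) < INR n * lam).
  { apply Rmult_lt_compat_r with (r := lam) in Hn; [|lra].
    unfold Rdiv in Hn. rewrite Rmult_assoc, Rinv_l, Rmult_1_r in Hn by lra. exact Hn. }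
  apply Rabs_def2 in Hn'. destruct (Rle_dec (ln (Cmod z)) 0) as [H|H].
  - apply (Hdown n); auto. lra.
  - apply (Hup n); auto. lra.
Qed.

End Theta.

(** * Continuity and complex differentiability *)

Lemma continuous_pair {U V W : UniformSpace} (f : U -> V) (g : U -> W) (x : U) :
  continuous f x -> continuous g x -> continuous (U := prod_UniformSpace V W) (fun y => (f y, g y)) x.
Proof.
  intros Hf Hg. apply (continuous_comp_2 (X := prod_UniformSpace V W) f g (fun a b => (a, b)) x Hf Hg).
  apply (continuous_ext (fun p : prod_UniformSpace V W => p)); [now intros [? ?]|apply continuous_id].
Qed.

Lemma locally_C (z : C) (P : C -> Prop) :
  locally (T := C_UniformSpace) z P <-> exists del, 0 < del /\ forall w, Cmod (w - z) < del -> P w.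
Proof.
  split.
  - intros [e He]. exists (pos e). split; [apply cond_pos|]. intros w Hw. apply He.
    apply C_NormedModule_mixin_compat1. exact Hw.
  - intros [del [Hd H]].
    assert (Hs : 0 < sqrt 2) by (apply sqrt_lt_R0; lra).
    exists (mkposreal (del / sqrt 2) (Rdiv_lt_0_compat _ _ Hd Hs)). intros w Hw. apply H.
    apply C_NormedModule_mixin_compat2 in Hw. simpl in Hw.
    replace (sqrt 2 * (del / sqrt 2)) with del in Hw by (field; lra). exact Hw.
Qed.

Notation Ccont f x := (continuous (U := C_UniformSpace) f x).

Lemma Ccont_iff {U : UniformSpace} (f : U -> C) (x : U) :
  Ccont f x <-> forall e, 0 < e -> locally x (fun y => Cmod (f y - f x) < e).
Proof.
  split.
  - intros H e He. apply (H (fun w => Cmod (w - f x) < e)). apply locally_C. exists e. now split.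
  - intros H P HP. apply locally_C in HP. destruct HP as [e [He HP]].
    unfold filtermap. generalize (H e He). apply filter_imp. intros y. apply HP.
Qed.

Section Ccont.
Context {U : UniformSpace}.
Implicit Types f g : U -> C.

Lemma Ccont_const (c : C) (x : U) : Ccont (fun _ : U => c) x.
Proof. apply continuous_const. Qed.

Lemma Ccont_plus f g (x : U) : Ccont f x -> Ccont g x -> Ccont (fun y => f y + g y)%C x.
Proof. exact (@continuous_plus U C_AbsRing C_NormedModule f g x). Qed.

Lemma Ccont_opp f (x : U) : Ccont f x -> Ccont (fun y => - f y)%C x.
Proof. exact (@continuous_opp U C_AbsRing C_NormedModule f x). Qed.

Lemma Ccont_minus f g (x : U) : Ccont f x -> Ccont g x -> Ccont (fun y => f y - g y)%C x.
Proof. intros Hf Hg. apply Ccont_plus; [exact Hf|now apply Ccont_opp]. Qed.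

Lemma Ccont_mult f g (x : U) : Ccont f x -> Ccont g x -> Ccont (fun y => f y * g y)%C x.
Proof.
  rewrite !Ccont_iff. intros Hf Hg e He.
  set (A := Cmod (f x)). set (B := Cmod (g x)).
  assert (A0 : 0 <= A) by apply Cmod_ge_0. assert (B0 : 0 <= B) by apply Cmod_ge_0.
  set (d := Rmin 1 (e / (A + B + 1))).
  assert (d0 : 0 < d) by (apply Rmin_glb_lt; [lra|apply Rdiv_lt_0_compat; lra]).
  generalize (filter_and _ _ (Hf d d0) (Hg d d0)). apply filter_imp. intros y [H1 H2].
  replace (f y * g y - f x * g x)%C with
    ((f y - f x) * (g y - g x) + (f y - f x) * g x + f x * (g y - g x))%C by ring.
  eapply Rle_lt_trans; [apply Cmod_triangle|].
  eapply Rle_lt_trans; [apply Rplus_le_compat_r, Cmod_triangle|].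
  rewrite !Cmod_mult. fold A B.
  set (a := Cmod (f y - f x)) in *. set (b := Cmod (g y - g x)) in *.
  assert (a0 : 0 <= a) by apply Cmod_ge_0. assert (b0 : 0 <= b) by apply Cmod_ge_0.
  assert (d1 : d <= 1) by apply Rmin_l.
  assert (d2 : d * (A + B + 1) <= e).
  { apply Rle_trans with (e / (A + B + 1) * (A + B + 1)).
    - apply Rmult_le_compat_r; [lra|apply Rmin_r].
    - right. field. lra. }
  nra.
Qed.

Lemma Ccont_inv f (x : U) : f x <> 0 -> Ccont f x -> Ccont (fun y => / f y)%C x.
Proof.
  rewrite !Ccont_iff. intros Hx Hf e He.
  set (A := Cmod (f x)). assert (A0 : 0 < A) by now apply Cmod_gt_0.
  set (d := Rmin (A / 2) (e * A * A / 2)).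
  assert (d0 : 0 < d) by (apply Rmin_glb_lt; [lra|]; assert (0 < e * A * A) by (repeat apply Rmult_lt_0_compat; lra); lra).
  generalize (Hf d d0). apply filter_imp. intros y H1.
  assert (Hy : A / 2 < Cmod (f y)).
  { assert (H := Cmod_triangle (f y) (- (f y - f x))).
    replace (f y + - (f y - f x))%C with (f x) in H by ring. rewrite Cmod_opp in H. fold A in H.
    assert (d <= A / 2) by apply Rmin_l. lra. }
  assert (Hy0 : f y <> 0) by (apply Cmod_gt_0; lra).
  replace (/ f y - / f x)%C with (- ((f y - f x) * (/ f y * / f x)))%C by (field; auto).
  rewrite Cmod_opp, !Cmod_mult, !Cmod_inv by auto. fold A.
  assert (d2 : d <= e * A * A / 2) by apply Rmin_r.
  assert (Hi : / Cmod (f y) * / A <= / (A / 2) * / A).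
  { apply Rmult_le_compat_r; [left; now apply Rinv_0_lt_compat|]. apply Rinv_le_contravar; lra. }
  pose proof (Cmod_ge_0 (f y - f x)%C).
  assert (0 < / (A / 2) * / A) by (apply Rmult_lt_0_compat; apply Rinv_0_lt_compat; lra).
  apply Rle_lt_trans with (Cmod (f y - f x) * (/ (A / 2) * / A)); [apply Rmult_le_compat_l; lra|].
  apply Rlt_le_trans with (e * A * A / 2 * (/ (A / 2) * / A)).
  - apply Rmult_lt_compat_r; lra.
  - right. field. lra.
Qed.

Lemma Ccont_RtoC (f : U -> R) (x : U) : continuous f x -> Ccont (fun y => RtoC (f y)) x.
Proof.
  intros Hf. apply Ccont_iff. intros e He.
  apply (Hf (fun w => Cmod (RtoC w - RtoC (f x)) < e)).
  exists (mkposreal e He). intros w Hw. change (Rabs (w - f x) < e) in Hw.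
  now rewrite <- RtoC_minus, Cmod_R.
Qed.

Lemma Ccont_pair (f g : U -> R) (x : U) : continuous f x -> continuous g x ->
  Ccont (fun y => (f y, g y) : C) x.
Proof.
  intros Hf Hg. apply (continuous_ext (fun y => RtoC (f y) + Ci * RtoC (g y))%C).
  - intros y. unfold Ci, RtoC, Cplus, Cmult; simpl. f_equal; ring.
  - apply Ccont_plus; [now apply Ccont_RtoC|].
    apply Ccont_mult; [apply Ccont_const|now apply Ccont_RtoC].
Qed.

Lemma continuous_Re f (x : U) : Ccont f x -> continuous (fun y => Re (f y)) x.
Proof.
  intros Hf. apply (continuous_comp f Re); [exact Hf|]. apply (continuous_fst (V := R_UniformSpace)).
Qed.

Lemma continuous_Im f (x : U) : Ccont f x -> continuous (fun y => Im (f y)) x.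
Proof.
  intros Hf. apply (continuous_comp f Im); [exact Hf|]. apply (continuous_snd (U := R_UniformSpace)).
Qed.

Lemma Ccont_Cexp f (x : U) : Ccont f x -> Ccont (fun y => Cexp (f y)) x.
Proof.
  intros Hf. unfold Cexp. apply Ccont_pair.
  - apply (continuous_mult (K := R_AbsRing) (fun y => exp (Re (f y))) (fun y => cos (Im (f y)))).
    + apply (continuous_comp (fun y => Re (f y)) exp); [now apply continuous_Re|].
      apply (ex_derive_continuous (V := R_NormedModule)). auto_derive. exact I.
    + apply (continuous_comp (fun y => Im (f y)) cos); [now apply continuous_Im|].
      apply (ex_derive_continuous (V := R_NormedModule)). auto_derive. exact I.
  - apply (continuous_mult (K := R_AbsRing) (fun y => exp (Re (f y))) (fun y => sin (Im (f y)))).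
    + apply (continuous_comp (fun y => Re (f y)) exp); [now apply continuous_Re|].
      apply (ex_derive_continuous (V := R_NormedModule)). auto_derive. exact I.
    + apply (continuous_comp (fun y => Im (f y)) sin); [now apply continuous_Im|].
      apply (ex_derive_continuous (V := R_NormedModule)). auto_derive. exact I.
Qed.

End Ccont.

(** Complex differentiability in Caratheodory's form, in which the rules of
    calculus become statements about continuous functions. *)
Definition cdiff (f : C -> C) (z : C) : Prop :=
  exists phi : C -> C, Ccont phi z /\ forall w, f w = (f z + phi w * (w - z))%C.

Lemma cdiff_cont f z : cdiff f z -> Ccont f z.
Proof.
  intros [phi [Hphi Hf]]. apply (continuous_ext (fun w => f z + phi w * (w - z))%C).
  - intros w. symmetry. apply Hf.
  - apply Ccont_plus; [apply Ccont_const|]. apply Ccont_mult; [exact Hphi|].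
    apply Ccont_minus; [apply continuous_id|apply Ccont_const].
Qed.

Lemma cdiff_estimate (f : C -> C) z :
  (exists l, forall e, 0 < e -> exists del, 0 < del /\ forall w, Cmod (w - z) < del ->
     Cmod (f w - f z - l * (w - z)) <= e * Cmod (w - z)) -> cdiff f z.
Proof.
  intros [l Hl].
  exists (fun w => if Ceq_dec w z then l else (f w - f z) / (w - z))%C. split.
  - apply Ccont_iff. intros e He. apply locally_C.
    destruct (Hl (e / 2) ltac:(lra)) as [del [Hd H]]. exists del. split; [exact Hd|].
    intros w Hw. destruct (Ceq_dec z z) as [_|N]; [|now elim N].
    destruct (Ceq_dec w z) as [E|N].
    + replace (l - l)%C with (RtoC 0) by ring. rewrite Cmod_0. exact He.
    + assert (Hwz : (w - z)%C <> 0) by (intros E; apply N, Ceq_minus, E).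
      replace ((f w - f z) / (w - z) - l)%C with ((f w - f z - l * (w - z)) / (w - z))%C by (field; exact Hwz).
      rewrite Cmod_div by exact Hwz. assert (H0 : 0 < Cmod (w - z)) by now apply Cmod_gt_0.
      apply Rle_lt_trans with (e / 2); [|lra].
      apply Rmult_le_reg_r with (Cmod (w - z)); [exact H0|].
      unfold Rdiv at 1. rewrite Rmult_assoc, Rinv_l, Rmult_1_r by lra. now apply H.
  - intros w. destruct (Ceq_dec w z) as [->|N]; [ring|].
    assert (Hwz : (w - z)%C <> 0) by (intros E; apply N, Ceq_minus, E). field. exact Hwz.
Qed.

Lemma cdiff_quadratic (f : C -> C) z :
  (exists l K, 0 <= K /\ forall w, Cmod (w - z) <= 1 ->
     Cmod (f w - f z - l * (w - z)) <= K * Cmod (w - z) ^ 2) -> cdiff f z.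
Proof.
  intros [l [K [HK H]]]. apply cdiff_estimate. exists l. intros e He.
  exists (Rmin 1 (e / (K + 1))). split; [apply Rmin_glb_lt; [lra|apply Rdiv_lt_0_compat; lra]|].
  intros w Hw. assert (H1 : Cmod (w - z) <= 1) by (pose proof (Rmin_l 1 (e / (K + 1))); lra).
  assert (H2 : Cmod (w - z) <= e / (K + 1)) by (pose proof (Rmin_r 1 (e / (K + 1))); lra).
  eapply Rle_trans; [apply H, H1|]. pose proof (Cmod_ge_0 (w - z)%C).
  assert (K * Cmod (w - z) <= e).
  { apply Rle_trans with (K * (e / (K + 1))); [apply Rmult_le_compat_l; lra|].
    apply Rmult_le_reg_r with (K + 1); [lra|]. replace (K * (e / (K + 1)) * (K + 1)) with (K * e) by (field; lra).
    nra. }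
  simpl. nra.
Qed.

Lemma cdiff_ex_derive (f : C -> C) z :
  ex_derive (K := C_AbsRing) (V := C_NormedModule) f z -> cdiff f z.
Proof.
  intros [l [_ Hl]]. apply cdiff_estimate. exists l. intros e He.
  specialize (Hl z (fun P H => H) (mkposreal e He)). destruct Hl as [del Hdel].
  exists (pos del). split; [apply cond_pos|]. intros w Hw.
  specialize (Hdel w Hw). 
  change (norm (minus (minus (f w) (f z)) (scal (minus w z) l)) <= e * Cmod (w - z)) in Hdel.
  rewrite Cmult_comm. exact Hdel.
Qed.

Lemma cdiff_ext (f g : C -> C) z : (forall w, f w = g w) -> cdiff f z -> cdiff g z.
Proof.
  intros E [phi [Hphi Hf]]. exists phi. split; [exact Hphi|]. intros w. rewrite <- !E. apply Hf.
Qed.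

Lemma cdiff_const c z : cdiff (fun _ => c) z.
Proof. exists (fun _ => RtoC 0). split; [apply Ccont_const|]. intros w. ring. Qed.

Lemma cdiff_id z : cdiff (fun w => w) z.
Proof. exists (fun _ => RtoC 1). split; [apply Ccont_const|]. intros w. ring. Qed.

Lemma cdiff_plus f g z : cdiff f z -> cdiff g z -> cdiff (fun w => f w + g w)%C z.
Proof.
  intros [p [Hp Hf]] [r [Hr Hg]]. exists (fun w => p w + r w)%C.
  split; [now apply Ccont_plus|]. intros w. rewrite (Hf w), (Hg w). ring.
Qed.

Lemma cdiff_mult f g z : cdiff f z -> cdiff g z -> cdiff (fun w => f w * g w)%C z.
Proof.
  intros Hf' [r [Hr Hg]]. assert (Cf := cdiff_cont _ _ Hf'). destruct Hf' as [p [Hp Hf]].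
  exists (fun w => p w * g z + f w * r w)%C. split.
  - apply Ccont_plus; apply Ccont_mult; auto. apply Ccont_const.
  - intros w. rewrite (Hg w). rewrite (Hf w). ring.
Qed.

Lemma cdiff_inv (f : C -> C) z : f z <> 0 -> cdiff f z -> cdiff (fun w => / f w)%C z.
Proof.
  intros Hz Hf'. assert (Cf := cdiff_cont _ _ Hf').
  apply cdiff_estimate. destruct Hf' as [p [Hp Hf]].
  assert (Cq : Ccont (fun w => - (p w * (/ f w * / f z)))%C z).
  { apply Ccont_opp, Ccont_mult; [exact Hp|]. apply Ccont_mult; [|apply Ccont_const].
    apply Ccont_inv; [exact Hz|exact Cf]. }
  assert (Cn : exists d, 0 < d /\ forall w, Cmod (w - z) < d -> f w <> 0).
  { assert (H0 : 0 < Cmod (f z)) by now apply Cmod_gt_0.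
    apply Ccont_iff with (e := Cmod (f z)) in Cf; [|exact H0]. apply locally_C in Cf.
    destruct Cf as [d [Hd H]]. exists d. split; [exact Hd|]. intros w Hw E. specialize (H w Hw).
    rewrite E in H. replace (0 - f z)%C with (- f z)%C in H by ring. rewrite Cmod_opp in H. lra. }
  destruct Cn as [d [Hd Hn]].
  exists (- (p z * (/ f z * / f z)))%C. intros e He.
  apply Ccont_iff with (e := e) in Cq; [|exact He]. apply locally_C in Cq. destruct Cq as [d' [Hd' H']].
  exists (Rmin d d'). split; [now apply Rmin_glb_lt|]. intros w Hw.
  assert (W1 : Cmod (w - z) < d) by (pose proof (Rmin_l d d'); lra).
  assert (W2 : Cmod (w - z) < d') by (pose proof (Rmin_r d d'); lra).
  specialize (Hn w W1). specialize (H' w W2).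
  replace (/ f w - / f z - - (p z * (/ f z * / f z)) * (w - z))%C with
    ((- (p w * (/ f w * / f z)) - - (p z * (/ f z * / f z))) * (w - z))%C.
  - rewrite Cmod_mult. apply Rmult_le_compat_r; [apply Cmod_ge_0|lra].
  - transitivity (- (p w * (w - z)) * (/ f w * / f z) + p z * (/ f z * / f z) * (w - z))%C; [ring|].
    replace (p w * (w - z))%C with (f w - f z)%C by (rewrite (Hf w); ring). field. auto.
Qed.

Lemma cdiff_comp f g z : cdiff g z -> cdiff f (g z) -> cdiff (fun w => f (g w)) z.
Proof.
  intros Hg' [p [Hp Hf]]. assert (Cg := cdiff_cont _ _ Hg'). destruct Hg' as [r [Hr Hg]].
  exists (fun w => p (g w) * r w)%C. split.
  - apply Ccont_mult; [|exact Hr]. apply (continuous_comp g p); assumption.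
  - intros w. rewrite (Hf (g w)).
    replace (g w - g z)%C with (r w * (w - z))%C by (rewrite (Hg w); ring). ring.
Qed.

Lemma pow_remainder (z h : C) R n : Cmod z + Cmod h <= R -> 1 <= R ->
  Cmod ((z + h) ^ S n - z ^ S n - INR (S n) * z ^ n * h) <= INR (S n) ^ 2 * R ^ S n * Cmod h ^ 2.
Proof.
  intros HR H1. pose proof (Cmod_ge_0 h) as h0. pose proof (Cmod_ge_0 z) as z0.
  induction n as [|n IH].
  - simpl (INR 1). replace ((z + h) ^ 1 - z ^ 1 - RtoC 1 * z ^ 0 * h)%C with (RtoC 0) by (simpl; ring).
    rewrite Cmod_0. assert (0 <= Cmod h ^ 2) by (simpl; nra). assert (0 <= R ^ 1) by (simpl; nra).
    rewrite pow1. nra.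
  - set (E := ((z + h) ^ S n - z ^ S n - INR (S n) * z ^ n * h)%C) in *.
    replace ((z + h) ^ S (S n) - z ^ S (S n) - INR (S (S n)) * z ^ S n * h)%C
      with ((z + h) * E + INR (S n) * z ^ n * (h * h))%C.
    2:{ unfold E. rewrite (S_INR (S n)), RtoC_plus.
        change ((z + h) ^ S (S n))%C with ((z + h) * (z + h) ^ S n)%C.
        change (z ^ S (S n))%C with (z * (z * z ^ n))%C.
        change (z ^ S n)%C with (z * z ^ n)%C. ring. }
    eapply Rle_trans; [apply Cmod_triangle|].
    rewrite !Cmod_mult, Cmod_R, Cmod_pow.
    assert (N0 : 0 < INR (S n)) by (apply lt_0_INR; lia). rewrite (Rabs_pos_eq (INR (S n))) by lra.
    rewrite (S_INR (S n)). set (N := INR (S n)) in *.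
    assert (P0 : 0 < R ^ S n) by (apply pow_lt; lra).
    assert (A1 : Cmod (z + h) * Cmod E <= R * (N ^ 2 * R ^ S n * Cmod h ^ 2)).
    { apply Rmult_le_compat; try apply Cmod_ge_0; [|exact IH].
      eapply Rle_trans; [apply Cmod_triangle|exact HR]. }
    assert (A2 : Cmod z ^ n <= R ^ S (S n)).
    { apply Rle_trans with (R ^ n); [apply pow_incr; lra|]. apply Rle_pow; [lra|lia]. }
    change (R ^ S (S n)) with (R * R ^ S n) in *.
    assert (H2 : 0 <= Cmod h ^ 2) by (simpl; nra).
    assert (A3 : N * Cmod z ^ n * (Cmod h * Cmod h) <= N * (R * R ^ S n) * Cmod h ^ 2).
    { replace (Cmod h * Cmod h) with (Cmod h ^ 2) by ring.
      apply Rmult_le_compat_r; [exact H2|]. apply Rmult_le_compat_l; lra. }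
    assert (0 <= R * R ^ S n * Cmod h ^ 2).
    { apply Rmult_le_pos; [apply Rmult_le_pos; lra|exact H2]. }
    replace ((N + 1) ^ 2 * (R * R ^ S n) * Cmod h ^ 2) with
      (R * (N ^ 2 * R ^ S n * Cmod h ^ 2) + N * (R * R ^ S n) * Cmod h ^ 2
        + (N + 1) * (R * R ^ S n * Cmod h ^ 2)) by ring.
    nra.
Qed.

Lemma pow_remainder' (z h : C) R n : Cmod z + Cmod h <= R -> 1 <= R ->
  Cmod ((z + h) ^ n - z ^ n - INR n * z ^ pred n * h) <= INR n ^ 2 * R ^ n * Cmod h ^ 2.
Proof.
  intros H1 H2. destruct n as [|n]; [|now apply pow_remainder].
  simpl. replace (1 - 1 - 0 * 1 * h)%C with (RtoC 0) by ring. rewrite Cmod_0. lra.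
Qed.

(** An everywhere convergent power series; the exponents [e n] let one lemma serve both
    halves of a Laurent series. *)
Lemma cdiff_entire (a : nat -> R) (e : nat -> nat) (z : C) :
  (forall R, 1 <= R -> ex_series (fun n => Rabs (a n) * INR (e n) ^ 2 * R ^ e n)) ->
  (forall w : C, ex_series (fun n => Cmod (RtoC (a n) * w ^ e n))) ->
  cdiff (fun w => CSeries (fun n => RtoC (a n) * w ^ e n)%C) z.
Proof.
  intros Hs Hc. set (R := Cmod z + 1).
  assert (HR : 1 <= R) by (unfold R; pose proof (Cmod_ge_0 z); lra).
  assert (HsR := Hs R HR). set (K := Series (fun n => Rabs (a n) * INR (e n) ^ 2 * R ^ e n)).
  assert (Ht : forall n, 0 <= Rabs (a n) * INR (e n) ^ 2 * R ^ e n).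
  { intros n. apply Rmult_le_pos; [apply Rmult_le_pos; [apply Rabs_pos|apply pow2_ge_0]|apply pow_le; lra]. }
  assert (HK : forall N, sum_n (fun n => Rabs (a n) * INR (e n) ^ 2 * R ^ e n) N <= K).
  { intros N. apply (is_lim_seq_incr_compare (sum_n (fun n => Rabs (a n) * INR (e n) ^ 2 * R ^ e n)) K).
    - exact (Series_correct _ HsR).
    - intros n. rewrite sum_Sn_R. specialize (Ht (S n)). lra. }
  assert (Hd : ex_series (fun n => Cmod (RtoC (a n) * (INR (e n) * z ^ pred (e n)))%C)).
  { apply (ex_series_le (V := R_CompleteNormedModule)) with (2 := HsR).
    intros n. change norm with Rabs. rewrite Rabs_pos_eq by apply Cmod_ge_0.
    rewrite !Cmod_mult, !Cmod_R, Cmod_pow, (Rabs_pos_eq (INR (e n))) by apply pos_INR.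
    rewrite Rmult_assoc. apply Rmult_le_compat_l; [apply Rabs_pos|].
    destruct (e n) as [|m]; [simpl; lra|].
    assert (1 <= INR (S m)) by (rewrite S_INR; pose proof (pos_INR m); lra).
    apply Rmult_le_compat; [lra|apply pow_le, Cmod_ge_0|nra|].
    simpl pred. apply Rle_trans with (R ^ m); [|apply Rle_pow; [lra|lia]].
    apply pow_incr. unfold R. pose proof (Cmod_ge_0 z). lra. }
  apply cdiff_quadratic. exists (CSeries (fun n => RtoC (a n) * (INR (e n) * z ^ pred (e n)))%C), K.
  split. { eapply Rle_trans; [|apply (HK O)]. rewrite sum_O. apply Ht. }
  intros w Hw. set (h := (w - z)%C) in *.
  pose proof (CSeries_lim _ (Hc w)) as L1. pose proof (CSeries_lim _ (Hc z)) as L2.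
  pose proof (CSeries_lim _ Hd) as L3.
  set (fw := CSeries (fun n => RtoC (a n) * w ^ e n)%C) in *.
  set (fz := CSeries (fun n => RtoC (a n) * z ^ e n)%C) in *.
  set (l := CSeries (fun n => RtoC (a n) * (INR (e n) * z ^ pred (e n)))%C) in *.
  set (pw := sum_n (fun n => RtoC (a n) * w ^ e n)%C) in *.
  set (pz := sum_n (fun n => RtoC (a n) * z ^ e n)%C) in *.
  set (pd := sum_n (fun n => RtoC (a n) * (INR (e n) * z ^ pred (e n)))%C) in *.
  apply (is_lim_seq_le (fun _ => Cmod (fw - fz - l * h)) (fun N => Cmod (pw N - fw) + (Cmod (pz N - fz) +
     (Cmod (pd N - l) * Cmod h + K * Cmod h ^ 2))) (Cmod (fw - fz - l * h)) (K * Cmod h ^ 2)).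
  - intros N.
    replace (fw - fz - l * h)%C with (- (pw N - fw) + ((pz N - fz) + ((pd N - l) * h
      + (pw N - pz N - pd N * h))))%C by ring.
    eapply Rle_trans; [apply Cmod_triangle|]. rewrite Cmod_opp. apply Rplus_le_compat_l.
    eapply Rle_trans; [apply Cmod_triangle|]. apply Rplus_le_compat_l.
    eapply Rle_trans; [apply Cmod_triangle|]. rewrite Cmod_mult. apply Rplus_le_compat_l.
    apply Rle_trans with (sum_n (fun n => Rabs (a n) * INR (e n) ^ 2 * R ^ e n) N * Cmod h ^ 2).
    2:{ apply Rmult_le_compat_r; [apply pow2_ge_0|apply HK]. }
    unfold pw, pz, pd. clear - Hw HR. induction N as [|N IH].
    + rewrite !sum_O. 
      replace (RtoC (a O) * w ^ e O - RtoC (a O) * z ^ e O - RtoC (a O) * (INR (e O) * z ^ pred (e O)) * h)%C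
        with (RtoC (a O) * ((z + h) ^ e O - z ^ e O - INR (e O) * z ^ pred (e O) * h))%C.
      2:{ replace (z + h)%C with w by (unfold h; ring). ring. }
      rewrite Cmod_mult, Cmod_R, !Rmult_assoc. apply Rmult_le_compat_l; [apply Rabs_pos|].
      rewrite <- Rmult_assoc. apply pow_remainder'; [unfold R; lra|exact HR].
    + rewrite !sum_Sn_C, sum_Sn_R.
      match goal with |- Cmod (?A + ?a' - (?B + ?b') - (?D + ?d') * h) <= _ =>
        replace (A + a' - (B + b') - (D + d') * h)%C with ((A - B - D * h) + (a' - b' - d' * h))%C by cring end.
      eapply Rle_trans; [apply Cmod_triangle|]. rewrite Rmult_plus_distr_r.
      apply Rplus_le_compat; [exact IH|].
      set (M := S N).
      replace (RtoC (a M) * w ^ e M - RtoC (a M) * z ^ e M - RtoC (a M) * (INR (e M) * z ^ pred (e M)) * h)%C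
        with (RtoC (a M) * ((z + h) ^ e M - z ^ e M - INR (e M) * z ^ pred (e M) * h))%C.
      2:{ replace (z + h)%C with w by (unfold h; ring). ring. }
      rewrite Cmod_mult, Cmod_R, !Rmult_assoc. apply Rmult_le_compat_l; [apply Rabs_pos|].
      rewrite <- Rmult_assoc. apply pow_remainder'; [unfold R; lra|exact HR].
  - apply is_lim_seq_const.
  - replace (K * Cmod h ^ 2) with (0 + (0 + (0 * Cmod h + K * Cmod h ^ 2))) at 1 by ring.
    apply is_lim_seq_plus'; [exact L1|]. apply is_lim_seq_plus'; [exact L2|].
    apply is_lim_seq_plus'; [|apply is_lim_seq_const].
    apply is_lim_seq_mult'; [exact L3|apply is_lim_seq_const].
Qed.

Lemma INR_le_pow2 n : INR n <= 2 ^ n.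
Proof.
  induction n as [|n IH]; [simpl; lra|]. rewrite S_INR. simpl.
  assert (1 <= 2 ^ n) by (apply pow_R1_Rle; lra). lra.
Qed.

Lemma cdiff_theta lam (z : C) : 0 < lam -> z <> 0 -> cdiff (theta lam) z.
Proof.
  intros Hl Hz. unfold theta.
  assert (Hsq : forall n R, 1 <= R -> INR n ^ 2 * R ^ n <= (4 * R) ^ n).
  { intros n R HR. rewrite Rpow_mult_distr. apply Rmult_le_compat_r; [apply pow_le; lra|].
    replace 4 with (2 ^ 2) by ring. rewrite <- pow_mult, Nat.mul_comm, pow_mult.
    apply pow_incr. split; [apply pos_INR|apply INR_le_pow2]. }
  apply cdiff_plus.
  - apply (cdiff_entire (fun n => gauss lam (INR n)) (fun n => n)).
    + intros R HR. apply (ex_series_le (V := R_CompleteNormedModule))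
        with (fun n => gauss lam (INR n) * (4 * R) ^ n); [|apply ex_series_gauss; lra].
      intros n. change norm with Rabs. rewrite (Rabs_pos_eq (gauss _ _)) by (left; apply gauss_pos).
      rewrite Rabs_pos_eq.
      * rewrite Rmult_assoc. apply Rmult_le_compat_l; [left; apply gauss_pos|now apply Hsq].
      * apply Rmult_le_pos; [apply Rmult_le_pos; [left; apply gauss_pos|apply pow2_ge_0]|apply pow_le; lra].
    + intros w. now apply ex_series_gauss_C.
  - apply (cdiff_comp (fun y => CSeries (fun j => RtoC (gauss lam (- (INR j + 1))) * y ^ S j)%C) (fun w => / w)%C).
    + apply cdiff_inv; [exact Hz|apply cdiff_id].
    + apply (cdiff_entire (fun j => gauss lam (- (INR j + 1))) S).
      * intros R HR. apply (ex_series_le (V := R_CompleteNormedModule))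
          with (fun n => gauss lam (INR (S n)) * (4 * R) ^ S n).
        -- intros n. change norm with Rabs. rewrite (Rabs_pos_eq (gauss _ _)) by (left; apply gauss_pos).
           rewrite Rabs_pos_eq.
           ++ rewrite Rmult_assoc. apply Rmult_le_compat; [left; apply gauss_pos| |now apply gauss_neg_le|now apply Hsq].
              apply Rmult_le_pos; [apply pow2_ge_0|apply pow_le; lra].
           ++ apply Rmult_le_pos; [apply Rmult_le_pos; [left; apply gauss_pos|apply pow2_ge_0]|apply pow_le; lra].
        -- apply (ex_series_incr_1 (fun n => gauss lam (INR n) * (4 * R) ^ n)). apply ex_series_gauss; lra.
      * intros w. now apply ex_series_gauss_neg_C.
Qed.

(** * Goursat's theorem on rectangles *)

Notation CInt f a b := (RInt (V := C_R_CompleteNormedModule) f a b).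
Notation is_CInt f a b l := (is_RInt (V := C_R_NormedModule) f a b l).
Notation ex_CInt f a b := (ex_RInt (V := C_R_NormedModule) f a b).

Lemma is_CInt_unique f a b l : is_CInt f a b l -> CInt f a b = l.
Proof. exact (is_RInt_unique (V := C_R_CompleteNormedModule) f a b l). Qed.

Lemma CInt_correct f a b : ex_CInt f a b -> is_CInt f a b (CInt f a b).
Proof. exact (RInt_correct (V := C_R_CompleteNormedModule) f a b). Qed.

Lemma ex_CInt_cont (f : R -> C) a b :
  (forall x, Rmin a b <= x <= Rmax a b -> continuous (U := C_UniformSpace) f x) -> ex_CInt f a b.
Proof. exact (ex_RInt_continuous (V := C_R_CompleteNormedModule) f a b). Qed.

Lemma is_CInt_ext (f g : R -> C) a b l :
  (forall x, Rmin a b < x < Rmax a b -> f x = g x) -> is_CInt f a b l -> is_CInt g a b l.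
Proof. exact (is_RInt_ext (V := C_R_NormedModule) f g a b l). Qed.

Lemma is_CInt_minus (f g : R -> C) a b lf lg :
  is_CInt f a b lf -> is_CInt g a b lg -> is_CInt (fun x => f x - g x)%C a b (lf - lg)%C.
Proof. exact (is_RInt_minus (V := C_R_NormedModule) f g a b lf lg). Qed.

Lemma is_CInt_pair (f : R -> C) a b (l : C) :
  is_RInt (fun x => Re (f x)) a b (Re l) -> is_RInt (fun x => Im (f x)) a b (Im l) -> is_CInt f a b l.
Proof.
  intros H1 H2. destruct l as [l1 l2].
  exact (is_RInt_fct_extend_pair (U := R_NormedModule) (V := R_NormedModule) f a b l1 l2 H1 H2).
Qed.

Lemma is_CInt_norm_const (f : R -> C) a b l M :
  a <= b -> (forall x, a <= x <= b -> Cmod (f x) <= M) -> is_CInt f a b l -> Cmod l <= (b - a) * M.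
Proof.
  intros Hab HM Hl. rewrite Cmod_norm.
  apply (norm_RInt_le_const (V := C_R_NormedModule) f a b l M Hab); [|exact Hl].
  intros x Hx. eapply Rle_trans; [|exact (HM x Hx)]. rewrite Cmod_norm. apply Rle_refl.
Qed.

Lemma is_CInt_norm (f : R -> C) (g : R -> R) a b l lg :
  a <= b -> (forall x, a <= x <= b -> Cmod (f x) <= g x) -> is_CInt f a b l -> is_RInt g a b lg ->
  Cmod l <= lg.
Proof.
  intros Hab HM Hl Hg. rewrite Cmod_norm.
  apply (norm_RInt_le (V := C_R_NormedModule) f g a b l lg Hab); [|exact Hl|exact Hg].
  intros x Hx. eapply Rle_trans; [|exact (HM x Hx)]. rewrite Cmod_norm. apply Rle_refl.
Qed.

Lemma CInt_Chasles (f : R -> C) a b c :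
  ex_CInt f a b -> ex_CInt f b c -> CInt f a c = (CInt f a b + CInt f b c)%C.
Proof. intros H1 H2. symmetry. exact (RInt_Chasles (V := C_R_CompleteNormedModule) f a b c H1 H2). Qed.

(** A complex affine function restricted to any side of a rectangle has this form. *)
Lemma is_CInt_affine (P S : C) a b :
  is_CInt (fun x => P + S * RtoC x)%C a b
    (P * RtoC (b - a) + S * RtoC ((b ^ 2 - a ^ 2) / 2))%C.
Proof.
  assert (HR : forall p s, is_RInt (fun x => p + s * x) a b (p * (b - a) + s * ((b ^ 2 - a ^ 2) / 2))).
  { intros p s.
    replace (p * (b - a) + s * ((b ^ 2 - a ^ 2) / 2)) with
      (minus (p * b + s * (b ^ 2 / 2)) (p * a + s * (a ^ 2 / 2))).
    2:{ change (@eq R ((p * b + s * (b ^ 2 / 2)) - (p * a + s * (a ^ 2 / 2)))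
          (p * (b - a) + s * ((b ^ 2 - a ^ 2) / 2))). field. }
    apply (is_RInt_derive (V := R_CompleteNormedModule) (fun x => p * x + s * (x ^ 2 / 2))).
    - intros x _. auto_derive; [exact I|]. field.
    - intros x _. apply (ex_derive_continuous (V := R_NormedModule)). auto_derive. exact I. }
  destruct P as [p1 p2], S as [s1 s2]. apply is_CInt_pair.
  - eapply is_RInt_ext; [|replace (Re _) with (p1 * (b - a) + s1 * ((b ^ 2 - a ^ 2) / 2)); [apply HR|]].
    + intros x _. simpl. ring.
    + simpl. ring.
  - eapply is_RInt_ext; [|replace (Im _) with (p2 * (b - a) + s2 * ((b ^ 2 - a ^ 2) / 2)); [apply HR|]].
    + intros x _. simpl. ring.
    + simpl. ring.
Qed.

Definition rect_int (f : C -> C) (a b c d : R) : C :=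
  (CInt (fun x => f (x, c)) a b + Ci * CInt (fun y => f (b, y)) c d
   - CInt (fun x => f (x, d)) a b - Ci * CInt (fun y => f (a, y)) c d)%C.

Lemma Ccont_hline (f : C -> C) x y : continuous (U := C_UniformSpace) f (x, y) ->
  continuous (U := C_UniformSpace) (fun x => f (x, y)) x.
Proof.
  intros H. apply (continuous_comp (fun x => (x, y) : C) f); [|exact H].
  apply Ccont_pair; [apply continuous_id|apply continuous_const].
Qed.

Lemma Ccont_vline (f : C -> C) x y : continuous (U := C_UniformSpace) f (x, y) ->
  continuous (U := C_UniformSpace) (fun y => f (x, y)) y.
Proof.
  intros H. apply (continuous_comp (fun y => (x, y) : C) f); [|exact H].
  apply Ccont_pair; [apply continuous_const|apply continuous_id].
Qed.

Section Goursat.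
Variable f : C -> C.
Variables A B C0 D : R.
Hypothesis f_diff : forall x y, A <= x <= B -> C0 <= y <= D -> cdiff f (x, y).

Lemma ex_hline a b y : A <= a <= B -> A <= b <= B -> C0 <= y <= D -> ex_CInt (fun x => f (x, y)) a b.
Proof.
  intros Ha Hb Hy. apply ex_CInt_cont. intros x Hx. apply Ccont_hline, cdiff_cont, f_diff; [|exact Hy].
  split; [apply Rle_trans with (Rmin a b); [apply Rmin_glb; lra|lra]|
    apply Rle_trans with (Rmax a b); [lra|apply Rmax_lub; lra]].
Qed.

Lemma ex_vline c d x : C0 <= c <= D -> C0 <= d <= D -> A <= x <= B -> ex_CInt (fun y => f (x, y)) c d.
Proof.
  intros Ha Hb Hy. apply ex_CInt_cont. intros y Hx. apply Ccont_vline, cdiff_cont, f_diff; [exact Hy|].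
  split; [apply Rle_trans with (Rmin c d); [apply Rmin_glb; lra|lra]|
    apply Rle_trans with (Rmax c d); [lra|apply Rmax_lub; lra]].
Qed.

(** The inner sides are traversed twice in opposite directions. *)
Lemma rect_int_quarters a m b c n d : A <= a <= m -> m <= b <= B -> C0 <= c <= n -> n <= d <= D ->
  rect_int f a b c d =
  (rect_int f a m c n + rect_int f m b c n + rect_int f a m n d + rect_int f m b n d)%C.
Proof.
  intros H1 H2 H3 H4. unfold rect_int.
  rewrite (CInt_Chasles (fun x => f (x, c)) a m b) by (apply ex_hline; lra).
  rewrite (CInt_Chasles (fun x => f (x, d)) a m b) by (apply ex_hline; lra).
  rewrite (CInt_Chasles (fun y => f (a, y)) c n d) by (apply ex_vline; lra).
  rewrite (CInt_Chasles (fun y => f (b, y)) c n d) by (apply ex_vline; lra).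
  ring.
Qed.

(** The affine part of [f] at [z] integrates to [0] over the boundary, and the remainder is at most
    [e] times the distance to [z]. *)
Lemma rect_int_local z e : cdiff f z -> 0 < e -> exists del, 0 < del /\
  forall a b c d, A <= a <= b -> b <= B -> C0 <= c <= d -> d <= D ->
    a <= Re z <= b -> c <= Im z <= d -> (b - a) + (d - c) < del ->
    Cmod (rect_int f a b c d) <= 2 * e * ((b - a) + (d - c)) ^ 2.
Proof.
  intros [phi [Hphi Hf]] He. apply Ccont_iff with (e := e) in Hphi; [|exact He].
  apply locally_C in Hphi. destruct Hphi as [del [Hdel Hphi]].
  exists del. split; [exact Hdel|]. intros a b c d Hab HbB Hcd HdD Hz1 Hz2 Hsmall.
  set (s := (b - a) + (d - c)) in *.
  set (aff := fun w => (f z + phi z * (w - z))%C).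
  assert (Hrem : forall x y, a <= x <= b -> c <= y <= d -> Cmod (f (x, y) - aff (x, y)) <= e * s).
  { intros x y Hx Hy.
    assert (Hd : Cmod ((x, y) - z)%C <= s).
    { eapply Rle_trans; [apply Cmod_le_ReIm|]. destruct z as [zx zy]. simpl in *.
      assert (Rabs (x + - zx) <= b - a) by (apply Rabs_le; lra).
      assert (Rabs (y + - zy) <= d - c) by (apply Rabs_le; lra). unfold s. lra. }
    unfold aff. rewrite (Hf (x, y)).
    replace (f z + phi (x, y) * ((x, y) - z) - (f z + phi z * ((x, y) - z)))%C
      with ((phi (x, y) - phi z) * ((x, y) - z))%C by ring.
    rewrite Cmod_mult. apply Rmult_le_compat; try apply Cmod_ge_0; [|exact Hd].
    left. apply Hphi. lra. }
  set (P := fun y => (f z + phi z * (Ci * RtoC y - z))%C).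
  set (P' := fun x => (f z + phi z * (RtoC x - z))%C).
  assert (Eh : forall x y, aff (x, y) = (P y + phi z * RtoC x)%C).
  { intros x y. unfold aff, P. replace ((x, y) : C) with (RtoC x + Ci * RtoC y)%C;
    [ring|unfold Ci, RtoC, Cplus, Cmult; simpl; f_equal; ring]. }
  assert (Ev : forall x y, aff (x, y) = (P' x + (phi z * Ci) * RtoC y)%C).
  { intros x y. unfold aff, P'. replace ((x, y) : C) with (RtoC x + Ci * RtoC y)%C;
    [ring|unfold Ci, RtoC, Cplus, Cmult; simpl; f_equal; ring]. }
  assert (Hh : forall y, c <= y <= d -> Cmod (CInt (fun x => f (x, y)) a b -
     (P y * RtoC (b - a) + phi z * RtoC ((b ^ 2 - a ^ 2) / 2))) <= (b - a) * (e * s)).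
  { intros y Hy. apply (is_CInt_norm_const (fun x => f (x, y) - (P y + phi z * RtoC x))%C a b); [lra| |].
    - intros x Hx. rewrite <- Eh. now apply Hrem.
    - apply is_CInt_minus; [apply CInt_correct, ex_hline; lra|apply is_CInt_affine]. }
  assert (Hv : forall x, a <= x <= b -> Cmod (CInt (fun y => f (x, y)) c d -
     (P' x * RtoC (d - c) + (phi z * Ci) * RtoC ((d ^ 2 - c ^ 2) / 2))) <= (d - c) * (e * s)).
  { intros x Hx. apply (is_CInt_norm_const (fun y => f (x, y) - (P' x + (phi z * Ci) * RtoC y))%C c d); [lra| |].
    - intros y Hy. rewrite <- Ev. now apply Hrem.
    - apply is_CInt_minus; [apply CInt_correct, ex_vline; lra|apply is_CInt_affine]. }
  pose proof (Hh c ltac:(lra)) as B1. pose proof (Hh d ltac:(lra)) as B2.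
  pose proof (Hv a ltac:(lra)) as B3. pose proof (Hv b ltac:(lra)) as B4.
  unfold rect_int.
  set (I1 := CInt (fun x => f (x, c)) a b) in *. set (I2 := CInt (fun x => f (x, d)) a b) in *.
  set (I3 := CInt (fun y => f (a, y)) c d) in *. set (I4 := CInt (fun y => f (b, y)) c d) in *.
  set (E := fun y => (P y * RtoC (b - a) + phi z * RtoC ((b ^ 2 - a ^ 2) / 2))%C) in *.
  set (E' := fun x => (P' x * RtoC (d - c) + (phi z * Ci) * RtoC ((d ^ 2 - c ^ 2) / 2))%C) in *.
  replace (I1 + Ci * I4 - I2 - Ci * I3)%C with
    ((I1 - E c) + (Ci * (I4 - E' b) + (- (I2 - E d) + - (Ci * (I3 - E' a)))))%C.
  2:{ enough (EE : (E c + Ci * E' b - E d - Ci * E' a)%C = 0).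
      { transitivity (I1 + Ci * I4 - I2 - Ci * I3 - (E c + Ci * E' b - E d - Ci * E' a))%C;
          [ring|rewrite EE; ring]. }
      unfold E, E', P, P'. rewrite !RtoC_minus.
      transitivity (phi z * ((RtoC b - RtoC a) * (RtoC d - RtoC c) * (- Ci + Ci)))%C; ring. }
  assert (Hd0 : (b - a) * (e * s) + ((d - c) * (e * s) + ((b - a) * (e * s) + (d - c) * (e * s)))
    = 2 * e * s ^ 2) by (unfold s; ring).
  rewrite <- Hd0.
  eapply Rle_trans; [apply Cmod_triangle|]. apply Rplus_le_compat; [exact B1|].
  eapply Rle_trans; [apply Cmod_triangle|]. apply Rplus_le_compat.
  { rewrite Cmod_mult, Cmod_Ci, Rmult_1_l. exact B4. }
  eapply Rle_trans; [apply Cmod_triangle|]. apply Rplus_le_compat.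
  - rewrite Cmod_opp. exact B2.
  - rewrite Cmod_opp, Cmod_mult, Cmod_Ci, Rmult_1_l. exact B3.
Qed.

Hypothesis HAB : A <= B.
Hypothesis HCD : C0 <= D.

Let rect : Type := R * R * (R * R).
Let size (r : rect) : R := (snd (fst r) - fst (fst r)) + (snd (snd r) - fst (snd r)).
Let bint (r : rect) : R := Cmod (rect_int f (fst (fst r)) (snd (fst r)) (fst (snd r)) (snd (snd r))).
Let inside (r : rect) : Prop :=
  (A <= fst (fst r) <= snd (fst r) /\ snd (fst r) <= B) /\
  (C0 <= fst (snd r) <= snd (snd r) /\ snd (snd r) <= D).

Let next_rect (e : R) (r : rect) : rect :=
  let '((a, b), (c, d)) := r in
  let m := (a + b) / 2 in let n := (c + d) / 2 in
  let bad r := Rlt_dec (e * size r ^ 2) (bint r) in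
  if bad ((a, m), (c, n)) then ((a, m), (c, n))
  else if bad ((m, b), (c, n)) then ((m, b), (c, n))
  else if bad ((a, m), (n, d)) then ((a, m), (n, d)) else ((m, b), (n, d)).

Let next_rect_spec e r : inside r -> e * size r ^ 2 < bint r ->
  inside (next_rect e r) /\ e * size (next_rect e r) ^ 2 < bint (next_rect e r) /\
  (snd (fst (next_rect e r)) - fst (fst (next_rect e r)) = (snd (fst r) - fst (fst r)) / 2) /\
  (snd (snd (next_rect e r)) - fst (snd (next_rect e r)) = (snd (snd r) - fst (snd r)) / 2) /\
  fst (fst r) <= fst (fst (next_rect e r)) /\ snd (fst (next_rect e r)) <= snd (fst r) /\
  fst (snd r) <= fst (snd (next_rect e r)) /\ snd (snd (next_rect e r)) <= snd (snd r).
Proof.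
  destruct r as [[a b] [c d]]. unfold next_rect, inside, size, bint. simpl fst. simpl snd.
  intros [[H1 H2] [H3 H4]] Hbad.
  set (m := (a + b) / 2). set (n := (c + d) / 2).
  assert (Hm : a <= m <= b) by (unfold m; lra). assert (Hn : c <= n <= d) by (unfold n; lra).
  pose proof (rect_int_quarters a m b c n d ltac:(lra) ltac:(lra) ltac:(lra) ltac:(lra)) as HQ.
  assert (E1 : m - a = (b - a) / 2) by (unfold m; field).
  assert (E2 : b - m = (b - a) / 2) by (unfold m; field).
  assert (E3 : n - c = (d - c) / 2) by (unfold n; field).
  assert (E4 : d - n = (d - c) / 2) by (unfold n; field).
  repeat (match goal with |- context [if ?X then _ else _] => destruct X as [?K|?K] end);
    simpl fst in *; simpl snd in *; repeat split; try lra.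
  rewrite HQ in Hbad. rewrite E1, E3 in *. rewrite E2, ?E4 in *.
  pose proof (Cmod_triangle (rect_int f a m c n + rect_int f m b c n + rect_int f a m n d) (rect_int f m b n d)) as T1.
  pose proof (Cmod_triangle (rect_int f a m c n + rect_int f m b c n) (rect_int f a m n d)) as T2.
  pose proof (Cmod_triangle (rect_int f a m c n) (rect_int f m b c n)) as T3.
  apply Rnot_lt_le in K, K0, K1.
  replace ((b - a + (d - c)) ^ 2) with (4 * ((b - a) / 2 + (d - c) / 2) ^ 2) in Hbad by field.
  lra.
Qed.

(** If the integral were nonzero it would exceed some [e * size^2]. One of the four quarters then
    has the same defect, and so on; the nested rectangles shrink to a point of differentiability,
    where [rect_int_local] forbids it. *)
Theorem goursat : rect_int f A B C0 D = 0.
Proof.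
  apply Cmod_eq_0. apply Rle_antisym; [|apply Cmod_ge_0].
  apply Rnot_lt_le. intros Hpos.
  set (r0 := ((A, B), (C0, D)) : rect).
  assert (exists e, 0 < e /\ e * size r0 ^ 2 < bint r0) as [e [He Hbad0]].
  { unfold size, bint, r0. simpl fst. simpl snd. set (s := (B - A + (D - C0)) ^ 2).
    assert (0 <= s) by apply pow2_ge_0.
    exists (Cmod (rect_int f A B C0 D) / (2 * (s + 1))). split; [apply Rdiv_lt_0_compat; lra|].
    apply Rmult_lt_reg_r with (2 * (s + 1)); [lra|].
    replace (Cmod (rect_int f A B C0 D) / (2 * (s + 1)) * s * (2 * (s + 1)))
      with (Cmod (rect_int f A B C0 D) * s) by (field; lra). nra. }
  set (r := fun n => Nat.iter n (next_rect e) r0).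
  assert (Hr : forall n, inside (r n) /\ e * size (r n) ^ 2 < bint (r n)).
  { induction n as [|n [IH1 IH2]].
    - split; [|exact Hbad0]. unfold inside, r, r0. simpl. lra.
    - destruct (next_rect_spec e (r n) IH1 IH2) as [H1 [H2 _]]. now split. }
  assert (Hs : forall n, 
    (snd (fst (r (S n))) - fst (fst (r (S n))) = (snd (fst (r n)) - fst (fst (r n))) / 2) /\
    (snd (snd (r (S n))) - fst (snd (r (S n))) = (snd (snd (r n)) - fst (snd (r n))) / 2) /\
    fst (fst (r n)) <= fst (fst (r (S n))) /\ snd (fst (r (S n))) <= snd (fst (r n)) /\
    fst (snd (r n)) <= fst (snd (r (S n))) /\ snd (snd (r (S n))) <= snd (snd (r n))).
  { intros n. destruct (Hr n) as [I1 I2]. destruct (next_rect_spec e (r n) I1 I2) as [_ [_ H]]. exact H. }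
  (* Opposite corners are monotone and ordered, so some point lies in every rectangle. *)
  assert (Hlim : forall lo hi : nat -> R, (forall n, lo n <= lo (S n)) -> (forall n, hi (S n) <= hi n) ->
     (forall n, lo n <= hi n) -> exists x, forall n, lo n <= x <= hi n).
  { intros lo hi H1 H2 H3.
    assert (Hhi : forall n k, hi (n + k)%nat <= hi n).
    { intros n k. induction k as [|k IH]; [rewrite Nat.add_0_r; lra|].
      rewrite Nat.add_succ_r. pose proof (H2 (n + k)%nat). lra. }
    assert (Hlo : forall n k, lo n <= lo (n + k)%nat).
    { intros n k. induction k as [|k IH]; [rewrite Nat.add_0_r; lra|].
      rewrite Nat.add_succ_r. pose proof (H1 (n + k)%nat). lra. }
    assert (Hlh : forall n m, lo n <= hi m).
    { intros n m. pose proof (Hlo n m). pose proof (Hhi m n). pose proof (H3 (n + m)%nat).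
      rewrite (Nat.add_comm m n) in H0. lra. }
    destruct (ex_finite_lim_seq_incr lo (hi O) H1 (fun n => Hlh n O)) as [x Hx].
    exists x. intros n. split; [apply (is_lim_seq_incr_compare lo x Hx H1)|].
    apply (is_lim_seq_le lo (fun _ => hi n) x (hi n)); [intros k; apply Hlh|exact Hx|apply is_lim_seq_const]. }
  destruct (Hlim (fun n => fst (fst (r n))) (fun n => snd (fst (r n)))) as [x Hx].
  { intros n; apply Hs. } { intros n; apply Hs. } { intros n. apply (Hr n). }
  destruct (Hlim (fun n => fst (snd (r n))) (fun n => snd (snd (r n)))) as [y Hy].
  { intros n; apply Hs. } { intros n; apply Hs. } { intros n. apply (Hr n). }
  cbv beta in Hx, Hy.
  assert (Hd : cdiff f (x, y)).
  { apply f_diff; [pose proof (Hx O)|pose proof (Hy O)]; unfold r, r0 in *; simpl in *; lra. }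
  destruct (rect_int_local (x, y) (e / 2) Hd ltac:(lra)) as [del [Hdel Hloc]].
  assert (Hsize : forall n, size (r n) = size r0 / 2 ^ n).
  { induction n as [|n IH]; [simpl; field|]. 
    assert (E : size (r (S n)) = size (r n) / 2).
    { unfold size. destruct (Hs n) as [E1 [E2 _]]. rewrite E1, E2. field. }
    rewrite E, IH. simpl. field. apply pow_nonzero. lra. }
  assert (exists n, size (r n) < del) as [n Hn].
  { assert (S0 : 0 <= size r0) by (unfold size, r0; simpl; lra).
    destruct (pow_lt_1_zero (/ 2) ltac:(rewrite Rabs_pos_eq; lra) (del / (size r0 + 1))) as [n Hn].
    - apply Rdiv_lt_0_compat; lra.
    - exists n. specialize (Hn n (le_n _)). rewrite Rabs_pos_eq in Hn by (apply pow_le; lra).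
      rewrite Hsize. unfold Rdiv. rewrite <- pow_inv.
      apply (Rmult_lt_compat_l (size r0 + 1)) in Hn; [|lra].
      replace ((size r0 + 1) * (del / (size r0 + 1))) with del in Hn by (field; lra).
      pose proof (pow_lt (/ 2) n ltac:(lra)). nra. }
  destruct (Hr n) as [I1 I2].
  specialize (Hloc (fst (fst (r n))) (snd (fst (r n))) (fst (snd (r n))) (snd (snd (r n)))
    (proj1 (proj1 I1)) (proj2 (proj1 I1)) (proj1 (proj2 I1)) (proj2 (proj2 I1)) (Hx n) (Hy n) Hn).
  fold (size (r n)) in Hloc. fold (bint (r n)) in Hloc. lra.
Qed.

End Goursat.

Lemma Cexp_plus (z w : C) : Cexp (z + w) = (Cexp z * Cexp w)%C.
Proof.
  destruct z as [x y], w as [x' y']. unfold Cexp, Cplus, Cmult, Re, Im. simpl.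
  rewrite exp_plus, cos_plus, sin_plus. f_equal; ring.
Qed.

Lemma exp_remainder x : Rabs x <= 1 -> Rabs (exp x - 1 - x) <= 12 * x ^ 2.
Proof.
  intros Hx. apply Rabs_le_between in Hx. pose proof (exp_ineq1_le x).
  rewrite Rabs_pos_eq by lra.
  destruct (Rle_dec x (1 / 2)) as [H1|H1].
  - pose proof (exp_ineq1_le (- x)) as H2. rewrite exp_Ropp in H2.
    pose proof (exp_pos x) as E.
    assert (H3 : (1 - x) * exp x <= 1).
    { apply (Rmult_le_compat_r (exp x)) in H2; [|lra]. rewrite Rinv_l in H2 by lra. lra. }
    nra.
  - assert (exp x <= exp 1) by (apply exp_le_mono; lra).
    pose proof exp_le_3. nra.
Qed.

Lemma Rabs_sin_le y : Rabs (sin y) <= Rabs y.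
Proof.
  destruct (MVT_gen sin 0 y cos) as [c [_ Hc]].
  - intros x _. auto_derive; [exact I|ring].
  - intros x _. apply continuity_sin.
  - rewrite sin_0, !Rminus_0_r in Hc. rewrite Hc, Rabs_mult.
    assert (Rabs (cos c) <= 1) by (apply Rabs_le; pose proof (COS_bound c); lra).
    pose proof (Rabs_pos y). nra.
Qed.

Lemma cos_remainder y : Rabs (cos y - 1) <= y ^ 2.
Proof.
  replace y with (2 * (y / 2)) at 1 by field. rewrite cos_2a_sin.
  pose proof (Rabs_sin_le (y / 2)) as H.
  assert (sin (y / 2) * sin (y / 2) <= (y / 2) * (y / 2)).
  { rewrite <- (Rabs_pos_eq (sin (y / 2) * sin (y / 2))) by nra.
    rewrite <- (Rabs_pos_eq (y / 2 * (y / 2))) by nra. rewrite !Rabs_mult.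
    apply Rmult_le_compat; auto using Rabs_pos. }
  apply Rabs_le. nra.
Qed.

Lemma sin_remainder y : Rabs y <= 1 -> Rabs (sin y - y) <= y ^ 2.
Proof.
  intros Hy. destruct (MVT_gen (fun y => sin y - y) 0 y (fun y => cos y - 1)) as [c [Hc1 Hc]].
  - intros x _. auto_derive; [exact I|ring].
  - intros x _. apply derivable_continuous_pt. apply derivable_pt_minus; [apply derivable_pt_sin|apply derivable_pt_id].
  - rewrite sin_0, !Rminus_0_r in Hc. rewrite Hc, Rabs_mult.
    pose proof (cos_remainder c) as H.
    assert (Hcy : Rabs c <= Rabs y).
    { unfold Rmin, Rmax in Hc1. destruct (Rle_dec 0 y); unfold Rabs; repeat destruct Rcase_abs; lra. }
    assert (Ec : c ^ 2 = Rabs c * Rabs c) by (rewrite <- Rabs_mult, Rabs_pos_eq; nra).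
    assert (Ey : y ^ 2 = Rabs y * Rabs y) by (rewrite <- Rabs_mult, Rabs_pos_eq; nra).
    rewrite Ec in H. rewrite Ey. pose proof (Rabs_pos c). pose proof (Rabs_pos y).
    apply Rmult_le_compat_r; [lra|]. nra.
Qed.

Lemma cdiff_Cexp z : cdiff Cexp z.
Proof.
  apply cdiff_quadratic. exists (Cexp z), (Cmod (Cexp z) * 30). split.
  { pose proof (Cmod_ge_0 (Cexp z)). lra. }
  intros w Hw. set (h := (w - z)%C) in *. replace w with (z + h)%C by (unfold h; ring).
  rewrite Cexp_plus.
  replace (Cexp z * Cexp h - Cexp z - Cexp z * h)%C with (Cexp z * (Cexp h - 1 - h))%C by ring.
  rewrite Cmod_mult, Rmult_assoc. apply Rmult_le_compat_l; [apply Cmod_ge_0|].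
  eapply Rle_trans; [apply Cmod_le_ReIm|]. rewrite Cmod2_alt.
  pose proof (re_le_Cmod h) as Hx. pose proof (im_le_Cmod h) as Hy.
  destruct h as [x y]. unfold Cexp, Cminus, Cplus, Copp, RtoC, Re, Im in *. simpl fst in *. simpl snd in *.
  pose proof (exp_remainder x ltac:(lra)) as E1. pose proof (cos_remainder y) as E2.
  pose proof (sin_remainder y ltac:(lra)) as E3.
  assert (E0 : 0 < exp x <= 3).
  { split; [apply exp_pos|]. apply Rle_trans with (exp 1); [|apply exp_le_3].
    apply exp_le_mono. pose proof (Rle_abs x). lra. }
  assert (Ex : x ^ 2 = Rabs x * Rabs x) by (rewrite <- Rabs_mult, Rabs_pos_eq; nra).
  assert (Ey : y ^ 2 = Rabs y * Rabs y) by (rewrite <- Rabs_mult, Rabs_pos_eq; nra).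
  assert (B1 : Rabs (exp x * cos y + - (1) + - x) <= 12 * x ^ 2 + 3 * y ^ 2).
  { replace (exp x * cos y + - (1) + - x) with ((exp x - 1 - x) + exp x * (cos y - 1)) by ring.
    eapply Rle_trans; [apply Rabs_triang|]. rewrite Rabs_mult, (Rabs_pos_eq (exp x)) by lra.
    apply Rplus_le_compat; [exact E1|]. apply Rmult_le_compat; auto using Rabs_pos; lra. }
  assert (E4 : Rabs (exp x - 1) <= 13 * Rabs x).
  { replace (exp x - 1) with ((exp x - 1 - x) + x) by ring. eapply Rle_trans; [apply Rabs_triang|].
    rewrite Ex in E1. pose proof (Rabs_pos x). nra. }
  assert (B2 : Rabs (exp x * sin y + - 0 + - y) <= 3 * y ^ 2 + 13 * (Rabs x * Rabs y)).
  { replace (exp x * sin y + - 0 + - y) with (exp x * (sin y - y) + (exp x - 1) * y) by ring.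
    eapply Rle_trans; [apply Rabs_triang|]. rewrite !Rabs_mult, (Rabs_pos_eq (exp x)) by lra.
    apply Rplus_le_compat.
    - apply Rmult_le_compat; auto using Rabs_pos; lra.
    - rewrite <- Rmult_assoc. apply Rmult_le_compat_r; [apply Rabs_pos|exact E4]. }
  rewrite Ex, Ey in B1. rewrite Ey in B2. rewrite Ex, Ey.
  pose proof (pow2_ge_0 (Rabs x - Rabs y)) as H2.
  replace ((Rabs x - Rabs y) ^ 2) with (Rabs x * Rabs x + Rabs y * Rabs y - 2 * (Rabs x * Rabs y)) in H2 by ring.
  pose proof (Rle_0_sqr (Rabs x)) as H3. pose proof (Rle_0_sqr (Rabs y)) as H4. unfold Rsqr in H3, H4.
  lra.
Qed.

(** * Improper integrals dominated by an exponential *)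

Notation Rcont f x := (continuous (U := C_UniformSpace) (T := R_UniformSpace) f x).
Notation is_line_int f J :=
  (is_RInt_gen (V := C_R_NormedModule) f (Rbar_locally m_infty) (Rbar_locally p_infty) J).

Lemma line_int_unique f J : is_line_int f J -> line_int f = J.
Proof.
  intros H. unfold line_int.
  exact (is_RInt_gen_unique (V := C_R_CompleteNormedModule) f J H).
Qed.

Lemma is_RInt_exp_scaled (B c a b : R) : c <> 0 ->
  is_RInt (fun x => B * exp (c * x)) a b (B / c * (exp (c * b) - exp (c * a))).
Proof.
  intros Hc.
  replace (B / c * (exp (c * b) - exp (c * a))) with (minus (B / c * exp (c * b)) (B / c * exp (c * a))).
  2:{ change (@eq R (B / c * exp (c * b) - B / c * exp (c * a)) (B / c * (exp (c * b) - exp (c * a)))). ring. }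
  apply (is_RInt_derive (V := R_CompleteNormedModule) (fun x => B / c * exp (c * x))).
  - intros x _. auto_derive; [exact I|]. field. exact Hc.
  - intros x _. apply (ex_derive_continuous (V := R_NormedModule)). auto_derive. exact I.
Qed.

Lemma ex_CInt_Rcont (f : R -> C) a b : (forall x, Rcont f x) -> ex_CInt f a b.
Proof. intros H. apply ex_CInt_cont. intros x _. apply H. Qed.

Section Dominated.
Variables (f : R -> C) (B c : R).
Hypothesis f_cont : forall x, Rcont f x.
Hypothesis c_pos : 0 < c.
Hypothesis f_dom : forall x, Cmod (f x) <= B * exp (- (c * Rabs x)).

Lemma dominated_B : 0 <= B.
Proof.
  pose proof (f_dom 0) as H. rewrite Rabs_R0, Rmult_0_r, Ropp_0, exp_0, Rmult_1_r in H.
  pose proof (Cmod_ge_0 (f 0)). lra.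
Qed.

Lemma dominated_right a b : 0 <= a <= b -> Cmod (CInt f a b) <= B / c * exp (- (c * a)).
Proof.
  intros Hab. pose proof dominated_B as HB.
  assert (H : Cmod (CInt f a b) <= B / (- c) * (exp (- c * b) - exp (- c * a))).
  { apply (is_CInt_norm f (fun x => B * exp (- c * x)) a b); [lra| | |].
    - intros x Hx. rewrite <- (Rabs_pos_eq x) at 2 by lra.
      eapply Rle_trans; [apply f_dom|]. right. do 2 f_equal. ring.
    - apply CInt_correct, ex_CInt_Rcont, f_cont.
    - apply is_RInt_exp_scaled. lra. }
  eapply Rle_trans; [exact H|].
  replace (B / - c * (exp (- c * b) - exp (- c * a))) with
    (B / c * exp (- (c * a)) - B / c * exp (- c * b)).
  2:{ replace (- (c * a)) with (- c * a) by ring. field. lra. }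
  assert (0 <= B / c * exp (- c * b)).
  { apply Rmult_le_pos; [|left; apply exp_pos]. apply Rdiv_le_0_compat; lra. }
  lra.
Qed.

Lemma dominated_left a b : a <= b <= 0 -> Cmod (CInt f a b) <= B / c * exp (c * b).
Proof.
  intros Hab. pose proof dominated_B as HB.
  assert (H : Cmod (CInt f a b) <= B / c * (exp (c * b) - exp (c * a))).
  { apply (is_CInt_norm f (fun x => B * exp (c * x)) a b); [lra| | |].
    - intros x Hx. eapply Rle_trans; [apply f_dom|]. rewrite (Rabs_left1 x) by lra.
      right. do 2 f_equal. ring.
    - apply CInt_correct, ex_CInt_Rcont, f_cont.
    - apply is_RInt_exp_scaled. lra. }
  eapply Rle_trans; [exact H|].
  assert (0 <= B / c * exp (c * a)).
  { apply Rmult_le_pos; [|left; apply exp_pos]. apply Rdiv_le_0_compat; lra. }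
  lra.
Qed.

Let tail (a b : R) : R := B / c * exp (c * a) + B / c * exp (- (c * b)).

Let tail_dom a b a' b' : a' <= a <= 0 -> 0 <= b <= b' ->
  Cmod (CInt f a' b' - CInt f a b) <= tail a b.
Proof.
  intros Ha Hb.
  rewrite (CInt_Chasles f a' a b'), (CInt_Chasles f a b b') by (apply ex_CInt_Rcont, f_cont).
  replace (CInt f a' a + (CInt f a b + CInt f b b') - CInt f a b)%C
    with (CInt f a' a + CInt f b b')%C by ring.
  eapply Rle_trans; [apply Cmod_triangle|]. unfold tail.
  apply Rplus_le_compat; [apply dominated_left; lra|apply dominated_right; lra].
Qed.

Lemma exp_tail_small (K eps : R) : 0 <= K -> 0 < eps -> exists M, 0 <= M /\
  forall x, M <= x -> K * exp (- (c * x)) < eps.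
Proof.
  intros HK He. exists ((K / eps) / c). split.
  { apply Rdiv_le_0_compat; [apply Rdiv_le_0_compat|]; lra. }
  intros x Hx. pose proof (exp_ineq1_le (c * x)) as H. rewrite exp_Ropp.
  assert (Hcx : K / eps <= c * x).
  { apply (Rmult_le_compat_l c) in Hx; [|lra]. replace (c * (K / eps / c)) with (K / eps) in Hx by (field; lra).
    exact Hx. }
  pose proof (exp_pos (c * x)) as E.
  apply Rmult_lt_reg_r with (exp (c * x)); [exact E|]. rewrite Rmult_assoc, Rinv_l, Rmult_1_r by lra.
  assert (K / eps < exp (c * x)) by lra.
  apply (Rmult_lt_compat_l eps) in H0; [|exact He]. replace (eps * (K / eps)) with K in H0 by (field; lra). exact H0.
Qed.

Lemma tail_small eps : 0 < eps -> exists M, 0 <= M /\ forall a b, a <= - M -> M <= b -> tail a b < eps.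
Proof.
  intros He. assert (HK : 0 <= B / c) by (apply Rdiv_le_0_compat; [apply dominated_B|lra]).
  destruct (exp_tail_small (B / c) (eps / 2) HK ltac:(lra)) as [M [HM H]].
  exists M. split; [exact HM|]. intros a b Ha Hb. unfold tail.
  pose proof (H b Hb) as H1. pose proof (H (- a) ltac:(lra)) as H2.
  replace (- (c * - a)) with (c * a) in H2 by ring. lra.
Qed.

(** Exponential domination makes the truncated integrals Cauchy; the explicit rate is what
    uniformity in a parameter needs later. *)
Lemma dominated_line_int : exists J, is_line_int f J /\
  forall a b, a <= 0 <= b -> Cmod (J - CInt f a b) <= B / c * exp (c * a) + B / c * exp (- (c * b)).
Proof.
  set (S := fun n => CInt f (- INR n) (INR n)).
  assert (Hpart : forall pr : C -> R, (forall z w, Rabs (pr z - pr w) <= Cmod (z - w)%C) ->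
     exists l : R, is_lim_seq (fun n => pr (S n)) l).
  { intros pr Hpr. enough (Hex : ex_finite_lim_seq (fun n => pr (S n))) by (destruct Hex as [l Hl]; now exists l).
    apply ex_lim_seq_cauchy_corr. intros eps.
    destruct (tail_small (eps / 2)) as [M [HM Htail]]; [pose proof (cond_pos eps); lra|].
    destruct (INR_unbounded M) as [N HN]. exists N.
    assert (H0 : forall n, (N <= n)%nat -> Cmod (S n - S N) < eps / 2).
    { intros n Hn. apply le_INR in Hn. pose proof (pos_INR N).
      apply Rle_lt_trans with (tail (- INR N) (INR N)); [|apply Htail; lra].
      apply (tail_dom (- INR N) (INR N) (- INR n) (INR n)); lra. }
    intros n m Hn Hm. eapply Rle_lt_trans; [apply Hpr|].
    replace (S n - S m)%C with ((S n - S N) + - (S m - S N))%C by ring.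
    eapply Rle_lt_trans; [apply Cmod_triangle|]. rewrite Cmod_opp.
    pose proof (H0 n Hn). pose proof (H0 m Hm). lra. }
  destruct (Hpart Re) as [l1 L1].
  { intros z w. eapply Rle_trans; [|apply re_le_Cmod]. destruct z, w. apply Rle_refl. }
  destruct (Hpart Im) as [l2 L2].
  { intros z w. eapply Rle_trans; [|apply im_le_Cmod]. destruct z, w. apply Rle_refl. }
  assert (L : is_lim_seq (fun n => Cmod ((l1, l2) - S n)%C) 0).
  { apply (is_lim_seq_le_le (fun _ => 0) _ (fun n => Rabs (l1 - Re (S n)) + Rabs (l2 - Im (S n)))).
    - intros n. split; [apply Cmod_ge_0|]. eapply Rle_trans; [apply Cmod_le_ReIm|]. apply Rle_refl.
    - apply is_lim_seq_const.
    - assert (HA : forall (s : nat -> R) (l : R), is_lim_seq s l -> is_lim_seq (fun n => Rabs (l - s n)) 0).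
      { intros s l Hs. rewrite <- Rabs_R0, <- (Rminus_diag l). apply (is_lim_seq_abs _ (l - l)).
        apply is_lim_seq_minus'; [apply is_lim_seq_const|exact Hs]. }
      apply is_lim_seq_plus_0; now apply HA. }
  assert (Hrate : forall a b, a <= 0 <= b -> Cmod ((l1, l2) - CInt f a b)%C <= tail a b).
  { intros a b Hab. destruct (INR_unbounded (Rmax (- a) b)) as [N HN].
    pose proof (Rmax_l (- a) b). pose proof (Rmax_r (- a) b).
    apply (is_lim_seq_le (fun _ => Cmod ((l1, l2) - CInt f a b)%C)
      (fun n => Cmod ((l1, l2) - S (n + N)%nat)%C + tail a b) (Cmod ((l1, l2) - CInt f a b)%C) (tail a b)).
    - intros n. replace ((l1, l2) - CInt f a b)%C with (((l1, l2) - S (n + N)%nat) + (S (n + N)%nat - CInt f a b))%C by ring.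
      eapply Rle_trans; [apply Cmod_triangle|]. apply Rplus_le_compat_l.
      pose proof (le_INR N (n + N) ltac:(lia)).
      apply (tail_dom a b (- INR (n + N)) (INR (n + N))); lra.
    - apply is_lim_seq_const.
    - rewrite <- (Rplus_0_l (tail a b)) at 1. apply is_lim_seq_plus'; [|apply is_lim_seq_const].
      apply (is_lim_seq_incr_n (fun n => Cmod ((l1, l2) - S n)%C)), L. }
  exists (l1, l2). split; [|exact Hrate].
  intros P HP. apply locally_C in HP. destruct HP as [eps [He HP]].
  destruct (tail_small eps He) as [M [HM Htail]].
  exists (fun a => a < - M) (fun b => M < b).
  - now exists (- M).
  - now exists M.
  - intros a b Ha Hb. exists (CInt f a b). split; [apply CInt_correct, ex_CInt_Rcont, f_cont|].
    apply HP. rewrite <- Cmod_opp. replace (- (CInt f a b - (l1, l2)))%C with ((l1, l2) - CInt f a b)%C by ring.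
    eapply Rle_lt_trans; [apply Hrate; lra|]. apply Htail; lra.
Qed.

End Dominated.

Lemma is_line_int_dominated_bound (f : R -> C) (B c : R) (J : C) : (forall x, Rcont f x) -> 0 < c ->
  (forall x, Cmod (f x) <= B * exp (- (c * Rabs x))) -> is_line_int f J -> Cmod J <= 2 * B / c.
Proof.
  intros Hf Hc Hd HJ. destruct (dominated_line_int f B c Hf Hc Hd) as [J' [HJ' H]].
  assert (E : J = J') by (rewrite <- (line_int_unique f J HJ); now apply line_int_unique).
  subst J'. specialize (H 0 0 ltac:(lra)).
  assert (E0 : CInt f 0 0 = RtoC 0) by (apply is_CInt_unique, (is_RInt_point (V := C_R_NormedModule))).
  rewrite E0 in H. replace (J - 0)%C with J in H by ring.
  rewrite Rmult_0_r, Ropp_0, exp_0 in H. eapply Rle_trans; [exact H|]. right. field. lra.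
Qed.

Lemma continuity_2d_of_continuous (f : R * R -> R) x y :
  continuous f (x, y) -> continuity_2d_pt (fun a b => f (a, b)) x y.
Proof.
  intros H. apply continuity_2d_pt_filterlim. intros P HP.
  specialize (H P HP). unfold filtermap in *.
  generalize H. apply filter_imp. intros [a b]. exact (fun h => h).
Qed.

Lemma Ccont_slice (f : R -> R -> C) x m :
  Ccont (fun xm : R * R => f (fst xm) (snd xm)) (x, m) -> Rcont (fun x => f x m) x.
Proof.
  intros H. apply (continuous_comp (fun x => (x, m)) (fun xm => f (fst xm) (snd xm))); [|exact H].
  apply continuous_pair; [apply continuous_id|apply continuous_const].
Qed.

(** Uniform continuity on the compact segment. *)
Lemma CInt_param_cont (f : R -> R -> C) a b m0 : a <= b ->
  (forall x m, Ccont (fun xm : R * R => f (fst xm) (snd xm)) (x, m)) ->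
  Rcont (fun m => CInt (fun x => f x m) a b) m0.
Proof.
  intros Hab Hf. apply Ccont_iff. intros e He.
  set (e1 := e / (4 * (b - a + 1))).
  assert (He1 : 0 < e1) by (apply Rdiv_lt_0_compat; lra).
  assert (HRe : forall x, a <= x <= b -> continuity_2d_pt (fun m x => Re (f x m)) m0 x).
  { intros x _. apply (continuity_2d_of_continuous (fun mx => Re (f (snd mx) (fst mx)))).
    apply continuous_Re. apply (continuous_comp (fun mx : R * R => (snd mx, fst mx)) (fun xm => f (fst xm) (snd xm))).
    - apply continuous_pair; [apply continuous_snd|apply continuous_fst].
    - apply Hf. }
  assert (HIm : forall x, a <= x <= b -> continuity_2d_pt (fun m x => Im (f x m)) m0 x).
  { intros x _. apply (continuity_2d_of_continuous (fun mx => Im (f (snd mx) (fst mx)))).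
    apply continuous_Im. apply (continuous_comp (fun mx : R * R => (snd mx, fst mx)) (fun xm => f (fst xm) (snd xm))).
    - apply continuous_pair; [apply continuous_snd|apply continuous_fst].
    - apply Hf. }
  destruct (uniform_continuity_2d_1d' _ a b m0 HRe (mkposreal e1 He1)) as [d1 H1].
  destruct (uniform_continuity_2d_1d' _ a b m0 HIm (mkposreal e1 He1)) as [d2 H2].
  assert (Hd : 0 < Rmin d1 d2) by (apply Rmin_glb_lt; apply cond_pos).
  exists (mkposreal _ Hd). intros m Hm. change (Rabs (m - m0) < Rmin d1 d2) in Hm.
  assert (Hcx : forall m' x, Rcont (fun x => f x m') x).
  { intros m' x. apply (Ccont_slice f), Hf. }
  assert (HI : is_CInt (fun x => f x m - f x m0)%C a b (CInt (fun x => f x m) a b - CInt (fun x => f x m0) a b)%C).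
  { apply is_CInt_minus; apply CInt_correct, ex_CInt_Rcont, Hcx. }
  eapply Rle_lt_trans; [apply (is_CInt_norm_const (fun x => f x m - f x m0)%C a b _ (2 * e1) Hab); [|exact HI]|].
  - intros x Hx. pose proof (Rmin_l d1 d2). pose proof (Rmin_r d1 d2). apply Rabs_def2 in Hm.
    eapply Rle_trans; [apply Cmod_le_ReIm|].
    specialize (H1 x m0 x m Hx ltac:(lra) Hx ltac:(lra)).
    specialize (H2 x m0 x m Hx ltac:(lra) Hx ltac:(lra)).
    rewrite Rminus_diag, Rabs_R0 in H1, H2.
    specialize (H1 (cond_pos d1)). specialize (H2 (cond_pos d2)). simpl in H1, H2.
    assert (R1 : Re (f x m - f x m0) = Re (f x m) - Re (f x m0)) by reflexivity.
    assert (R2 : Im (f x m - f x m0) = Im (f x m) - Im (f x m0)) by reflexivity.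
    rewrite R1, R2. lra.
  - unfold e1. apply Rmult_lt_reg_r with (4 * (b - a + 1)); [lra|].
    replace ((b - a) * (2 * (e / (4 * (b - a + 1)))) * (4 * (b - a + 1))) with (2 * e * (b - a)) by (field; lra).
    nra.
Qed.

(** The tails are small uniformly in the parameter, so continuity passes from the
    truncated integrals to the improper ones. *)
Lemma line_int_param_cont (f : R -> R -> C) (J : R -> C) B c :
  (forall x m, Ccont (fun xm : R * R => f (fst xm) (snd xm)) (x, m)) -> 0 < c ->
  (forall x m, Cmod (f x m) <= B * exp (- (c * Rabs x))) ->
  (forall m, is_line_int (fun x => f x m) (J m)) -> forall m, Rcont J m.
Proof.
  intros Hf Hc Hd HJ m0.
  assert (Hcx : forall m' x, Rcont (fun x => f x m') x).
  { intros m' x. apply (Ccont_slice f), Hf. }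
  assert (Hrate : forall m a b, a <= 0 <= b ->
     Cmod (J m - CInt (fun x => f x m) a b) <= B / c * exp (c * a) + B / c * exp (- (c * b))).
  { intros m. destruct (dominated_line_int (fun x => f x m) B c (Hcx m) Hc (fun x => Hd x m)) as [J' [HJ' H]].
    assert (E : J m = J') by (rewrite <- (line_int_unique _ _ (HJ m)); now apply line_int_unique).
    now rewrite E. }
  apply Ccont_iff. intros e He.
  destruct (tail_small (fun x => f x m0) B c Hc (fun x => Hd x m0) (e / 3) ltac:(lra)) as [M [HM Htail]].
  pose proof (Htail (- M) M ltac:(lra) ltac:(lra)) as HT.
  assert (Hcont := CInt_param_cont f (- M) M m0 ltac:(lra) Hf).
  apply Ccont_iff with (e := e / 3) in Hcont; [|lra].
  generalize Hcont. apply filter_imp. intros m Hm.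
  replace (J m - J m0)%C with ((J m - CInt (fun x => f x m) (- M) M)
    + ((CInt (fun x => f x m) (- M) M - CInt (fun x => f x m0) (- M) M)
    + - (J m0 - CInt (fun x => f x m0) (- M) M)))%C by ring.
  eapply Rle_lt_trans; [apply Cmod_triangle|].
  eapply Rle_lt_trans; [apply Rplus_le_compat_l, Cmod_triangle|]. rewrite Cmod_opp.
  pose proof (Hrate m (- M) M ltac:(lra)). pose proof (Hrate m0 (- M) M ltac:(lra)). lra.
Qed.

(** In the coordinate [v = e^x cis d] the measure [dv / v] becomes [dx], and the endpoints [0] and
    infinity play symmetric roles. *)
Lemma ray_int_log (d : R) (F : C -> C) B c J :
  (forall x, Rcont (fun x => F (RtoC (exp x) * cis d)%C) x) -> 0 < c ->
  (forall x, Cmod (F (RtoC (exp x) * cis d)%C) <= B * exp (- (c * Rabs x))) ->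
  is_line_int (fun x => F (RtoC (exp x) * cis d)%C) J ->
  ray_int d (fun v => F v / v)%C = J.
Proof.
  intros HF Hc Hd HJ.
  assert (Hcis : cis d <> 0).
  { intros E. unfold cis in E. injection E as E1 E2. pose proof (sin2_cos2 d) as H.
    rewrite E1, E2 in H. unfold Rsqr in H. lra. }
  set (g := fun r => (F (RtoC r * cis d) / (RtoC r * cis d) * cis d)%C).
  assert (Hg : forall r, 0 < r -> Rcont g r).
  { intros r Hr. unfold g. unfold Cdiv. apply Ccont_mult; [|apply Ccont_const].
    apply Ccont_mult.
    - apply (continuous_ext_loc _ (fun r => F (RtoC (exp (ln r)) * cis d)%C)).
      + exists (mkposreal r Hr). intros y Hy. change (Rabs (y - r) < r) in Hy.
        apply Rabs_def2 in Hy. rewrite exp_ln; [reflexivity|lra].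
      + apply (continuous_comp ln (fun x => F (RtoC (exp x) * cis d)%C)); [|apply HF].
        apply (ex_derive_continuous (V := R_NormedModule)). auto_derive. exact Hr.
    - apply Ccont_inv.
      + apply Cmult_neq_0; [|exact Hcis]. intros E. apply RtoC_inj in E. lra.
      + apply Ccont_mult; [|apply Ccont_const]. apply Ccont_RtoC, continuous_id. }
  assert (Hsub : forall a b, CInt (fun x => F (RtoC (exp x) * cis d)%C) a b = CInt g (exp a) (exp b)).
  { intros a b. apply is_CInt_unique.
    eapply (is_CInt_ext (fun y => scal (exp y) (g (exp y)))).
    - intros x _. rewrite scal_R_Cmult. unfold g.
      assert (RtoC (exp x) <> 0) by (intros E; apply RtoC_inj in E; pose proof (exp_pos x); lra).
      field. auto.
    - apply (is_RInt_comp (V := C_R_CompleteNormedModule) g exp exp).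
      + intros x _. apply Hg, exp_pos.
      + intros x _. split; [auto_derive; [exact I|ring]|].
        apply (ex_derive_continuous (V := R_NormedModule)). auto_derive. exact I. }
  unfold ray_int. 
  apply (is_RInt_gen_unique (V := C_R_CompleteNormedModule) (Fa := at_right 0) (Fb := Rbar_locally p_infty) g J).
  destruct (dominated_line_int _ B c HF Hc Hd) as [J' [HJ' Hrate]].
  assert (E : J = J') by (rewrite <- (line_int_unique _ _ HJ); now apply line_int_unique).
  subst J'.
  intros P HP. apply locally_C in HP. destruct HP as [eps [He HP]].
  destruct (tail_small _ B c Hc Hd eps He) as [M [HM Htail]].
  exists (fun a => 0 < a < exp (- M)) (fun b => exp M < b).
  - exists (mkposreal _ (exp_pos (- M))). intros y Hy Hy0. change (Rabs (y - 0) < exp (- M)) in Hy.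
    apply Rabs_def2 in Hy. lra.
  - now exists (exp M).
  - intros a b Ha Hb. exists (CInt g a b).
    pose proof (exp_pos M) as EM. simpl fst. simpl snd. split.
    + apply CInt_correct, ex_CInt_cont. intros x Hx. apply Hg.
      apply Rlt_le_trans with (Rmin a b); [apply Rmin_glb_lt; lra|lra].
    + apply HP. rewrite <- (exp_ln a), <- (exp_ln b), <- Hsub by lra.
      assert (L1 : ln a <= - M) by (rewrite <- (ln_exp (- M)); left; apply ln_increasing; lra).
      assert (L2 : M <= ln b) by (rewrite <- (ln_exp M); left; apply ln_increasing; lra).
      rewrite <- Cmod_opp.
      match goal with |- Cmod (- (?X - ?Y))%C < _ => replace (- (X - Y))%C with (Y - X)%C by ring end.
      eapply Rle_lt_trans; [apply Hrate; lra|]. apply Htail; lra.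
Qed.

(** * Cauchy's theorem in logarithmic coordinates *)

Lemma Cmod_cis y : Cmod (cis y) = 1.
Proof.
  unfold cis, Cmod. simpl. rewrite !Rmult_1_r, <- sqrt_1. f_equal.
  pose proof (sin2_cos2 y) as H. unfold Rsqr in H. lra.
Qed.

Lemma cis_neq_0 y : cis y <> 0.
Proof. apply Cmod_gt_0. rewrite Cmod_cis. lra. Qed.

Lemma cis_plus x y : cis (x + y) = (cis x * cis y)%C.
Proof. unfold cis, Cmult. simpl. rewrite cos_plus, sin_plus. f_equal; ring. Qed.

Definition polar (x y : R) : C := (RtoC (exp x) * cis y)%C.

Lemma polar_Cexp x y : polar x y = Cexp (x, y).
Proof. unfold polar, Cexp, cis, Cmult, RtoC, Re, Im. simpl. f_equal; ring. Qed.

Lemma Cmod_polar x y : Cmod (polar x y) = exp x.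
Proof. unfold polar. rewrite Cmod_mult, Cmod_R, Cmod_cis, Rabs_pos_eq; [ring|left; apply exp_pos]. Qed.

Lemma polar_neq_0 x y : polar x y <> 0.
Proof. apply Cmod_gt_0. rewrite Cmod_polar. apply exp_pos. Qed.

Lemma polar_div x y x' y' : (polar x y / polar x' y')%C = polar (x - x') (y - y').
Proof.
  assert (H := polar_neq_0 x' y').
  assert (E : (polar (x - x') (y - y') * polar x' y')%C = polar x y).
  { unfold polar. replace x with ((x - x') + x') at 2 by ring. replace y with ((y - y') + y') at 2 by ring.
    rewrite exp_plus, cis_plus, RtoC_mult. ring. }
  rewrite <- E. field. exact H.
Qed.

Lemma Ccont_polar {U : UniformSpace} (f g : U -> R) (x : U) :
  continuous f x -> continuous g x -> Ccont (fun t => polar (f t) (g t)) x.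
Proof.
  intros Hf Hg. apply (continuous_ext (fun t => Cexp (f t, g t))).
  - intros t. symmetry. apply polar_Cexp.
  - apply Ccont_Cexp, Ccont_pair; assumption.
Qed.

Section LogCauchy.
Variable F : C -> C.

Lemma cdiff_log x y : cdiff F (polar x y) -> cdiff (fun w => F (Cexp w)) (x, y).
Proof. intros H. apply cdiff_comp; [apply cdiff_Cexp|]. now rewrite <- polar_Cexp. Qed.

(** Goursat's theorem for [F (Cexp w)]: the sides of a rectangle in [w] are radial segments and
    circular arcs in [v], and the measure [dv / v] becomes [dw]. *)
Lemma log_cauchy a b c d : a <= b -> c <= d ->
  (forall x y, a <= x <= b -> c <= y <= d -> cdiff F (polar x y)) ->
  (CInt (fun x => F (polar x c)) a b + Ci * CInt (fun y => F (polar b y)) c d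
   - CInt (fun x => F (polar x d)) a b - Ci * CInt (fun y => F (polar a y)) c d)%C = 0.
Proof.
  intros Hab Hcd HF.
  rewrite <- (goursat (fun w => F (Cexp w)) a b c d (fun x y Hx Hy => cdiff_log x y (HF x y Hx Hy)) Hab Hcd).
  unfold rect_int.
  assert (E : forall (f g : R -> C) s t, (forall x, f x = g x) -> CInt f s t = CInt g s t).
  { intros f g s t H. apply (RInt_ext (V := C_R_CompleteNormedModule)). intros x _. apply H. }
  rewrite (E (fun x => F (polar x c)) (fun x => F (Cexp (x, c)))) by (intros; now rewrite polar_Cexp).
  rewrite (E (fun x => F (polar x d)) (fun x => F (Cexp (x, d)))) by (intros; now rewrite polar_Cexp).
  rewrite (E (fun y => F (polar a y)) (fun y => F (Cexp (a, y)))) by (intros; now rewrite polar_Cexp).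
  rewrite (E (fun y => F (polar b y)) (fun y => F (Cexp (b, y)))) by (intros; now rewrite polar_Cexp).
  reflexivity.
Qed.

Lemma Ccont_arc x y : cdiff F (polar x y) -> Rcont (fun y => F (polar x y)) y.
Proof.
  intros H. apply (continuous_comp (fun y => polar x y) F); [|now apply cdiff_cont].
  apply Ccont_polar; [apply continuous_const|apply continuous_id].
Qed.

Lemma Ccont_ray x y : cdiff F (polar x y) -> Rcont (fun x => F (polar x y)) x.
Proof.
  intros H. apply (continuous_comp (fun x => polar x y) F); [|now apply cdiff_cont].
  apply Ccont_polar; [apply continuous_id|apply continuous_const].
Qed.

Lemma arc_bound x c d M : c <= d -> (forall y, c <= y <= d -> cdiff F (polar x y)) ->
  (forall y, c <= y <= d -> Cmod (F (polar x y)) <= M) ->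
  Cmod (CInt (fun y => F (polar x y)) c d) <= (d - c) * M.
Proof.
  intros Hcd HF HM. apply (is_CInt_norm_const (fun y => F (polar x y)) c d); auto.
  apply CInt_correct, ex_CInt_cont. intros y Hy. rewrite Rmin_left, Rmax_right in Hy by lra.
  apply Ccont_arc. now apply HF.
Qed.

(** Rotating a radial segment costs at most the integrals over the two arcs joining the
    endpoints. *)
Lemma rotate_segment a b c d Ma Mb : a <= b ->
  (forall x y, a <= x <= b -> Rmin c d <= y <= Rmax c d -> cdiff F (polar x y)) ->
  (forall y, Rmin c d <= y <= Rmax c d -> Cmod (F (polar a y)) <= Ma) ->
  (forall y, Rmin c d <= y <= Rmax c d -> Cmod (F (polar b y)) <= Mb) ->
  Cmod (CInt (fun x => F (polar x c)) a b - CInt (fun x => F (polar x d)) a b) <= Rabs (d - c) * (Ma + Mb).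
Proof.
  intros Hab.
  assert (Hle : forall c d, c <= d ->
    (forall x y, a <= x <= b -> c <= y <= d -> cdiff F (polar x y)) ->
    (forall y, c <= y <= d -> Cmod (F (polar a y)) <= Ma) ->
    (forall y, c <= y <= d -> Cmod (F (polar b y)) <= Mb) ->
    Cmod (CInt (fun x => F (polar x c)) a b - CInt (fun x => F (polar x d)) a b) <= (d - c) * (Ma + Mb)).
  { clear c d. intros c d Hcd HF HMa HMb. pose proof (log_cauchy a b c d Hab Hcd HF) as HC.
    pose proof (arc_bound a c d Ma Hcd (fun y => HF a y ltac:(lra)) HMa) as B1.
    pose proof (arc_bound b c d Mb Hcd (fun y => HF b y ltac:(lra)) HMb) as B2.
    set (I1 := CInt (fun x => F (polar x c)) a b) in *. set (I2 := CInt (fun x => F (polar x d)) a b) in *.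
    set (A1 := CInt (fun y => F (polar a y)) c d) in *. set (A2 := CInt (fun y => F (polar b y)) c d) in *.
    replace (I1 - I2)%C with ((I1 + Ci * A2 - I2 - Ci * A1) + (Ci * A1 + - (Ci * A2)))%C by ring.
    rewrite HC, Cplus_0_l. eapply Rle_trans; [apply Cmod_triangle|].
    rewrite Cmod_opp, !Cmod_mult, Cmod_Ci. lra. }
  intros HF HMa HMb. destruct (Rle_dec c d) as [H|H].
  - rewrite Rmin_left, Rmax_right in * by lra. rewrite Rabs_pos_eq by lra. now apply Hle.
  - rewrite Rmin_right, Rmax_left in * by lra. rewrite Rabs_left by lra.
    rewrite <- Cmod_opp.
    match goal with |- Cmod (- (?X - ?Y))%C <= _ => replace (- (X - Y))%C with (Y - X)%C by ring end.
    replace (- (d - c)) with (c - d) by ring. apply Hle; auto. lra.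
Qed.

End LogCauchy.

(** In logarithmic coordinates about the centre the horizontal sides cancel by periodicity,
    so circular means do not depend on the radius. *)
Lemma mean_value_bound (f : C -> C) v0 r M : 0 < r ->
  (forall v, Cmod (v - v0) <= r -> cdiff f v) ->
  (forall v, Cmod (v - v0) = r -> Cmod (f v) <= M) -> Cmod (f v0) <= M.
Proof.
  intros Hr Hf HM. set (F := fun w => f (v0 + w)%C).
  assert (Hmod : forall w, Cmod (v0 + w - v0) = Cmod w) by (intros w; f_equal; ring).
  assert (HF : forall x y, x <= ln r -> cdiff F (polar x y)).
  { intros x y Hx. unfold F. apply (cdiff_comp f (fun w => v0 + w)%C).
    - apply cdiff_plus; [apply cdiff_const|apply cdiff_id].
    - apply Hf. rewrite Hmod, Cmod_polar. rewrite <- (exp_ln r) by exact Hr.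
      now apply exp_le_mono. }
  assert (Hb : Cmod (CInt (fun y => F (polar (ln r) y)) 0 (2 * PI)) <= (2 * PI - 0) * M).
  { pose proof PI_RGT_0. apply arc_bound; [lra|intros; apply HF; lra|].
    intros y _. apply HM. rewrite Hmod, Cmod_polar. now apply exp_ln. }
  apply le_epsilon. intros e He.
  assert (Hc : cdiff f v0) by (apply Hf; replace (v0 - v0)%C with (RtoC 0) by ring; rewrite Cmod_0; lra).
  apply cdiff_cont in Hc. apply Ccont_iff with (e := e) in Hc; [|exact He].
  apply locally_C in Hc. destruct Hc as [del [Hdel Hc]].
  (* On the circle of radius [e^a] the function is within [e] of its value at the centre. *)
  set (a := Rmin (ln r) (ln (del / 2))).
  assert (Ha : a <= ln r) by apply Rmin_l.
  assert (Hea : exp a < del).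
  { apply Rle_lt_trans with (exp (ln (del / 2))); [|rewrite exp_ln; lra].
    apply exp_le_mono, Rmin_r. }
  pose proof PI_RGT_0 as HPI.
  assert (HI : Cmod (CInt (fun y => F (polar a y)) 0 (2 * PI) - RtoC (2 * PI) * f v0) <= (2 * PI - 0) * e).
  { apply (is_CInt_norm_const (fun y => F (polar a y) - f v0)%C 0 (2 * PI)); [lra| |].
    - intros y _. left. apply Hc. rewrite Hmod, Cmod_polar. exact Hea.
    - apply is_CInt_minus.
      + apply CInt_correct, ex_CInt_cont. intros y _. apply Ccont_arc, HF. exact Ha.
      + eapply (is_CInt_ext (fun y => f v0 + RtoC 0 * RtoC y)%C); [intros; ring|].
        replace (RtoC (2 * PI) * f v0)%C with
          (f v0 * RtoC (2 * PI - 0) + RtoC 0 * RtoC (((2 * PI) ^ 2 - 0 ^ 2) / 2))%C.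
        * apply is_CInt_affine.
        * rewrite Rminus_0_r. ring. }
  pose proof (log_cauchy F a (ln r) 0 (2 * PI) Ha ltac:(lra) (fun x y Hx _ => HF x y (proj2 Hx))) as HC.
  assert (E : CInt (fun x => F (polar x (2 * PI))) a (ln r) = CInt (fun x => F (polar x 0)) a (ln r)).
  { apply (RInt_ext (V := C_R_CompleteNormedModule)). intros x _. unfold polar, cis.
    now rewrite cos_2PI, sin_2PI, cos_0, sin_0. }
  rewrite E in HC.
  set (A1 := CInt (fun y => F (polar a y)) 0 (2 * PI)) in *.
  set (A2 := CInt (fun y => F (polar (ln r) y)) 0 (2 * PI)) in *.
  set (I0 := CInt (fun x => F (polar x 0)) a (ln r)) in *.
  assert (EA : A1 = A2).
  { apply Ceq_minus. 
    assert (H : (Ci * (A2 - A1))%C = 0) by (rewrite <- HC; ring).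
    apply (f_equal (Cmult Ci)) in H. rewrite Cmult_assoc in H.
    replace (Ci * Ci)%C with (- RtoC 1)%C in H by (unfold Ci, Cmult, Copp, RtoC; simpl; f_equal; ring).
    transitivity (- RtoC 1 * (A2 - A1))%C; [ring|]. rewrite H. ring. }
  rewrite EA in HI.
  assert (HT := Cmod_triangle A2 (- (A2 - RtoC (2 * PI) * f v0))).
  replace (A2 + - (A2 - RtoC (2 * PI) * f v0))%C with (RtoC (2 * PI) * f v0)%C in HT by ring.
  rewrite Cmod_opp, Cmod_mult, Cmod_R, Rabs_pos_eq in HT by lra.
  apply Rmult_le_reg_l with (2 * PI); [lra|]. lra.
Qed.

(** * Sectors and directions *)

Lemma Rabs_atan_le t : Rabs (atan t) <= Rabs t.
Proof.
  destruct (MVT_gen atan 0 t (fun x => / (1 + x ^ 2))) as [c [_ Hc]].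
  - intros x _. auto_derive; [exact I|]. field. nra.
  - intros x _. apply derivable_continuous_pt, derivable_pt_atan.
  - rewrite atan_0, !Rminus_0_r in Hc. rewrite Hc, Rabs_mult.
    assert (H : 0 < / (1 + c ^ 2) <= 1).
    { split; [apply Rinv_0_lt_compat; nra|]. rewrite <- Rinv_1. apply Rinv_le_contravar; nra. }
    rewrite (Rabs_pos_eq (/ _)) by lra. pose proof (Rabs_pos t). nra.
Qed.

Lemma infinite_sector_ray d A x : infinite_sector d A -> A (polar x d).
Proof.
  intros [eta [Heta H]]. apply H. exists (exp x), d. split; [apply exp_pos|]. split; [|reflexivity].
  rewrite Rminus_diag, Rabs_R0. lra.
Qed.

(** A sector is a cone, so a disc about a point of the bisecting ray can be chosen with radius
    proportional to the modulus. *)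
Lemma infinite_sector_disc d A : infinite_sector d A -> exists c, 0 < c <= 1 / 2 /\
  forall x v, Cmod (v - polar x d) <= c * exp x -> A v.
Proof.
  intros [eta [Heta H]]. exists (Rmin (1 / 2) (eta / 3)).
  assert (Hc : 0 < Rmin (1 / 2) (eta / 3)) by (apply Rmin_glb_lt; lra).
  pose proof (Rmin_l (1 / 2) (eta / 3)) as H1. pose proof (Rmin_r (1 / 2) (eta / 3)) as H2.
  set (c := Rmin (1 / 2) (eta / 3)) in *. split; [lra|]. intros x v Hv.
  pose proof (polar_neq_0 x d) as Hp.
  set (h := (v / polar x d - 1)%C).
  assert (Hh : Cmod h <= c).
  { replace h with ((v - polar x d) / polar x d)%C by (unfold h; field; exact Hp).
    rewrite Cmod_div, Cmod_polar by exact Hp. pose proof (exp_pos x).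
    apply Rmult_le_reg_r with (exp x); [lra|]. unfold Rdiv. rewrite Rmult_assoc, Rinv_l by lra. lra. }
  pose proof (re_le_Cmod h) as Hx. pose proof (im_le_Cmod h) as Hy.
  assert (Ev : v = (polar x d * (1 + h))%C) by (unfold h; field; exact Hp).
  destruct h as [hx hy]. unfold Re, Im in Hx, Hy. simpl in Hx, Hy.
  assert (Hx1 : 1 / 2 <= 1 + hx) by (assert (- c <= hx) by (apply Rabs_le_between with (x := hx); lra); lra).
  set (t := hy / (1 + hx)).
  assert (Ht : Rabs t < eta).
  { unfold t, Rdiv. rewrite Rabs_mult, (Rabs_pos_eq (/ _)) by (left; apply Rinv_0_lt_compat; lra).
    assert (/ (1 + hx) <= 2).
    { replace 2 with (/ (1 / 2)) by field. apply Rinv_le_contravar; lra. }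
    assert (0 < / (1 + hx)) by (apply Rinv_0_lt_compat; lra).
    pose proof (Rabs_pos hy). nra. }
  apply H. exists (exp x * ((1 + hx) * sqrt (1 + t ^ 2))), (d + atan t).
  assert (Hs : 0 < sqrt (1 + t ^ 2)) by (apply sqrt_lt_R0; nra).
  split; [pose proof (exp_pos x); apply Rmult_lt_0_compat; [lra|apply Rmult_lt_0_compat; lra]|].
  split. { replace (d + atan t - d) with (atan t) by ring. pose proof (Rabs_atan_le t). lra. }
  rewrite Ev. unfold polar. rewrite cis_plus, RtoC_mult.
  replace (RtoC 1 + (hx, hy))%C with (RtoC ((1 + hx) * sqrt (1 + t ^ 2)) * cis (atan t))%C; [ring|].
  unfold cis. rewrite cos_atan, sin_atan. unfold Cmult, RtoC, Cplus. simpl fst. simpl snd.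
  replace (t * (t * 1)) with (Rsqr t) by (unfold Rsqr; ring). rewrite <- Rsqr_pow2 in Hs.
  f_equal.
  - field. lra.
  - transitivity ((1 + hx) * t); [field; lra|]. unfold t. field. lra.
Qed.

Lemma polar_form (T : C) d : T <> 0 -> exists psi, Rabs psi <= PI /\ T = polar (ln (Cmod T)) (d + psi).
Proof.
  intros HT. assert (H0 : 0 < Cmod T) by now apply Cmod_gt_0.
  set (w := (T / RtoC (Cmod T) * cis (- d))%C).
  assert (Hw : Cmod w = 1).
  { unfold w. rewrite Cmod_mult, Cmod_cis, Cmod_div, Cmod_R, Rabs_pos_eq; [field; lra|lra|].
    apply RtoC_neq_0. lra. }
  enough (exists psi, Rabs psi <= PI /\ w = cis psi) as [psi [Hpsi Ew]].
  { exists psi. split; [exact Hpsi|]. unfold polar. rewrite exp_ln, cis_plus by exact H0.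
    rewrite <- Ew. unfold w.
    transitivity (T * (cis (- d) * cis d))%C.
    - rewrite <- cis_plus. replace (- d + d) with 0 by ring. unfold cis. rewrite cos_0, sin_0.
      change (1, 0) with (RtoC 1). ring.
    - field. apply RtoC_neq_0. lra. }
  clearbody w. destruct w as [x y].
  assert (Hxy : x * x + y * y = 1).
  { pose proof (Cmod2_alt (x, y)) as H. rewrite Hw in H. unfold Re, Im in H. simpl in H. lra. }
  assert (Hx : -1 <= x <= 1) by nra.
  pose proof (acos_bound x) as HA.
  assert (Es : sqrt (1 - x ^ 2) = Rabs y).
  { rewrite <- sqrt_Rsqr_abs. f_equal. unfold Rsqr. lra. }
  destruct (Rle_dec 0 y) as [Hy|Hy].
  - exists (acos x). split; [rewrite Rabs_pos_eq; lra|]. unfold cis. rewrite cos_acos, sin_acos by exact Hx.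
    rewrite Rsqr_pow2, Es, Rabs_pos_eq by exact Hy. reflexivity.
  - exists (- acos x). split; [rewrite Rabs_Ropp, Rabs_pos_eq; lra|]. unfold cis.
    rewrite cos_neg, sin_neg, cos_acos, sin_acos by exact Hx.
    rewrite Rsqr_pow2, Es, Rabs_left by lra. rewrite Ropp_involutive. reflexivity.
Qed.

Lemma Cmod_1_plus_cis r y : Cmod (1 + RtoC r * cis y) = sqrt (1 + 2 * r * cos y + r ^ 2).
Proof.
  unfold Cmod, cis, Cplus, Cmult, RtoC. simpl fst. simpl snd. f_equal.
  pose proof (sin2_cos2 y) as H. unfold Rsqr in H.
  replace ((1 + (r * cos y - 0 * sin y)) ^ 2 + (0 + (r * sin y + 0 * cos y)) ^ 2)
    with (1 + 2 * r * cos y + r ^ 2 * (sin y * sin y + cos y * cos y)) by ring.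
  rewrite H. ring.
Qed.

Lemma cos_Rabs y : cos y = cos (Rabs y).
Proof. unfold Rabs. destruct (Rcase_abs y); [now rewrite cos_neg|reflexivity]. Qed.

(** Turning towards the positive axis moves a ray away from [-1]. *)
Lemma Cmod_1_plus_cis_mono r y y' : 0 <= r -> Rabs y' <= Rabs y <= PI ->
  Cmod (1 + RtoC r * cis y) <= Cmod (1 + RtoC r * cis y').
Proof.
  intros Hr Hy. rewrite !Cmod_1_plus_cis. apply sqrt_le_1_alt.
  assert (cos y <= cos y').
  { rewrite (cos_Rabs y), (cos_Rabs y'). pose proof (Rabs_pos y').
    destruct (proj1 Hy) as [H1|H1]; [left; apply cos_decreasing_1; lra|right; now rewrite H1]. }
  nra.
Qed.

Lemma Rset_polar {X : setting} th x psi : Rset th (polar x (th + psi)) <->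
  forall r, 0 <= r -> tdelta < Cmod (1 + RtoC r * cis psi).
Proof.
  assert (E : forall r s, 0 <= r -> s = r * exp (- x) ->
     Cmod (1 + RtoC r * cis th / polar x (th + psi)) = Cmod (1 + RtoC s * cis psi)).
  { intros r s Hr ->. replace (RtoC r * cis th / polar x (th + psi))%C with (RtoC (r * exp (- x)) * cis (- psi))%C.
    - rewrite !Cmod_1_plus_cis, cos_neg. reflexivity.
    - unfold polar. rewrite RtoC_mult, exp_Ropp, RtoC_inv, cis_plus by (pose proof (exp_pos x); lra).
      assert (Ei : (cis (- psi) * cis psi)%C = 1).
      { rewrite <- cis_plus. replace (- psi + psi) with 0 by ring. unfold cis. now rewrite cos_0, sin_0. }
      pose proof (cis_neq_0 th). pose proof (cis_neq_0 psi). pose proof (exp_neq_0 x).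
      replace (cis (- psi)) with (/ cis psi)%C.
      + field. auto.
      + rewrite <- (Cmult_1_l (/ cis psi)), <- Ei. field. auto. }
  pose proof (exp_pos x) as Ex. pose proof (exp_pos (- x)) as Ex'.
  split.
  - intros [_ H] r Hr. specialize (H (r * exp x) ltac:(nra)).
    rewrite (E (r * exp x) r) in H; [exact H|nra|].
    rewrite Rmult_assoc, <- exp_plus. replace (x + - x) with 0 by ring. rewrite exp_0. ring.
  - intros H. split; [apply polar_neq_0|]. intros r Hr.
    rewrite (E r (r * exp (- x)) Hr eq_refl). apply H. nra.
Qed.

Lemma off_negative_polar {X : setting} x psi :
  (forall r, 0 <= r -> tdelta < Cmod (1 + RtoC r * cis psi)) -> off_negative tdelta (polar x psi).
Proof.
  intros H r Hr. unfold polar. rewrite Cmult_assoc, <- RtoC_mult. left. apply H.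
  pose proof (exp_pos x). nra.
Qed.

(** * Growth of the q-Laplace transforms *)

Lemma Cmod_div_le (a b : C) A B : Cmod a <= A -> 0 < B <= Cmod b -> Cmod (a / b) <= A / B.
Proof.
  intros Ha Hb. assert (Hb0 : b <> 0) by (apply Cmod_gt_0; lra).
  rewrite Cmod_div by exact Hb0. unfold Rdiv. apply Rmult_le_compat; [apply Cmod_ge_0| |exact Ha|].
  - left. apply Rinv_0_lt_compat. lra.
  - apply Rinv_le_contravar; lra.
Qed.

Lemma ln_gt_0 x : 1 < x -> 0 < ln x.
Proof. intros H. rewrite <- ln_1. apply ln_increasing; lra. Qed.

Lemma Theta_polar_lower (q k del : R) : 1 < q -> 0 < k -> 0 < del -> exists c, 0 < c /\
  forall x psi, off_negative del (polar x psi) ->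
  c * exp (k / (2 * ln q) * x ^ 2 + x / 2) <= Cmod (Theta q k (polar x psi)).
Proof.
  intros Hq Hk Hd. pose proof (ln_gt_0 q Hq) as HL.
  destruct (theta_lower (ln q / k) ltac:(now apply Rdiv_lt_0_compat) del Hd) as [c [Hc H]].
  exists c. split; [exact Hc|]. intros x psi Hoff. rewrite Theta_theta by exact Hk.
  eapply Rle_trans; [|apply H; [apply polar_neq_0|exact Hoff]].
  right. rewrite Cmod_polar, ln_exp. unfold theta_growth. do 2 f_equal. field. lra.
Qed.

Lemma cdiff_Theta (q k : R) (z : C) : 1 < q -> 0 < k -> z <> 0 -> cdiff (Theta q k) z.
Proof.
  intros Hq Hk Hz. pose proof (ln_gt_0 q Hq) as HL.
  apply (cdiff_ext (theta (ln q / k))).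
  - intros w. symmetry. now apply Theta_theta.
  - apply cdiff_theta; [now apply Rdiv_lt_0_compat|exact Hz].
Qed.

(** The Gaussian factor of a kernel [1 / Theta], once completed to a square, dominates any
    exponential. *)
Lemma neg_square_le S b y : 0 < S -> - (S * y ^ 2) + b * y <= b ^ 2 / (4 * S).
Proof.
  intros HS. apply Rmult_le_reg_r with (4 * S); [lra|].
  replace (b ^ 2 / (4 * S) * (4 * S)) with (b ^ 2) by (field; lra).
  pose proof (pow2_ge_0 (2 * S * y - b)). nra.
Qed.

Section Laplace.
Context {X : setting}.
Hypothesis q_gt : 1 < q.
Hypothesis tdelta_pos : 0 < tdelta.

(** For [x <= 0] the kernel alone decays, at the price of a factor [e^{-y}]. For [x >= 0] the Gaussian
    of the kernel cancels the growth of [g] and leaves the cross term [k / L * x * y], which is a strong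
    decay once [y] is negative enough. *)
Lemma qLaplace_bound (k a : R) : 0 < k -> 0 <= a -> exists K, 0 < K /\
  forall th g W, 
  (forall x, Rcont (fun x => g (polar x th)) x) ->
  (forall x, Cmod (g (polar x th)) <= W * exp (k / (2 * ln q) * Rmax 0 x ^ 2 + a * Rmax 0 x)) ->
  forall y psi, y <= 0 -> k / ln q * y + a - 1 / 2 <= -1 ->
  (forall r, 0 <= r -> tdelta < Cmod (1 + RtoC r * cis psi)) ->
  Cmod (qLaplace q k th g (polar y (th + psi))) <= K * W * exp (- y).
Proof.
  intros Hk Ha. pose proof (ln_gt_0 q q_gt) as HL. set (L := ln q) in *.
  destruct (Theta_polar_lower q k tdelta q_gt Hk tdelta_pos) as [c [Hc Hth]]. fold L in Hth.
  assert (HkL : 0 < k / L) by (now apply Rdiv_lt_0_compat).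
  set (K0 := (- 3 / 2) ^ 2 / (4 * (k / (2 * L)))).
  assert (HK0 : 0 <= K0).
  { apply Rdiv_le_0_compat; [nra|]. assert (0 < k / (2 * L)) by (apply Rdiv_lt_0_compat; lra). lra. }
  exists (k / L * (2 * (/ c * exp K0))).
  split. { apply Rmult_lt_0_compat; [lra|]. apply Rmult_lt_0_compat; [lra|].
    apply Rmult_lt_0_compat; [now apply Rinv_0_lt_compat|apply exp_pos]. }
  intros th g W Hgc Hg y psi Hy Hdecay Hpsi.
  assert (HW : 0 <= W).
  { pose proof (Hg 0) as H. pose proof (Cmod_ge_0 (g (polar 0 th))).
    pose proof (exp_pos (k / (2 * L) * Rmax 0 0 ^ 2 + a * Rmax 0 0)). nra. }
  set (F := fun u => (g u / Theta q k (u / polar y (th + psi)))%C).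
  assert (Eq : forall x, (polar x th / polar y (th + psi))%C = polar (x - y) (- psi)).
  { intros x. rewrite polar_div. f_equal. ring. }
  assert (Hoff : forall x, off_negative tdelta (polar x (- psi))).
  { intros x. apply off_negative_polar. intros r Hr. rewrite Cmod_1_plus_cis, cos_neg, <- Cmod_1_plus_cis.
    now apply Hpsi. }
  assert (Hlow : forall x, c * exp (k / (2 * L) * (x - y) ^ 2 + (x - y) / 2)
     <= Cmod (Theta q k (polar x th / polar y (th + psi)))).
  { intros x. rewrite Eq. apply Hth, Hoff. }
  assert (HFc : forall x, Rcont (fun x => F (polar x th)) x).
  { intros x. unfold F, Cdiv. apply Ccont_mult; [apply Hgc|]. apply Ccont_inv.
    - apply Cmod_gt_0. eapply Rlt_le_trans; [|apply Hlow]. apply Rmult_lt_0_compat; [lra|apply exp_pos].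
    - apply (continuous_comp (fun x => polar x th * / polar y (th + psi))%C (Theta q k)).
      + apply Ccont_mult; [|apply Ccont_const]. apply Ccont_polar; [apply continuous_id|apply continuous_const].
      + apply cdiff_cont, cdiff_Theta; auto. fold (Cdiv (polar x th) (polar y (th + psi))).
        rewrite Eq. apply polar_neq_0. }
  assert (HFd : forall x, Cmod (F (polar x th)) <= (W * (/ c * exp K0) * exp (- y)) * exp (- (1 * Rabs x))).
  { intros x. unfold F. eapply Rle_trans.
    - apply Cmod_div_le; [apply Hg|]. split; [|apply Hlow]. apply Rmult_lt_0_compat; [lra|apply exp_pos].
    - unfold Rdiv at 1. rewrite Rinv_mult, <- exp_Ropp.
      replace (W * (/ c * exp K0) * exp (- y) * exp (- (1 * Rabs x)))
        with (W * / c * exp (K0 + - y + - Rabs x)) by (rewrite !exp_plus, Rmult_1_l; ring).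
      match goal with |- W * ?A * (/ c * ?B) <= _ => replace (W * A * (/ c * B)) with (W * / c * (A * B)) by ring end.
      rewrite <- exp_plus. apply Rmult_le_compat_l.
      { apply Rmult_le_pos; [exact HW|left; now apply Rinv_0_lt_compat]. }
      apply exp_le_mono. destruct (Rle_dec 0 x) as [Hx|Hx].
      + rewrite Rmax_right, Rabs_pos_eq by lra.
        replace (k / (2 * L) * x ^ 2 + a * x + - (k / (2 * L) * (x - y) ^ 2 + (x - y) / 2))
          with (x * (k / L * y + a - 1 / 2) - k / L * (y * y) / 2 + y / 2) by (field; lra).
        assert (x * (k / L * y + a - 1 / 2) <= x * -1) by (apply Rmult_le_compat_l; lra).
        assert (0 <= k / L * (y * y)) by (apply Rmult_le_pos; [lra|nra]). lra.
      + rewrite Rmax_left, Rabs_left by lra.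
        pose proof (neg_square_le (k / (2 * L)) (- 3 / 2) (x - y) ltac:(apply Rdiv_lt_0_compat; lra)) as H.
        fold K0 in H. lra. }
  destruct (dominated_line_int _ _ 1 HFc Rlt_0_1 HFd) as [J [HJ _]].
  change (qLaplace q k th g (polar y (th + psi))) with
    (RtoC (k / ln q) * ray_int th (fun v => F v / v))%C.
  rewrite (ray_int_log th F _ 1 J HFc Rlt_0_1 HFd HJ).
  pose proof (is_line_int_dominated_bound _ _ 1 J HFc Rlt_0_1 HFd HJ) as HB.
  fold L. rewrite Cmod_mult, Cmod_R, Rabs_pos_eq by lra.
  rewrite !Rmult_assoc. apply Rmult_le_compat_l; [lra|].
  eapply Rle_trans; [exact HB|]. right. field. lra.
Qed.

Lemma weight_pos m : 0 < weight m.
Proof. unfold weight. apply Rmult_lt_0_compat; apply exp_pos. Qed.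

Lemma log_square_bound (kap al r D x : R) (w : C) : 0 < kap -> 0 < r -> 1 <= D -> 0 <= x ->
  r <= Cmod w <= exp x * D ->
  kap / 2 * (ln (Cmod w) ^ 2 / ln q) + al * ln (Cmod w) <=
  kap / (2 * ln q) * x ^ 2 + (kap / ln q * ln D + Rabs al) * x
  + (kap / (2 * ln q) * (ln D ^ 2 + ln r ^ 2) + Rabs al * (ln D + Rabs (ln r))).
Proof.
  intros Hkap Hr HD Hx Hw. pose proof (ln_gt_0 q q_gt) as HL. set (L := ln q) in *.
  assert (H1 : ln r <= ln (Cmod w)) by (apply ln_le_mono; lra).
  assert (H2 : ln (Cmod w) <= x + ln D).
  { rewrite <- (ln_exp x) at 1. rewrite <- ln_mult by (lra || apply exp_pos). apply ln_le_mono; lra. }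
  assert (HD0 : 0 <= ln D) by (rewrite <- ln_1; apply ln_le_mono; lra).
  set (l := ln (Cmod w)) in *. set (M := ln r) in *. set (D' := ln D) in *.
  assert (HlM : Rabs l <= x + D' + Rabs M).
  { apply Rabs_le. pose proof (Rle_abs M). pose proof (Rle_abs (- M)) as H3. rewrite Rabs_Ropp in H3.
    pose proof (Rabs_pos M). lra. }
  assert (Hl2 : l ^ 2 <= (x + D') ^ 2 + M ^ 2).
  { destruct (Rle_dec 0 l) as [Hl|Hl].
    - assert (l ^ 2 <= (x + D') ^ 2) by (apply pow_incr; lra). pose proof (pow2_ge_0 M). lra.
    - assert (l ^ 2 <= M ^ 2) by nra. pose proof (pow2_ge_0 (x + D')). lra. }
  assert (Ha : al * l <= Rabs al * (x + D' + Rabs M)).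
  { eapply Rle_trans; [apply Rle_abs|]. rewrite Rabs_mult. apply Rmult_le_compat_l; [apply Rabs_pos|exact HlM]. }
  assert (Hk : kap / 2 * (l ^ 2 / L) <= kap / (2 * L) * ((x + D') ^ 2 + M ^ 2)).
  { replace (kap / 2 * (l ^ 2 / L)) with (kap / (2 * L) * l ^ 2) by (field; lra).
    apply Rmult_le_compat_l; [|exact Hl2]. left. apply Rdiv_lt_0_compat; lra. }
  replace (kap / (2 * L) * ((x + D') ^ 2 + M ^ 2)) with
    (kap / (2 * L) * x ^ 2 + kap / L * D' * x + kap / (2 * L) * (D' ^ 2 + M ^ 2)) in Hk by (field; lra).
  lra.
Qed.

(** The bound on [wk1] is in terms of [ln |v + dlt|] and blows up at [v = - dlt], which may lie on
    the ray; near that point the mean value property transfers the bound from a circle. *)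
Lemma wk1_ray_bound p : 0 < kappa -> W2 p -> infinite_sector (dir p) (Usec p) ->
  exists W0 a, 0 < W0 /\ 0 <= a /\ forall x m e, Eps p e ->
  Cmod (wk1 p (polar x (dir p)) m e) <=
    (W0 * weight m) * exp (kappa / (2 * ln q) * Rmax 0 x ^ 2 + a * Rmax 0 x).
Proof.
  intros Hkap HW2 Hsec. pose proof (ln_gt_0 q q_gt) as HL.
  destruct (wk1_bound p HW2) as [C1 [dl [HC1 [Hdl Hb]]]].
  destruct (infinite_sector_disc _ _ Hsec) as [c [Hc Hdisc]].
  (* If a point of the ray is within [r / 2] of [- dl], its modulus exceeds [dl / 2], so the disc
     of radius [r] about it lies in the sector; its boundary is at distance at least [r / 2]
     from [- dl]. *)
  set (r := c * (dl / 2)). assert (Hr : 0 < r) by (unfold r; nra).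
  assert (Hr2 : r <= dl / 4) by (unfold r; nra).
  set (D := 1 + dl + r). assert (HD : 1 <= D) by (unfold D; lra).
  set (a := kappa / ln q * ln D + Rabs alpha).
  set (K := kappa / (2 * ln q) * (ln D ^ 2 + ln (r / 2) ^ 2) + Rabs alpha * (ln D + Rabs (ln (r / 2)))).
  assert (HD0 : 0 <= ln D) by (rewrite <- ln_1; apply ln_le_mono; lra).
  exists (C1 * exp K), a. split; [apply Rmult_lt_0_compat; [lra|apply exp_pos]|].
  split. { unfold a. pose proof (Rabs_pos alpha). assert (0 < kappa / ln q) by (now apply Rdiv_lt_0_compat).
    assert (0 <= kappa / ln q * ln D) by (apply Rmult_le_pos; lra). lra. }
  intros x m e He. set (xp := Rmax 0 x). assert (Hxp : 0 <= xp) by apply Rmax_l.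
  assert (Hfar : forall v, Usec p v -> r / 2 <= Cmod (v + RtoC dl) <= exp xp * D ->
    Cmod (wk1 p v m e) <= C1 * exp K * weight m * exp (kappa / (2 * ln q) * xp ^ 2 + a * xp)).
  { intros v Hv Hmod. assert (Hv0 : (v + RtoC dl)%C <> 0) by (apply Cmod_gt_0; lra).
    eapply Rle_trans; [apply (Hb v m e (or_introl Hv) He Hv0)|].
    pose proof (log_square_bound kappa alpha (r / 2) D xp (v + RtoC dl) Hkap ltac:(lra) HD Hxp Hmod) as HB.
    fold a in HB. fold K in HB. apply exp_le_mono in HB. rewrite (exp_plus _ K) in HB.
    pose proof (weight_pos m).
    replace (C1 * exp K * weight m * exp (kappa / (2 * ln q) * xp ^ 2 + a * xp))
      with (C1 * weight m * (exp (kappa / (2 * ln q) * xp ^ 2 + a * xp) * exp K)) by ring.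
    apply Rmult_le_compat_l; [apply Rmult_le_pos; lra|exact HB]. }
  set (v0 := polar x (dir p)).
  assert (Hexp : exp x <= exp xp) by (apply exp_le_mono, Rmax_r).
  assert (E1 : 1 <= exp xp) by (rewrite <- exp_0; now apply exp_le_mono).
  assert (Hv0 : Cmod (v0 + RtoC dl) <= exp xp * (1 + dl)).
  { eapply Rle_trans; [apply Cmod_triangle|]. unfold v0. rewrite Cmod_polar, Cmod_R, Rabs_pos_eq by lra. nra. }
  destruct (Rle_dec (r / 2) (Cmod (v0 + RtoC dl))) as [Hd|Hd].
  - apply Hfar; [now apply infinite_sector_ray|]. split; [exact Hd|].
    eapply Rle_trans; [exact Hv0|]. apply Rmult_le_compat_l; unfold D; lra.
  - apply Rnot_le_lt in Hd.
    assert (Hs : dl / 2 <= exp x).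
    { pose proof (Cmod_triangle (v0 + RtoC dl) (- v0)) as H.
      replace (v0 + RtoC dl + - v0)%C with (RtoC dl) in H by ring.
      rewrite Cmod_R, Rabs_pos_eq, Cmod_opp in H by lra. unfold v0 in H at 2. rewrite Cmod_polar in H. lra. }
    assert (Hin : forall v, Cmod (v - v0) <= r -> Usec p v).
    { intros v Hv. apply (Hdisc x). eapply Rle_trans; [exact Hv|]. unfold r. apply Rmult_le_compat_l; lra. }
    apply (mean_value_bound (fun v => wk1 p v m e) v0 r _ Hr).
    + intros v Hv. apply cdiff_ex_derive. apply (wk1_holomorphic_u p HW2 m e He). left. now apply Hin.
    + intros v Hv. apply Hfar; [apply Hin; lra|]. split.
      * pose proof (Cmod_triangle (v + RtoC dl) (- (v0 + RtoC dl))) as H.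
        replace (v + RtoC dl + - (v0 + RtoC dl))%C with (v - v0)%C in H by ring.
        rewrite Hv, Cmod_opp in H. lra.
      * replace (v + RtoC dl)%C with ((v - v0) + (v0 + RtoC dl))%C by ring.
        eapply Rle_trans; [apply Cmod_triangle|]. rewrite Hv. unfold D. nra.
Qed.

(** [Lwk1] is only polynomially large at [0], which the kernel [1 / Theta] absorbs. *)
Lemma Lwk1_bound p : 0 < kappa -> W2 p -> infinite_sector (dir p) (Usec p) ->
  exists K1 x1, 0 < K1 /\ x1 <= 0 /\ forall y psi m e, Eps p e -> y <= x1 ->
  (forall r, 0 <= r -> tdelta < Cmod (1 + RtoC r * cis psi)) ->
  Cmod (Lwk1 p m e (polar y (dir p + psi))) <= K1 * weight m * exp (- y).
Proof.
  intros Hkap HW2 Hsec. pose proof (ln_gt_0 q q_gt) as HL.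
  destruct (wk1_ray_bound p Hkap HW2 Hsec) as [W0 [a [HW0 [Ha Hw]]]].
  destruct (qLaplace_bound kappa a Hkap Ha) as [K [HK HB]].
  assert (HkL : 0 < kappa / ln q) by (now apply Rdiv_lt_0_compat).
  exists (K * W0), (- ((a + 1 / 2) / (kappa / ln q))).
  split; [now apply Rmult_lt_0_compat|].
  assert (0 <= (a + 1 / 2) / (kappa / ln q)) by (apply Rdiv_le_0_compat; lra).
  split; [lra|]. intros y psi m e He Hy Hpsi. unfold Lwk1.
  replace (K * W0 * weight m) with (K * (W0 * weight m)) by ring.
  apply HB; [| |lra| |exact Hpsi].
  - intros x. apply (Ccont_ray (fun v => wk1 p v m e)). apply cdiff_ex_derive, (wk1_holomorphic_u p HW2 m e He).
    left. now apply infinite_sector_ray.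
  - intros x. now apply Hw.
  - apply (Rmult_le_compat_l (kappa / ln q)) in Hy; [|lra].
    replace (kappa / ln q * - ((a + 1 / 2) / (kappa / ln q))) with (- (a + 1 / 2)) in Hy by (field; lra).
    lra.
Qed.

End Laplace.

(** * Rotation of the initial segment *)

Lemma continuous_on_comp {U V W : UniformSpace} (D : V -> Prop) (f : V -> W) (h : U -> V) (x : U) :
  continuous_on D f -> (forall y, D (h y)) -> continuous h x -> continuous (fun y => f (h y)) x.
Proof.
  intros Hf HD Hh P HP. specialize (Hf (h x) (HD x) P HP). unfold filtermap, within in *.
  specialize (Hh _ Hf). unfold filtermap in Hh. revert Hh. apply filter_imp. intros y Hy. apply Hy, HD.
Qed.

Lemma polar_translate x b y : polar x y = (RtoC (exp (x - b)) * polar b y)%C.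
Proof.
  unfold polar. rewrite Cmult_assoc, <- RtoC_mult, <- exp_plus. do 3 f_equal. ring.
Qed.

Section Estimates.
Context {X : setting}.
Hypothesis Heq : equation_assumptions.
Hypothesis Hgeo : geometry_assumptions.
Hypothesis Hsol : solution_assumptions.

Let Hq : 1 < q := q_gt1 Heq.
Let L_pos : 0 < ln q := ln_gt_0 q (q_gt1 Heq).

Lemma k2_pos : 0 < k2.
Proof. destruct (k_order Heq). lra. Qed.

Lemma kappa_pos : 0 < kappa.
Proof.
  destruct (k_order Heq). unfold kappa. apply Rinv_0_lt_compat.
  assert (/ k2 < / k1) by (apply Rinv_lt_contravar; nra). lra.
Qed.

Lemma kappa_k2 : kappa * k2 / (kappa + k2) = k1.
Proof.
  destruct (k_order Heq). unfold kappa. field. repeat split; try lra.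
  replace (k2 * k1 + k2 * (k2 - k1)) with (k2 * k2) by ring. nra.
Qed.

Lemma weight_le m : weight m <= exp (- (beta * Rabs m)).
Proof.
  unfold weight. replace (- beta * Rabs m) with (- (beta * Rabs m)) by ring.
  rewrite <- (Rmult_1_l (exp (- (beta * Rabs m)))) at 2. apply Rmult_le_compat_r; [left; apply exp_pos|].
  apply Rle_trans with (exp 0); [apply exp_le_mono|rewrite exp_0; lra].
  pose proof (Rabs_pos m). pose proof (mu_pos Heq).
  assert (0 <= ln (1 + Rabs m)) by (rewrite <- ln_1; apply ln_le_mono; lra). nra.
Qed.

Lemma weight_le_1 m : weight m <= 1.
Proof.
  eapply Rle_trans; [apply weight_le|]. rewrite <- exp_0. apply exp_le_mono.
  pose proof (Rabs_pos m). pose proof (beta_pos Heq). nra.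
Qed.

(** Logarithm of the lower bound for the kernel [Theta q k2] at modulus [e^y]. *)
Definition growth (y : R) : R := k2 / (2 * ln q) * y ^ 2 + y / 2.

(** The quadratic terms in [x] cancel; the cross term is largest at [x0] since [b <= 0]. *)
Lemma growth_tail x0 x b : x0 <= x -> b <= 0 ->
  k2 / (2 * ln q) * x ^ 2 + nu * x - growth (x - b) <=
  - ((1 / 2 - nu) * x) + (- (k2 / (2 * ln q)) * b ^ 2 + (1 / 2 + k2 / ln q * x0) * b).
Proof.
  intros Hx Hb. unfold growth. assert (0 < k2 / ln q) by (apply Rdiv_lt_0_compat; [apply k2_pos|exact L_pos]).
  replace (k2 / (2 * ln q)) with (k2 / ln q / 2) by (field; lra).
  set (s := k2 / ln q) in *. assert (s * b * x <= s * b * x0) by (assert (s * b <= 0) by nra; nra). nra.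
Qed.

(** A crude bound, enough for integrability at the vertex and for the vanishing of the small
    arcs. *)
Lemma growth_vertex x b :
  - x - growth (x - b) <= x - 2 * b + (- 5 / 2) ^ 2 / (4 * (k2 / (2 * ln q))).
Proof.
  pose proof (neg_square_le (k2 / (2 * ln q)) (- 5 / 2) (x - b)
    ltac:(apply Rdiv_lt_0_compat; [apply k2_pos|lra])) as H.
  unfold growth. lra.
Qed.

Lemma growth_at x0 b :
  - x0 - growth (x0 - b) = - (k2 / (2 * ln q)) * b ^ 2 + (1 / 2 + k2 / ln q * x0) * b
    + (- (3 / 2) * x0 - k2 / (2 * ln q) * x0 ^ 2).
Proof. unfold growth. field. lra. Qed.

(** The Gaussians of orders [kappa] and [k2] combine to one of order [k1], because
    [1 / k1 = 1 / kappa + 1 / k2]. *)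
Lemma growth_combine x b K :
  - (kappa / (2 * ln q)) * x ^ 2 + K * x - growth (x - b) <=
  x + (- (k1 / (2 * ln q)) * b ^ 2 + ((K - 3 / 2) * (k2 / (kappa + k2)) + 1 / 2) * b
       + (K - 3 / 2) ^ 2 / (4 * ((kappa + k2) / (2 * ln q)))).
Proof.
  pose proof k2_pos. pose proof kappa_pos.
  pose proof (neg_square_le ((kappa + k2) / (2 * ln q)) (K - 3 / 2) (x - k2 * b / (kappa + k2))
    ltac:(apply Rdiv_lt_0_compat; lra)) as H1.
  rewrite <- kappa_k2. unfold growth.
  match type of H1 with ?A <= ?B => set (rhs := B) in * end.
  match goal with |- ?l <= x + (?u + rhs) =>
    replace l with ((- ((kappa + k2) / (2 * ln q) * (x - k2 * b / (kappa + k2)) ^ 2)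
      + (K - 3 / 2) * (x - k2 * b / (kappa + k2))) + (x + u)) by (field; lra) end.
  lra.
Qed.

Section OneDirection.
Variable p : nat.
Hypothesis Hp : (p < vsig)%nat.
Let th := dir p.

(** [Rset (dir p)] is a cone; this is its condition on the angle from [dir p]. *)
Definition seen (psi : R) : Prop := forall r, 0 <= r -> tdelta < Cmod (1 + RtoC r * cis psi).

Lemma seen_mono psi psi' : seen psi -> Rabs psi' <= Rabs psi <= PI -> seen psi'.
Proof.
  intros H Hpsi r Hr. eapply Rlt_le_trans; [apply (H r Hr)|]. now apply Cmod_1_plus_cis_mono.
Qed.

(** All that is used of [Lwk1] near the vertex; [x1] is below the logarithms of the radii of the
    finite sector, of the domain of holomorphy, and of the domain of [Lwk1_bound]. *)
Lemma near_vertex : exists K1 x1, 0 < K1 /\ x1 <= 0 /\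
  forall x psi m e, Eps p e -> x <= x1 -> seen psi ->
    cdiff (Lwk1 p m e) (polar x (th + psi)) /\
    Cmod (Lwk1 p m e (polar x (th + psi))) <= K1 * weight m * exp (- x) /\
    wk2 p (polar x th) m e = Lwk1 p m e (polar x th).
Proof.
  pose proof (tdelta_range Hgeo) as Htd.
  destruct (Lwk1_bound Hq (proj1 Htd) p kappa_pos (u_W2 Hsol p Hp) (Usec_sector Hgeo p Hp)) as [K1 [x1 [HK1 [Hx1 HB]]]].
  pose proof (u_W3 Hsol p Hp) as HW3.
  destruct (Sfin_sector p HW3) as [eta [r0 [Heta [Hr0 HS]]]].
  set (R1 := Rpower q ((1 / 2 - alpha) / kappa) / 2).
  assert (HR1 : 0 < R1) by (unfold R1; assert (0 < Rpower q ((1 / 2 - alpha) / kappa)) by apply exp_pos; lra).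
  set (x1' := Rmin x1 (Rmin (ln (r0 / 2)) (ln (R1 / 2)))).
  assert (E1 : x1' <= x1) by apply Rmin_l.
  assert (E2 : x1' <= ln (r0 / 2)) by (eapply Rle_trans; [apply Rmin_r|apply Rmin_l]).
  assert (E3 : x1' <= ln (R1 / 2)) by (eapply Rle_trans; [apply Rmin_r|apply Rmin_r]).
  exists K1, x1'. split; [exact HK1|]. split; [lra|].
  intros x psi m e He Hx Hpsi.
  assert (X2 : exp x < r0).
  { apply Rle_lt_trans with (exp (ln (r0 / 2))); [apply exp_le_mono; lra|rewrite exp_ln; lra]. }
  assert (X3 : exp x < R1).
  { apply Rle_lt_trans with (exp (ln (R1 / 2))); [apply exp_le_mono; lra|rewrite exp_ln; lra]. }
  split; [|split].
  - apply cdiff_ex_derive, (Lwk1_holomorphic p HW3 R1 m e); [unfold R1 in *; lra|exact He|].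
    split; [now apply Rset_polar|]. unfold disc. now rewrite Cmod_polar.
  - apply (HB x psi m e He); [lra|exact Hpsi].
  - symmetry. apply (Lwk1_eq_wk2 p HW3); [| | | |exact He].
    + apply HS. exists (exp x), th. split; [pose proof (exp_pos x); lra|]. split; [|reflexivity].
      unfold th. rewrite Rminus_diag, Rabs_R0. lra.
    + apply infinite_sector_ray, (Ssec_sector Hgeo p Hp).
    + rewrite <- (Rplus_0_r th). apply Rset_polar. intros r Hr.
      eapply Rlt_le_trans; [apply (Hpsi r Hr)|]. rewrite !Cmod_1_plus_cis. apply sqrt_le_1_alt.
      rewrite cos_0. pose proof (COS_bound psi). nra.
    + rewrite Cmod_polar. exact X3.
Qed.

(** For each time [T] in direction [dir p + psi], the [q]-Laplace integral along [dir p] is the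
    integral of [Lwk1] along the segment in direction [T] itself, up to the arc at
    radius [e^x0] and the tail beyond it. *)
Lemma rotated_ray_int : exists x1, x1 <= 0 /\ forall x0, x0 <= x1 -> exists E, 0 < E /\
  forall b psi e, b <= 0 -> Rabs psi <= PI -> seen psi -> Eps p e ->
  exists J : R -> C,
    (forall m, ray_int th (fun v => wk2 p v m e / Theta q k2 (v / polar b (th + psi)) / v)%C = J m) /\
    (forall m, Rcont J m) /\
    (exists Bd, forall m, Cmod (J m) <= Bd * weight m) /\
    (forall m x, x <= x0 -> cdiff (fun v => Lwk1 p m e v / Theta q k2 (v / polar b (th + psi)))%C
        (polar x (th + psi))) /\
    (forall m eps, 0 < eps -> exists a0, a0 <= x0 /\ forall a, a <= a0 ->
       Cmod (J m - CInt (fun x => Lwk1 p m e (polar x (th + psi))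
                           / Theta q k2 (polar x (th + psi) / polar b (th + psi)))%C a x0) <=
       E * weight m * exp (- (k2 / (2 * ln q)) * b ^ 2 + (1 / 2 + k2 / ln q * x0) * b) + eps).
Proof.
  pose proof (tdelta_range Hgeo) as Htd. pose proof k2_pos as Hk2. pose proof PI_RGT_0 as HPI.
  destruct near_vertex as [K1 [x1 [HK1 [Hx1 Hnear]]]].
  destruct (Theta_polar_lower q k2 tdelta Hq Hk2 (proj1 Htd)) as [c [Hc HTh]].
  pose proof (u_W1 Hsol p Hp) as HW1.
  destruct (wk2_bound p HW1) as [C0 [HC0 Hwk2]].
  exists x1. split; [exact Hx1|]. intros x0 Hx0.
  set (A := 1 / 2 - nu). assert (HA : 0 < A) by (unfold A; pose proof (nu_lt Hgeo); lra).
  set (E1 := C0 / c * (exp (- (A * x0)) / A)).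
  set (E2 := PI * (K1 / c * exp (- (3 / 2) * x0 - k2 / (2 * ln q) * x0 ^ 2))).
  assert (HE1 : 0 < E1).
  { unfold E1. apply Rmult_lt_0_compat; apply Rdiv_lt_0_compat; try lra. apply exp_pos. }
  assert (HE2 : 0 < E2).
  { unfold E2. apply Rmult_lt_0_compat; [lra|]. apply Rmult_lt_0_compat; [apply Rdiv_lt_0_compat; lra|apply exp_pos]. }
  exists (E1 + E2). split; [lra|].
  intros b psi e Hb Hpsi Hseen He. pose proof (Eps_small Hgeo p e Hp He) as Hdisc.
  set (T := polar b (th + psi)).
  set (Q0 := - (k2 / (2 * ln q)) * b ^ 2 + (1 / 2 + k2 / ln q * x0) * b).
  set (F := fun x m => (wk2 p (polar x th) m e / Theta q k2 (polar x th / T))%C).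
  set (G := fun m v => (Lwk1 p m e v / Theta q k2 (v / T))%C).
  assert (Hrot : forall y, Rmin th (th + psi) <= y <= Rmax th (th + psi) ->
     exists psi', y = th + psi' /\ seen psi' /\ seen (psi' - psi)).
  { intros y Hy. exists (y - th). split; [ring|].
    assert (Hy' : Rabs (y - th) <= Rabs psi /\ Rabs (y - th - psi) <= Rabs psi).
    { unfold Rmin, Rmax in Hy. destruct (Rle_dec th (th + psi)); unfold Rabs; repeat destruct Rcase_abs; lra. }
    split; eapply seen_mono; eauto; lra. }
  assert (HTlow : forall x psi', seen (psi' - psi) ->
     c * exp (growth (x - b)) <= Cmod (Theta q k2 (polar x (th + psi') / T))).
  { intros x psi' H. unfold T. rewrite polar_div.
    replace (th + psi' - (th + psi)) with (psi' - psi) by ring. apply HTh, off_negative_polar, H. }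
  assert (HTne : forall x psi', seen (psi' - psi) -> Theta q k2 (polar x (th + psi') / T) <> 0).
  { intros x psi' H. apply Cmod_gt_0. eapply Rlt_le_trans; [|now apply HTlow].
    apply Rmult_lt_0_compat; [exact Hc|apply exp_pos]. }
  assert (HGd : forall m x psi', x <= x0 -> seen psi' -> seen (psi' - psi) -> cdiff (G m) (polar x (th + psi'))).
  { intros m x psi' Hx H1 H2. unfold G, Cdiv. apply cdiff_mult; [apply Hnear; auto; lra|].
    apply cdiff_inv; [now apply HTne|].
    apply (cdiff_comp (Theta q k2) (fun v => v * / T)%C).
    - apply cdiff_mult; [apply cdiff_id|apply cdiff_const].
    - apply cdiff_Theta; auto. apply Cmult_neq_0; [apply polar_neq_0|].
      unfold T. intros E. pose proof (Cinv_r _ (polar_neq_0 b (th + psi))) as HI. rewrite E, Cmult_0_r in HI.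
      apply C1_nz. now symmetry. }
  assert (HGb : forall m x psi', x <= x0 -> seen psi' -> seen (psi' - psi) ->
     Cmod (G m (polar x (th + psi'))) <= K1 / c * weight m * exp (- x - growth (x - b))).
  { intros m x psi' Hx H1 H2. unfold G.
    eapply Rle_trans; [apply Cmod_div_le; [apply (Hnear x psi' m e He); [lra|exact H1]|split; [|now apply HTlow]]|].
    - apply Rmult_lt_0_compat; [exact Hc|apply exp_pos].
    - right. replace (- x - growth (x - b)) with (- x + - growth (x - b)) by ring.
      rewrite exp_plus, (exp_Ropp (growth (x - b))). field. pose proof (exp_pos (growth (x - b))). split; lra. }
  assert (Hseen0 : seen 0) by (eapply seen_mono; [exact Hseen|]; rewrite Rabs_R0; split; [apply Rabs_pos|exact Hpsi]).
  assert (Hseenm : seen (0 - psi)).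
  { eapply seen_mono; [exact Hseen|]. replace (0 - psi) with (- psi) by ring. rewrite Rabs_Ropp. lra. }
  assert (HFG : forall m x, x <= x0 -> F x m = G m (polar x th)).
  { intros m x Hx. unfold F, G. f_equal. apply (Hnear x 0 m e He); [lra|exact Hseen0]. }
  assert (HFt : forall m x, x0 <= x -> Cmod (F x m) <= C0 / c * weight m * exp Q0 * exp (- A * x)).
  { intros m x Hx. unfold F. pose proof (HTlow x 0 Hseenm) as HL0. rewrite Rplus_0_r in HL0.
    pose proof (Hwk2 (polar x th) m e (infinite_sector_ray _ _ x (Ssec_sector Hgeo p Hp)) Hdisc) as HW.
    rewrite Cmod_polar, ln_exp in HW.
    eapply Rle_trans; [apply Cmod_div_le; [exact HW|split; [|exact HL0]]|].
    - apply Rmult_lt_0_compat; [exact Hc|apply exp_pos].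
    - pose proof (growth_tail x0 x b Hx Hb) as HG. fold A in HG. fold Q0 in HG.
      unfold Rdiv at 1. rewrite Rinv_mult, <- exp_Ropp.
      match goal with |- C0 * weight m * ?P * (/ c * ?S) <= _ =>
        replace (C0 * weight m * P * (/ c * S)) with (C0 / c * weight m * (P * S)) by (field; lra) end.
      rewrite !Rmult_assoc, <- !exp_plus. apply Rmult_le_compat_l; [left; apply Rdiv_lt_0_compat; lra|].
      apply Rmult_le_compat_l; [left; apply weight_pos|].
      apply exp_le_mono. lra. }
  (* The integrand decays like [e^x] at the vertex and like [e^(- A x)] at infinity. *)
  set (cc := Rmin A 1). assert (Hcc : 0 < cc) by (apply Rmin_glb_lt; lra).
  assert (HccA : cc <= A) by apply Rmin_l. assert (Hcc1 : cc <= 1) by apply Rmin_r.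
  set (K2 := (- 5 / 2) ^ 2 / (4 * (k2 / (2 * ln q)))).
  set (Bv := K1 / c * exp (- 2 * b + K2)). set (Bt := C0 / c * exp Q0 * exp (- 2 * A * x0)).
  assert (HBv : 0 < Bv) by (apply Rmult_lt_0_compat; [apply Rdiv_lt_0_compat; lra|apply exp_pos]).
  assert (HBt : 0 < Bt).
  { apply Rmult_lt_0_compat; [|apply exp_pos]. apply Rmult_lt_0_compat; [apply Rdiv_lt_0_compat; lra|apply exp_pos]. }
  assert (HGv : forall m x psi', x <= x0 -> seen psi' -> seen (psi' - psi) ->
     Cmod (G m (polar x (th + psi'))) <= Bv * weight m * exp x).
  { intros m x psi' Hx H1 H2. eapply Rle_trans; [now apply HGb|].
    pose proof (growth_vertex x b) as HG. fold K2 in HG. apply exp_le_mono in HG.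
    replace (x - 2 * b + K2) with ((- 2 * b + K2) + x) in HG by ring. rewrite exp_plus in HG.
    unfold Bv. replace (K1 / c * exp (-2 * b + K2) * weight m * exp x)
      with (K1 / c * weight m * (exp (-2 * b + K2) * exp x)) by ring.
    apply Rmult_le_compat_l; [|exact HG]. apply Rmult_le_pos; [left; apply Rdiv_lt_0_compat; lra|left; apply weight_pos]. }
  assert (HFd : forall x m, Cmod (F x m) <= ((Bv + Bt) * weight m) * exp (- (cc * Rabs x))).
  { intros x m. pose proof (weight_pos m) as Hw. pose proof (exp_pos (- (cc * Rabs x))) as He0.
    destruct (Rle_dec x x0) as [Hx|Hx].
    - rewrite HFG by exact Hx. rewrite <- (Rplus_0_r th).
      eapply Rle_trans; [now apply HGv|].
      assert (exp x <= exp (- (cc * Rabs x))).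
      { apply exp_le_mono. rewrite Rabs_left1 by lra. nra. }
      apply Rmult_le_compat; [nra|left; apply exp_pos|nra|exact H].
    - eapply Rle_trans; [apply HFt; lra|].
      assert (HX : exp (- A * x) <= exp (- 2 * A * x0) * exp (- (cc * Rabs x))).
      { rewrite <- exp_plus. apply exp_le_mono.
        destruct (Rle_dec 0 x); [rewrite Rabs_pos_eq by lra|rewrite Rabs_left by lra]; nra. }
      assert (0 < C0 / c * weight m * exp Q0).
      { apply Rmult_lt_0_compat; [|apply exp_pos]. apply Rmult_lt_0_compat; [apply Rdiv_lt_0_compat; lra|exact Hw]. }
      apply Rle_trans with (C0 / c * weight m * exp Q0 * (exp (- 2 * A * x0) * exp (- (cc * Rabs x)))).
      { apply Rmult_le_compat_l; lra. }
      replace (C0 / c * weight m * exp Q0 * (exp (- 2 * A * x0) * exp (- (cc * Rabs x))))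
        with (Bt * weight m * exp (- (cc * Rabs x))) by (unfold Bt; ring).
      apply Rmult_le_compat_r; [lra|]. nra. }
  assert (HFc2 : forall x m, Ccont (fun xm : R * R => F (fst xm) (snd xm)) (x, m)).
  { intros x m. unfold F, Cdiv. apply Ccont_mult.
    - apply (continuous_on_comp _ _ (fun xm : R * R => ((polar (fst xm) th, snd xm), e)) (x, m) (wk2_continuous p HW1)).
      + intros y. simpl. split; [|exact Hdisc]. apply infinite_sector_ray, (Ssec_sector Hgeo p Hp).
      + apply continuous_pair; [|apply continuous_const]. apply continuous_pair; [|apply continuous_snd].
        apply Ccont_polar; [apply continuous_fst|apply continuous_const].
    - apply Ccont_inv.
      + rewrite <- (Rplus_0_r th). now apply HTne.
      + apply (continuous_comp (fun xm : R * R => polar (fst xm) th * / T)%C (Theta q k2)).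
        * apply Ccont_mult; [|apply Ccont_const]. apply Ccont_polar; [apply continuous_fst|apply continuous_const].
        * apply cdiff_cont, cdiff_Theta; auto. simpl fst. apply Cmult_neq_0; [apply polar_neq_0|].
          unfold T. intros E. pose proof (Cinv_r _ (polar_neq_0 b (th + psi))) as HI. rewrite E, Cmult_0_r in HI.
          apply C1_nz. now symmetry. }
  assert (HFc : forall m x, Rcont (fun x => F x m) x).
  { intros m x. apply (Ccont_slice F), HFc2. }
  assert (HJ : forall m, exists J, is_line_int (fun x => F x m) J /\ forall a b', a <= 0 <= b' ->
     Cmod (J - CInt (fun x => F x m) a b') <= (Bv + Bt) * weight m / cc * exp (cc * a)
       + (Bv + Bt) * weight m / cc * exp (- (cc * b'))).
  { intros m. apply (dominated_line_int (fun x => F x m) ((Bv + Bt) * weight m) cc (HFc m) Hcc).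
    intros x. apply HFd. }
  exists (fun m => line_int (fun x => F x m)).
  assert (HJ1 : forall m, is_line_int (fun x => F x m) (line_int (fun x => F x m))).
  { intros m. destruct (HJ m) as [J [H _]]. now rewrite (line_int_unique _ _ H). }
  split; [|split; [|split; [|split]]].
  - intros m. apply (ray_int_log th (fun v => wk2 p v m e / Theta q k2 (v / T))%C ((Bv + Bt) * weight m) cc).
    + apply HFc.
    + exact Hcc.
    + intros x. apply HFd.
    + apply HJ1.
  - apply (line_int_param_cont F _ (Bv + Bt) cc HFc2 Hcc); [|exact HJ1].
    intros x m. eapply Rle_trans; [apply HFd|]. apply Rmult_le_compat_r; [left; apply exp_pos|].
    pose proof (weight_le_1 m). nra.
  - exists (2 * (Bv + Bt) / cc). intros m.
    eapply Rle_trans; [apply (is_line_int_dominated_bound (fun x => F x m) ((Bv + Bt) * weight m) cc _ (HFc m) Hcc)|].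
    + intros x. apply HFd.
    + apply HJ1.
    + right. field. lra.
  - intros m x Hx. apply HGd; [exact Hx|exact Hseen|].
    replace (psi - psi) with 0 by ring. exact Hseen0.
  - intros m eps Heps. destruct (HJ m) as [J [HJm Hrate]]. rewrite (line_int_unique _ _ HJm).
    pose proof (weight_pos m) as Hw.
    set (Kt := 2 * ((Bv + Bt) * weight m / cc) + PI * (Bv * weight m)).
    assert (HKt : 0 <= Kt).
    { unfold Kt. assert (0 <= (Bv + Bt) * weight m / cc) by (apply Rdiv_le_0_compat; [nra|lra]).
      assert (0 <= PI * (Bv * weight m)) by (apply Rmult_le_pos; [lra|nra]). lra. }
    destruct (exp_tail_small cc Hcc Kt eps HKt Heps) as [M [HM HMt]].
    (* The ray is truncated symmetrically at [a] and [- a]; the arc at [a] also vanishes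
       as [a] goes to minus infinity. *)
    exists (Rmin x0 (- M)). split; [apply Rmin_l|]. intros a Ha.
    pose proof (Rmin_l x0 (- M)). pose proof (Rmin_r x0 (- M)).
    assert (Hax : a <= x0) by lra. assert (HaM : a <= - M) by lra.
    pose proof (HMt (- a) ltac:(lra)) as HMa. replace (- (cc * - a)) with (cc * a) in HMa by ring.
    pose proof (Hrate a (- a) ltac:(lra)) as HR. replace (- (cc * - a)) with (cc * a) in HR by ring.
    assert (Htail : Cmod (CInt (fun x => F x m) x0 (- a)) <= E1 * weight m * exp Q0).
    { eapply Rle_trans.
      - apply (is_CInt_norm (fun x => F x m) (fun x => C0 / c * weight m * exp Q0 * exp (- A * x)) x0 (- a));
          [lra| | |apply is_RInt_exp_scaled; lra].
        + intros x Hx. apply HFt. lra.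
        + apply CInt_correct, ex_CInt_Rcont, HFc.
      - unfold E1.
        replace (C0 / c * weight m * exp Q0 / - A * (exp (- A * - a) - exp (- A * x0)))
          with (C0 / c * weight m * exp Q0 / A * exp (- A * x0) - C0 / c * weight m * exp Q0 / A * exp (- A * - a))
          by (field; lra).
        replace (C0 / c * (exp (- (A * x0)) / A) * weight m * exp Q0)
          with (C0 / c * weight m * exp Q0 / A * exp (- A * x0)).
        2:{ replace (- A * x0) with (- (A * x0)) by ring. field. lra. }
        assert (0 <= C0 / c * weight m * exp Q0 / A * exp (- A * - a)).
        { apply Rmult_le_pos; [|left; apply exp_pos]. left. apply Rdiv_lt_0_compat; [|exact HA].
          apply Rmult_lt_0_compat; [|apply exp_pos]. apply Rmult_lt_0_compat; [apply Rdiv_lt_0_compat; lra|exact Hw]. }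
        lra. }
    assert (Harc : Cmod (CInt (fun x => G m (polar x th)) a x0 - CInt (fun x => G m (polar x (th + psi))) a x0)
      <= PI * (Bv * weight m * exp a + K1 / c * weight m * exp (- x0 - growth (x0 - b)))).
    { eapply Rle_trans.
      - apply (rotate_segment (G m) a x0 th (th + psi) (Bv * weight m * exp a)
          (K1 / c * weight m * exp (- x0 - growth (x0 - b))) Hax).
        + intros x y Hx Hy. destruct (Hrot y Hy) as [psi' [-> [H1 H2]]]. apply HGd; auto; lra.
        + intros y Hy. destruct (Hrot y Hy) as [psi' [-> [H1 H2]]]. apply HGv; auto.
        + intros y Hy. destruct (Hrot y Hy) as [psi' [-> [H1 H2]]]. apply HGb; auto. lra.
      - replace (th + psi - th) with psi by ring. apply Rmult_le_compat_r; [|exact Hpsi].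
        assert (0 <= Bv * weight m * exp a) by (apply Rmult_le_pos; [nra|left; apply exp_pos]).
        assert (0 <= K1 / c * weight m * exp (- x0 - growth (x0 - b))).
        { apply Rmult_le_pos; [|left; apply exp_pos]. apply Rmult_le_pos; [left; apply Rdiv_lt_0_compat; lra|lra]. }
        lra. }
    assert (EFG : CInt (fun x => F x m) a x0 = CInt (fun x => G m (polar x th)) a x0).
    { apply (RInt_ext (V := C_R_CompleteNormedModule)). intros x Hx. apply HFG.
      rewrite Rmin_left, Rmax_right in Hx by lra. lra. }
    rewrite (CInt_Chasles (fun x => F x m) a x0 (- a)), EFG in HR by (apply ex_CInt_Rcont, HFc).
    set (I1 := CInt (fun x => G m (polar x th)) a x0) in *.
    set (I2 := CInt (fun x => F x m) x0 (- a)) in *.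
    change (Cmod (J - CInt (fun x => G m (polar x (th + psi))) a x0) <= (E1 + E2) * weight m * exp Q0 + eps).
    set (I3 := CInt (fun x => G m (polar x (th + psi))) a x0) in *.
    replace (J - I3)%C with ((J - (I1 + I2)) + ((I1 - I3) + I2))%C by ring.
    eapply Rle_trans; [apply Cmod_triangle|].
    eapply Rle_trans; [apply Rplus_le_compat_l, Cmod_triangle|].
    rewrite growth_at in Harc. fold Q0 in Harc. rewrite exp_plus in Harc.
    replace (PI * (Bv * weight m * exp a + K1 / c * weight m *
       (exp Q0 * exp (- (3 / 2) * x0 - k2 / (2 * ln q) * x0 ^ 2))))
      with (PI * (Bv * weight m) * exp a + E2 * weight m * exp Q0) in Harc by (unfold E2; ring).
    assert (Hea : exp a <= exp (cc * a)) by (apply exp_le_mono; nra).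
    assert (Hea2 : PI * (Bv * weight m) * exp a <= PI * (Bv * weight m) * exp (cc * a)).
    { apply Rmult_le_compat_l; [|exact Hea]. apply Rmult_le_pos; [lra|nra]. }
    unfold Kt in HMa. lra.
Qed.

End OneDirection.
End Estimates.

(** * Difference of consecutive solutions *)

Section Difference.
Context {X : setting}.
Hypothesis Heq : equation_assumptions.
Hypothesis Hgeo : geometry_assumptions.
Hypothesis Hsol : solution_assumptions.

Definition inner_int (p : nat) (t e : C) (m : R) : C :=
  ray_int (dir p) (fun v => wk2 p v m e / Theta q k2 (v / (e * t)) / v)%C.

Lemma next_lt p : (p < vsig)%nat -> (next p < vsig)%nat.
Proof. intros Hp. apply Nat.mod_upper_bound. lia. Qed.

Lemma ln_Rb th T : Rbset th T -> T <> 0 /\ ln (Cmod T) < 0.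
Proof.
  intros [[HT _] Hd]. split; [exact HT|]. unfold disc in Hd.
  pose proof (eps0_range Heq). pose proof (rTau_range Hgeo).
  rewrite <- ln_1. apply ln_increasing; [now apply Cmod_gt_0|]. nra.
Qed.

(** After the rotation both integrals run over the segment in the direction of [T]; the estimates
    for tails and arcs enter through [E1] and [E1'], the segment through [ES]. *)
Lemma inner_int_difference p : (p < vsig)%nat -> Usec_disjoint p ->
  exists E K, 0 < E /\ forall t e, Tau t -> Eps p e -> Eps (next p) e ->
  (forall m, Rcont (inner_int p t e) m) /\ (forall m, Rcont (inner_int (next p) t e) m) /\
  (exists B, forall m, Cmod (inner_int p t e m) <= B * weight m) /\
  (exists B, forall m, Cmod (inner_int (next p) t e m) <= B * weight m) /\
  forall m, Cmod (inner_int (next p) t e m - inner_int p t e m) <=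
    E * weight m * exp (- (k1 / (2 * ln q)) * ln (Cmod (e * t)) ^ 2 + K * ln (Cmod (e * t))).
Proof.
  intros Hp Hdisj. pose proof (next_lt p Hp) as Hp'.
  pose proof (tdelta_range Hgeo) as Htd. pose proof (k2_pos Heq) as Hk2. pose proof (kappa_pos Heq) as Hkap.
  pose proof (q_gt1 Heq) as Hq. pose proof (ln_gt_0 q Hq) as HL.
  destruct (u_W4 Hsol p Hp Hdisj) as [K31 [K41 [HK31 HW4]]].
  destruct (rotated_ray_int Heq Hgeo Hsol p Hp) as [x1 [Hx1 H1]].
  destruct (rotated_ray_int Heq Hgeo Hsol (next p) Hp') as [x1' [Hx1' H1']].
  destruct (Theta_polar_lower q k2 tdelta Hq Hk2 (proj1 Htd)) as [c [Hc HTh]].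
  assert (Hrad : 0 < eps0 * rTau).
  { pose proof (eps0_range Heq). pose proof (rTau_range Hgeo). apply Rmult_lt_0_compat; lra. }
  set (x0 := Rmin (Rmin x1 x1') (ln (eps0 * rTau / 2))).
  assert (X1 : x0 <= x1) by (eapply Rle_trans; [apply Rmin_l|apply Rmin_l]).
  assert (X2 : x0 <= x1') by (eapply Rle_trans; [apply Rmin_l|apply Rmin_r]).
  assert (X3 : x0 <= ln (eps0 * rTau / 2)) by apply Rmin_r.
  destruct (H1 x0 X1) as [E1 [HE1 HJ]]. destruct (H1' x0 X2) as [E1' [HE1' HJ']]. clear H1 H1'.
  set (KE := 1 / 2 + k2 / ln q * x0).
  set (KS := (K41 - 3 / 2) * (k2 / (kappa + k2)) + 1 / 2).
  set (CS := (K41 - 3 / 2) ^ 2 / (4 * ((kappa + k2) / (2 * ln q)))).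
  set (ES := K31 / c * exp CS).
  assert (HES : 0 < ES) by (apply Rmult_lt_0_compat; [apply Rdiv_lt_0_compat; lra|apply exp_pos]).
  exists (E1 + E1' + ES), (Rmin KE KS). split; [lra|].
  intros t e Ht He He'. set (T := (e * t)%C).
  pose proof (Rb_contains Hgeo p t e Hp Ht He) as HR. fold T in HR.
  pose proof (Rb_contains Hgeo (next p) t e Hp' Ht He') as HR'. fold T in HR'.
  destruct (ln_Rb _ _ HR) as [HT0 Hb]. set (b := ln (Cmod T)) in *.
  destruct (polar_form T (dir p) HT0) as [psi [Hpsi ET]]. fold b in ET.
  destruct (polar_form T (dir (next p)) HT0) as [psi' [Hpsi' ET']]. fold b in ET'.
  assert (Hseen : seen psi).
  { refine (proj1 (Rset_polar (dir p) b psi) _). rewrite <- ET. apply HR. }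
  assert (Hseen' : seen psi').
  { refine (proj1 (Rset_polar (dir (next p)) b psi') _). rewrite <- ET'. apply HR'. }
  destruct (HJ b psi e ltac:(lra) Hpsi Hseen He) as [J [J1 [J2 [J3 [J4 J5]]]]].
  destruct (HJ' b psi' e ltac:(lra) Hpsi' Hseen' He') as [J' [J1' [J2' [J3' [J4' J5']]]]].
  clear HJ HJ'.
  rewrite <- ET in J1, J4, J5. rewrite <- ET' in J1', J4', J5'.
  assert (EJ : forall m, inner_int p t e m = J m) by (intros m; apply J1).
  assert (EJ' : forall m, inner_int (next p) t e m = J' m) by (intros m; apply J1').
  split; [|split; [|split; [|split]]].
  { intros m. apply (continuous_ext J); [intros; symmetry; apply EJ|apply J2]. }
  { intros m. apply (continuous_ext J'); [intros; symmetry; apply EJ'|apply J2']. }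
  { destruct J3 as [B HB]. exists B. intros m. rewrite EJ. apply HB. }
  { destruct J3' as [B HB]. exists B. intros m. rewrite EJ'. apply HB. }
  intros m. rewrite EJ, EJ'. pose proof (weight_pos m) as Hw.
  set (phi := dir p + psi) in *.
  (* The two angles differ by a multiple of [2 * PI]: both directions are that of [T]. *)
  assert (Ephi : forall x, polar x (dir (next p) + psi') = polar x phi).
  { intros x. rewrite (polar_translate x b), (polar_translate x b phi), <- ET, <- ET'. reflexivity. }
  set (G := fun x => (Lwk1 p m e (polar x phi) / Theta q k2 (polar x phi / T))%C).
  set (G' := fun x => (Lwk1 (next p) m e (polar x phi) / Theta q k2 (polar x phi / T))%C).
  assert (HGc : forall x, x <= x0 -> Rcont G x).
  { intros x Hx. exact (Ccont_ray (fun v => Lwk1 p m e v / Theta q k2 (v / T))%C x phi (J4 m x Hx)). }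
  assert (HGc' : forall x, x <= x0 -> Rcont G' x).
  { intros x Hx. pose proof (J4' m x Hx) as HC. rewrite Ephi in HC.
    exact (Ccont_ray (fun v => Lwk1 (next p) m e v / Theta q k2 (v / T))%C x phi HC). }
  assert (HRx : forall x, x <= x0 -> Rbset (dir p) (polar x phi) /\ Rbset (dir (next p)) (polar x phi)).
  { intros x Hx. assert (Hd : disc (eps0 * rTau) (polar x phi)).
    { unfold disc. rewrite Cmod_polar. apply Rle_lt_trans with (exp (ln (eps0 * rTau / 2))).
      - apply exp_le_mono. lra.
      - rewrite exp_ln; lra. }
    split; split; auto.
    - now apply Rset_polar.
    - rewrite <- Ephi. now apply Rset_polar. }
  set (QS := - (k1 / (2 * ln q)) * b ^ 2 + KS * b).
  assert (HGG : forall x, x <= x0 -> Cmod (G' x - G x) <= ES * weight m * exp QS * exp (1 * x)).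
  { intros x Hx. unfold G, G'.
    replace (Lwk1 (next p) m e (polar x phi) / Theta q k2 (polar x phi / T)
       - Lwk1 p m e (polar x phi) / Theta q k2 (polar x phi / T))%C
      with ((Lwk1 (next p) m e (polar x phi) - Lwk1 p m e (polar x phi)) / Theta q k2 (polar x phi / T))%C
      by (unfold Cdiv; ring).
    destruct (HRx x Hx) as [R1 R2].
    pose proof (HW4 (polar x phi) m e R1 R2 He He') as HD.
    rewrite Cmod_polar in HD. unfold Rpower in HD. rewrite ln_exp in HD.
    eapply Rle_trans; [apply Cmod_div_le; [exact HD|split]|].
    - apply Rmult_lt_0_compat; [exact Hc|apply exp_pos].
    - rewrite ET, polar_div. fold phi. replace (phi - phi) with 0 by ring.
      apply (HTh (x - b)). apply off_negative_polar. intros r Hr.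
      apply (seen_mono psi 0 Hseen); [rewrite Rabs_R0; split; [apply Rabs_pos|exact Hpsi]|exact Hr].
    - pose proof (growth_combine Heq x b K41) as HG. fold KS in HG. fold CS in HG. fold QS in HG.
      unfold growth in HG.
      unfold Rdiv at 1. rewrite Rinv_mult, <- exp_Ropp.
      match goal with |- K31 * weight m * ?P * ?R * (/ c * ?S) <= _ =>
        replace (K31 * weight m * P * R * (/ c * S)) with (K31 / c * weight m * (P * R * S)) by (field; lra) end.
      rewrite <- !exp_plus.
      unfold ES. rewrite Rmult_1_l.
      replace (K31 / c * exp CS * weight m * exp QS * exp x) with
        (K31 / c * weight m * exp (x + (QS + CS))) by (rewrite !exp_plus; ring).
      apply Rmult_le_compat_l; [apply Rmult_le_pos; [left; apply Rdiv_lt_0_compat; lra|lra]|].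
      apply exp_le_mono. lra. }
  set (QE := - (k2 / (2 * ln q)) * b ^ 2 + KE * b).
  assert (Hmain : Cmod (J' m - J m) <= (E1 + E1') * weight m * exp QE + ES * weight m * exp QS).
  { apply le_epsilon. intros eps Heps.
    destruct (J5 m (eps / 2) ltac:(lra)) as [a0 [Ha0 HA]].
    destruct (J5' m (eps / 2) ltac:(lra)) as [a0' [Ha0' HA']].
    set (a := Rmin a0 a0'). assert (A1 : a <= a0) by apply Rmin_l. assert (A2 : a <= a0') by apply Rmin_r.
    specialize (HA a A1). specialize (HA' a A2).
    change (Cmod (J m - CInt G a x0) <= E1 * weight m * exp QE + eps / 2) in HA.
    assert (EG' : CInt (fun x => Lwk1 (next p) m e (polar x (dir (next p) + psi'))
        / Theta q k2 (polar x (dir (next p) + psi') / T))%C a x0 = CInt G' a x0).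
    { apply (RInt_ext (V := C_R_CompleteNormedModule)). intros x _. unfold G'. now rewrite Ephi. }
    rewrite EG' in HA'. change (Cmod (J' m - CInt G' a x0) <= E1' * weight m * exp QE + eps / 2) in HA'.
    assert (HI : Cmod (CInt G' a x0 - CInt G a x0) <= ES * weight m * exp QS).
    { eapply Rle_trans.
      - apply (is_CInt_norm (fun x => G' x - G x)%C (fun x => ES * weight m * exp QS * exp (1 * x)) a x0); [lra| | |apply is_RInt_exp_scaled; lra].
        + intros x Hx. apply HGG. lra.
        + apply is_CInt_minus; apply CInt_correct, ex_CInt_cont; intros x Hx;
            rewrite Rmin_left, Rmax_right in Hx by lra; [apply HGc'|apply HGc]; lra.
      - rewrite !Rmult_1_l. rewrite Rdiv_1_r.
        assert (exp x0 <= 1) by (rewrite <- exp_0; apply exp_le_mono; lra).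
        pose proof (exp_pos a). pose proof (exp_pos QS).
        rewrite <- (Rmult_1_r (ES * weight m * exp QS)) at 2. apply Rmult_le_compat_l; [|lra].
        apply Rmult_le_pos; [nra|lra]. }
    replace (J' m - J m)%C with ((J' m - CInt G' a x0) + ((CInt G' a x0 - CInt G a x0) + - (J m - CInt G a x0)))%C by ring.
    eapply Rle_trans; [apply Cmod_triangle|].
    eapply Rle_trans; [apply Rplus_le_compat_l, Cmod_triangle|]. rewrite Cmod_opp. lra. }
  set (Q0 := - (k1 / (2 * ln q)) * b ^ 2 + Rmin KE KS * b).
  destruct (k_order Heq) as [Hk1 Hk12].
  assert (B1 : exp QE <= exp Q0).
  { apply exp_le_mono. unfold QE, Q0. pose proof (Rmin_l KE KS).
    assert (k1 / (2 * ln q) <= k2 / (2 * ln q)).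
    { unfold Rdiv. apply Rmult_le_compat_r; [left; apply Rinv_0_lt_compat; lra|lra]. }
    pose proof (pow2_ge_0 b). nra. }
  assert (B2 : exp QS <= exp Q0).
  { apply exp_le_mono. unfold QS, Q0. pose proof (Rmin_r KE KS). nra. }
  eapply Rle_trans; [exact Hmain|].
  replace ((E1 + E1' + ES) * weight m * exp Q0) with ((E1 + E1') * weight m * exp Q0 + ES * weight m * exp Q0) by ring.
  apply Rplus_le_compat; apply Rmult_le_compat_l; try assumption; nra.
Qed.

Lemma Cmod_Cexp z : Cmod (Cexp z) = exp (Re z).
Proof. destruct z as [x y]. rewrite <- polar_Cexp. apply Cmod_polar. Qed.

(** Integration over [m]: the factor [exp (beta' |m|)] coming from [z] in the strip is absorbed by
    the weight. *)
Lemma u_difference beta' p : 0 < beta' < beta -> (p < vsig)%nat -> Usec_disjoint p ->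
  exists K3 K4, 0 < K3 /\ forall t z e, Tau t -> strip beta' z -> Eps p e -> Eps (next p) e ->
  Cmod (u (next p) t z e - u p t z e) <=
    K3 * exp (- (k1 / (2 * ln q)) * ln (Cmod (e * t)) ^ 2 + K4 * ln (Cmod (e * t))).
Proof.
  intros Hbeta Hp Hdisj. pose proof (next_lt p Hp) as Hp'.
  pose proof (q_gt1 Heq) as Hq. pose proof (ln_gt_0 q Hq) as HL. pose proof (k2_pos Heq) as Hk2.
  destruct (inner_int_difference p Hp Hdisj) as [E [K [HE H]]].
  set (P := (RtoC (/ sqrt (2 * PI)) * RtoC (k2 / ln q))%C).
  assert (HP : 0 < Cmod P).
  { apply Cmod_gt_0, Cmult_neq_0; apply RtoC_neq_0.
    - apply Rinv_neq_0_compat. assert (0 < sqrt (2 * PI)) by (apply sqrt_lt_R0; pose proof PI_RGT_0; lra). lra.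
    - assert (0 < k2 / ln q) by (now apply Rdiv_lt_0_compat). lra. }
  exists (Cmod P * (2 * E / (beta - beta'))), K.
  split; [apply Rmult_lt_0_compat; [exact HP|apply Rdiv_lt_0_compat; lra]|].
  intros t z e Ht Hz He He'.
  destruct (H t e Ht He He') as [C1 [C2 [[B1 D1] [[B2 D2] HD]]]]. clear H.
  assert (Hz' : strip beta z) by (unfold strip in *; lra).
  set (S := exp (- (k1 / (2 * ln q)) * ln (Cmod (e * t)) ^ 2 + K * ln (Cmod (e * t)))) in *.
  set (ex := fun m : R => Cexp (Ci * z * RtoC m)%C).
  assert (Hex : forall m, Cmod (ex m) <= exp (beta' * Rabs m)).
  { intros m. unfold ex. rewrite Cmod_Cexp. apply exp_le_mono.
    replace (Re (Ci * z * RtoC m)%C) with (- (Im z * m)) by (destruct z; simpl; ring).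
    eapply Rle_trans; [apply Rle_abs|]. rewrite Rabs_Ropp, Rabs_mult.
    apply Rmult_le_compat_r; [apply Rabs_pos|]. unfold strip in Hz. lra. }
  assert (Hexc : forall m, Rcont ex m).
  { intros m. unfold ex. apply Ccont_Cexp, Ccont_mult; [apply Ccont_const|apply Ccont_RtoC, continuous_id]. }
  assert (Hdom : forall (f : R -> C) B, (forall m, Cmod (f m) <= B * weight m) ->
     forall m, Cmod (f m * ex m)%C <= B * exp (- ((beta - beta') * Rabs m))).
  { intros f B Hf m. rewrite Cmod_mult.
    replace (- ((beta - beta') * Rabs m)) with (- (beta * Rabs m) + beta' * Rabs m) by ring.
    rewrite exp_plus, <- Rmult_assoc.
    assert (HB : 0 <= B).
    { pose proof (Hf 0). pose proof (Cmod_ge_0 (f 0)). pose proof (weight_pos 0). nra. }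
    apply Rmult_le_compat; try apply Cmod_ge_0; [|apply Hex].
    eapply Rle_trans; [apply Hf|]. apply Rmult_le_compat_l; [exact HB|apply (weight_le Heq)]. }
  assert (Hbb : 0 < beta - beta') by lra.
  destruct (dominated_line_int (fun m => inner_int p t e m * ex m)%C B1 (beta - beta')
    (fun m => Ccont_mult _ _ _ (C1 m) (Hexc m)) Hbb (Hdom _ _ D1)) as [I1 [HI1 _]].
  destruct (dominated_line_int (fun m => inner_int (next p) t e m * ex m)%C B2 (beta - beta')
    (fun m => Ccont_mult _ _ _ (C2 m) (Hexc m)) Hbb (Hdom _ _ D2)) as [I2 [HI2 _]].
  assert (U1 : u p t z e = (P * I1)%C).
  { rewrite (u_formula Hsol p t z e Hp Ht Hz' He). fold P. f_equal. exact (line_int_unique _ _ HI1). }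
  assert (U2 : u (next p) t z e = (P * I2)%C).
  { rewrite (u_formula Hsol (next p) t z e Hp' Ht Hz' He'). fold P. f_equal. exact (line_int_unique _ _ HI2). }
  assert (HI : is_line_int (fun m => inner_int (next p) t e m * ex m - inner_int p t e m * ex m)%C (I2 - I1)%C).
  { exact (is_RInt_gen_minus (V := C_R_NormedModule) _ _ _ _ HI2 HI1). }
  rewrite U1, U2. replace (P * I2 - P * I1)%C with (P * (I2 - I1))%C by ring.
  rewrite Cmod_mult, Rmult_assoc. apply Rmult_le_compat_l; [lra|].
  replace (2 * E / (beta - beta') * S) with (2 * (E * S) / (beta - beta')) by (field; lra).
  apply (is_line_int_dominated_bound (fun m => inner_int (next p) t e m * ex m - inner_int p t e m * ex m)%C
    (E * S) (beta - beta') _); [|exact Hbb| |exact HI].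
  - intros m. apply Ccont_minus; apply Ccont_mult; auto.
  - intros m.
    replace (inner_int (next p) t e m * ex m - inner_int p t e m * ex m)%C
      with ((inner_int (next p) t e m - inner_int p t e m) * ex m)%C by ring.
    apply (Hdom (fun m => inner_int (next p) t e m - inner_int p t e m)%C). intros m'.
    eapply Rle_trans; [apply HD|]. right. ring.
Qed.

End Difference.

Theorem proposition3 (X : setting)
  (Heq : equation_assumptions) (Hgeo : geometry_assumptions)
  (Hsol : solution_assumptions)
  (beta' : R) (Hbeta' : 0 < beta' < beta)
  (p : nat) (Hp : (p < vsig)%nat) (Hdisj : Usec_disjoint p) :
  (exists K3 K4 : R, 0 < K3 /\
    forall t z e : C, Tau t -> strip beta' z -> Eps p e -> Eps (next p) e ->
    Cmod (u (next p) t z e - u p t z e)%C <=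
      K3 * exp (- (k1 / (2 * ln q)) * ln (Cmod (e * t)%C) ^ 2)
      * Rpower (Cmod (e * t)%C) K4)
  /\
  (exists K3 K4 : R, 0 < K3 /\
    forall t z e : C, Tau t -> strip beta' z -> Eps p e -> Eps (next p) e ->
    forall N : nat,
    Cmod (u (next p) t z e - u p t z e)%C <=
      K3 * Rpower q (K4 ^ 2 / (2 * k1)) * Rpower q (- (K4 / k1)) ^ N
      * Rpower q (INR N ^ 2 / (2 * k1)) * Cmod (e * t)%C ^ N).
Proof.
  destruct (u_difference Heq Hgeo Hsol beta' p Hbeta' Hp Hdisj) as [K3 [K4 [HK3 H]]].
  split; exists K3, K4; (split; [exact HK3|]); intros t z e Ht Hz He He'.
  - eapply Rle_trans; [now apply H|]. right. rewrite exp_plus. unfold Rpower. ring.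
  - intros N. eapply Rle_trans; [now apply H|].
    pose proof (q_gt1 Heq) as Hq. pose proof (ln_gt_0 q Hq) as HL. destruct (k_order Heq) as [Hk1 _].
    assert (HT : 0 < Cmod (e * t)).
    { apply Cmod_gt_0. exact (proj1 (proj1 (Rb_contains Hgeo p t e Hp Ht He))). }
    set (b := ln (Cmod (e * t))).
    replace (Cmod (e * t)) with (exp b) by (now apply exp_ln).
    unfold Rpower. rewrite !pow_exp, !Rmult_assoc, <- !exp_plus.
    apply Rmult_le_compat_l; [lra|]. apply exp_le_mono.
    pose proof (neg_square_le (k1 / (2 * ln q)) (K4 - INR N) b ltac:(apply Rdiv_lt_0_compat; lra)) as HS.
    replace ((K4 - INR N) ^ 2 / (4 * (k1 / (2 * ln q)))) with
      (K4 ^ 2 / (2 * k1) * ln q + (INR N * (- (K4 / k1) * ln q) + INR N ^ 2 / (2 * k1) * ln q)) in HS by (field; lra).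
    lra.
Qed.
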